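(* Let $X$ be a projective K3 surface with a symplectic automorphism $\tau$ of order $4$ and $\mathrm{rk}(NS(X))=15$, let $L$ be the ample class generating $\Omega_4^{\perp_{NS(X)}}$, let $\tilde Y$ be the minimal resolution of $X/\tau$, and let $\pi_4:X\dashrightarrow\tilde Y$ be the rational quotient map. Then $$H^0(X,L)=\pi_4^*H^0(\tilde Y,D_1)\oplus\pi_4^*H^0(\tilde Y,D_2)\oplus\pi_4^*H^0(\tilde Y,D_3)\oplus\pi_4^*H^0(\tilde Y,D_4)$$ for some divisors $D_1,\dots,D_4\in NS(\tilde Y)$, and every $\pi_4^*H^0(\tilde Y,D_i)$ corresponds to one of the eigenspaces for the action of $\tau^*$ on $H^0(X,L)$.
   Context: $\Omega_4=(H^2(X,\mathbb Z)^{\tau^*})^{\perp}\subset NS(X)$ is the co-invariant lattice of $\tau$ (rank $14$). Since $\tau^*L=L$ and $\tau$ has order $4$, $\tau^*$ acts on $H^0(X,L)$, which decomposes as $V_1\oplus V_i\oplus V_{-1}\oplus V_{-i}$ into eigenspaces relative to the fourth roots of unity (some possibly zero); the four summands $\pi_4^*H^0(\tilde Y,D_j)$ correspond to the four different eigenspaces. The pullback $\pi_4^*$ on divisor classes is $b_*p^*$ for a resolution $X\xleftarrow{b}X'\xrightarrow{p}\tilde Y$ of $\pi_4$; it kills all the exceptional curves of $\tilde Y\to X/\tau$. The divisors satisfy $\pi_4^*D_j=L$, so that pullback of sections gives $\pi_4^*H^0(\tilde Y,D_j)\subset H^0(X,L)$. *)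

(* Defs.v *)
From HB Require Import structures.
From mathcomp Require Import all_boot all_order all_algebra.
From mathcomp Require Import all_classical all_reals all_analysis.
From mathcomp Require Import complex.

Set Implicit Arguments.
Unset Strict Implicit.
Unset Printing Implicit Defensive.

Import Order.TTheory GRing.Theory Num.Theory.
Local Open Scope classical_set_scope.
Local Open Scope ring_scope.

(* Varieties are integral projective varieties over the complex field R[i]    *)
(* (R : realType), presented as projective models in the sense of Zariski: a  *)
(* variety with function field F is the set of its local rings O_{X,P} (P     *)
(* ranging over all scheme points), which are subrings of F.  All function    *)
(* fields live inside one big field K, an extension of R[i] through iota, so  *)
(* a variety has type set (set K), and a point is identified with its local   *)
(* ring.  O is a specialization of O' iff O `<=` O', and a dominant morphism  *)
(* compatible with the inclusion of function fields is a property (each local *)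
(* ring of the source dominates one of the target), not a datum.              *)

Section LocalRings.
Context {K : fieldType}.
Implicit Types (A O P E : set K) (X Y : set (set K)).

Definition loc_unit O : set K := [set f | f != 0 /\ O f /\ O f^-1].

(* For O local, the maximal ideal. *)
Definition maxid O : set K := O `\` loc_unit O.

Definition dominates O' O : Prop := O `<=` O' /\ maxid O `<=` maxid O'.

Definition is_subring A : Prop :=
  A 1 /\ forall a b, A a -> A b -> A (a - b) /\ A (a * b).

Definition prime_ideal A (p : set K) : Prop :=
  [/\ p `<=` A, p 0 /\ ~ p 1,
      forall a b, p a -> p b -> p (a + b),
      forall a b, A a -> p b -> p (a * b)
    & forall a b, A a -> A b -> p (a * b) -> p a \/ p b].

Definition localization A (p : set K) : set K :=
  [set f | exists a b, [/\ A a, A b, ~ p b & f = a / b]].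

(* The local ring of the generic point. *)
Definition funfield X : set K := \bigcup_(O in X) O.

Definition prime_divisor X E : Prop :=
  [/\ X E, E `<` funfield X
    & forall O, X O -> E `<` O -> O = funfield X].

(* Dimension 2 as a topological space: chains of irreducible closed subsets   *)
(* are chains of local rings.                                                 *)
Definition dimension2 X : Prop :=
  (exists A B C, [/\ X A, X B, X C, A `<` B & B `<` C]) /\
  ~ (exists A B C D, [/\ X A, X B, X C & X D] /\
                     [/\ A `<` B, B `<` C & C `<` D]).

Definition has_ord E (f : K) (n : int) : Prop :=
  exists t e, [/\ maxid E = [set t * a | a in E], loc_unit E e & f = t ^ n * e].

(* The valuation of f != 0 along E, when E is a discrete valuation ring. *)
Definition ord E (f : K) : int := xget 0 [set n | has_ord E f n].

(* Divisors: finitely supported integral combinations of prime divisors. *)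
Definition is_divisor X (D : set K -> int) : Prop :=
  (forall E, D E <> 0 -> prime_divisor X E) /\ finite_set [set E | D E <> 0].

Definition lin_equiv X (D D' : set K -> int) : Prop :=
  exists2 h, h != 0 /\ funfield X h
           & forall E, prime_divisor X E -> ord E h = D E - D' E.

Definition scale_div (n : int) (D : set K -> int) : set K -> int :=
  fun E => n * D E.

(* H^0(X, O_X(D)), as a space of rational functions. *)
Definition H0 X (D : set K -> int) : set K :=
  [set f | funfield X f /\
           (f != 0 -> forall E, prime_divisor X E -> 0 <= ord E f + D E)].

Definition local_eq X (D : set K -> int) P (f : K) : Prop :=
  [/\ f != 0, funfield X f
    & forall E, prime_divisor X E -> P `<=` E -> ord E f = D E].

Definition model_morphism X Y : Prop :=
  forall O', X O' -> exists2 O, Y O & dominates O' O.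

(* Pullback of a divisor D of Y by a dominant morphism X -> Y: pulling back a *)
(* local equation of D gives a local equation of the pullback.                *)
Definition pullback_div X Y (D : set K -> int) : set K -> int :=
  fun E => if `[< prime_divisor X E >] then
    ord E (xget 1 [set f | exists2 Q, Y Q & dominates E Q /\ local_eq Y D Q f])
  else 0.

(* Pushforward by a birational morphism onto X: a prime divisor is contracted *)
(* unless its local ring is also the local ring of a prime divisor of X.      *)
Definition pushforward_div X (D : set K -> int) : set K -> int :=
  fun E => if `[< prime_divisor X E >] then D E else 0.

(* NS(X) is taken modulo linear equivalence, which is legitimate for a K3     *)
(* surface: there NS(X) = Pic(X), because H^1(X, O_X) = 0.                    *)
Definition rank_NS X (r : nat) : Prop :=
  exists B : 'I_r -> (set K -> int),
  [/\ forall i, is_divisor X (B i),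
      forall m : 'I_r -> int,
        lin_equiv X (fun E => \sum_i m i * B i E) (fun=> 0) -> forall i, m i = 0
    & forall D, is_divisor X D ->
        exists (n : int) (m : 'I_r -> int),
          n != 0 /\ lin_equiv X (scale_div n D) (fun E => \sum_i m i * B i E)].

End LocalRings.

Section Surfaces.
Context {R : realType} {K : fieldType} (iota : {rmorphism R[i] -> K}).
Implicit Types (A O P Q E : set K) (X Y Z : set (set K)).

Definition is_subalgebra A : Prop := is_subring A /\ range iota `<=` A.

(* The coordinate ring of the affine chart x_i != 0 of the variety with       *)
(* generic point (x_0 : ... : x_n).                                           *)
Definition chart n (x : 'I_n.+1 -> K) (i : 'I_n.+1) : set K :=
  smallest is_subalgebra (range (fun j => x j / x i)).

Definition model n (x : 'I_n.+1 -> K) : set (set K) :=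
  [set O | exists i p,
     prime_ideal (chart x i) p /\ O = localization (chart x i) p].

Definition presents n (x : 'I_n.+1 -> K) X : Prop :=
  (forall i, x i != 0) /\ X = model x.

Definition projective_variety X : Prop :=
  exists n (x : 'I_n.+1 -> K), presents x X.

Definition has_value P (f : K) (c : R[i]) : Prop := maxid P (f - iota c).

(* The complex points: the points with residue field R[i]. *)
Definition Cpoint X P : Prop :=
  X P /\ forall f, P f -> exists c, has_value P f c.

Definition parameters P (u v : K) : Prop :=
  maxid P = [set u * a.1 + v * a.2 | a in P `*` P].

Definition smooth_projective_surface X : Prop :=
  [/\ projective_variety X, dimension2 X
    & forall P, Cpoint X P -> exists u v, parameters P u v].

(* A resolution of singularities Y -> V, V a projective surface. *)
Definition resolution V Y : Prop :=
  [/\ smooth_projective_surface Y, funfield Y = funfield V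
    & model_morphism Y V].

Definition minimal_resolution V Y : Prop :=
  resolution V Y /\ forall Z, resolution V Z -> model_morphism Z Y.

Definition very_ample X (D : set K -> int) : Prop :=
  exists r (s : 'I_r.+1 -> K),
  [/\ forall i, H0 X D (s i),
      forall P, Cpoint X P -> exists i, local_eq X D P (s i)^-1
    & presents s X].

Definition ample X (D : set K -> int) : Prop :=
  exists2 m : nat, (0 < m)%N & very_ample X (scale_div m%:Z D).

Definition derivation (d : K -> K) : Prop :=
  [/\ forall a b, d (a + b) = d a + d b,
      forall a b, d (a * b) = a * d b + b * d a
    & forall c, d (iota c) = 0].

(* The triple (g, u, v) stands for the rational 2-form g du /\ dv; two such   *)
(* forms are equal iff they agree on all pairs of derivations.                *)
Definition eq_form (w w' : K * K * K) : Prop :=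
  forall d d', derivation d -> derivation d' ->
    w.1.1 * (d w.1.2 * d' w.2 - d' w.1.2 * d w.2) =
    w'.1.1 * (d w'.1.2 * d' w'.2 - d' w'.1.2 * d w'.2).

(* Regular nowhere vanishing 2-forms. *)
Definition symplectic_form X (w : K * K * K) : Prop :=
  forall P, Cpoint X P -> exists g u v,
    [/\ loc_unit P g, parameters P u v & eq_form w (g, u, v)].

Definition regular_sections X (U : set (set K)) : set K :=
  [set f | funfield X f /\ forall P, U P -> P f].

Definition chart_open X n (x : 'I_n.+1 -> K) (i : 'I_n.+1) : set (set K) :=
  [set P | X P /\ forall j, P (x j / x i)].

(* H^1(X, O_X) = 0, by Cech cohomology of the standard affine covers. *)
Definition H1O_vanishes X : Prop :=
  forall n (x : 'I_n.+1 -> K), presents x X ->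
  forall a : 'I_n.+1 -> 'I_n.+1 -> K,
    (forall i j, regular_sections X (chart_open X x i `&` chart_open X x j)
       (a i j)) ->
    (forall i j l, a i l = a i j + a j l) ->
  exists2 b : 'I_n.+1 -> K,
    (forall i, regular_sections X (chart_open X x i) (b i))
    & forall i j, a i j = b j - b i.

(* A projective K3 surface whose function field is the whole of K. *)
Definition projective_K3 X : Prop :=
  [/\ smooth_projective_surface X, funfield X = setT,
      exists w, symplectic_form X w & H1O_vanishes X].

(* The automorphism tau is given by its action sigma = tau^* on K, so that    *)
(* the local ring of tau(P) is sigma @^-1` P.                                 *)
Definition automorphism X (sigma : {rmorphism K -> K}) : Prop :=
  [/\ bijective sigma, forall c, sigma (iota c) = iota c
    & forall O, X O <-> X (sigma @^-1` O)].

Definition has_order4 (sigma : K -> K) : Prop :=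
  (forall f, iter 4 sigma f = f) /\ exists f, iter 2 sigma f <> f.

Definition symplectic X (sigma : K -> K) : Prop :=
  forall w, symplectic_form X w ->
    eq_form (sigma w.1.1, sigma w.1.2, sigma w.2) w.

(* X / tau: the local ring at the image of P consists of the invariant        *)
(* elements of the local ring at P.                                           *)
Definition quotient_surface X (sigma : K -> K) : set (set K) :=
  [set O `&` [set f | sigma f = f] | O in X].

Definition aut_pullback_div (sigma : K -> K) (D : set K -> int) : set K -> int :=
  fun E => D (sigma @^-1` E).

(* The action of tau^* on H^0(X, L): an isomorphism tau^* L -> L is           *)
(* multiplication by some g with div g = tau^* L - L, and it is normalized so *)
(* that f |-> g * sigma f has fourth power the identity.  Then g is unique up *)
(* to a fourth root of unity.                                                 *)
Definition section_action (sigma : K -> K) (g f : K) : K := g * sigma f.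

Definition linearization X (sigma : K -> K) (L : set K -> int) (g : K) : Prop :=
  [/\ g != 0,
      forall E, prime_divisor X E -> ord E g = aut_pullback_div sigma L E - L E
    & forall f, iter 4 (section_action sigma g) f = f].

Definition section_eigenspace X (sigma : K -> K) (L : set K -> int) (g : K)
    (lambda : R[i]) : set K :=
  [set f | H0 X L f /\ section_action sigma g f = iota lambda * f].

(* pi_4^* D = b_* p^* D, for X <-b- X' -p-> Y. *)
Definition rational_pullback X X' Y (D : set K -> int) : set K -> int :=
  pushforward_div X (pullback_div X' Y D).

(* pi_4^* H^0(Y, D) inside H^0(X, L): sections of D are pulled back to        *)
(* sections of pi_4^* D, and h realizes the isomorphism of O_X(pi_4^* D) with *)
(* O_X(L), which is unique up to a constant.                                  *)
Definition pullback_H0 X X' Y (D L : set K -> int) : set K :=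
  [set s | exists f h, [/\ H0 Y D f, h != 0,
     forall E, prime_divisor X E -> ord E h = rational_pullback X X' Y D E - L E
     & s = f * h]].

(* The Euclidean topology on the set of complex points. *)
Definition euclid_nbhs X P (N : set (set K)) : Prop :=
  exists (s : seq K) (e : R[i]), [/\ 0 < e, forall f, f \in s -> P f
    & forall Q, Cpoint X Q ->
        (forall f, f \in s -> exists c d,
            [/\ has_value P f c, has_value Q f d & `|d - c| < e]) -> N Q].

Definition euclid_open X (U : set (set K)) : Prop :=
  U `<=` Cpoint X /\ forall P, U P -> euclid_nbhs X P U.

Definition euclid_continuous X (U : set (set K)) (l : set K -> R[i]) : Prop :=
  forall P, U P -> forall e : R[i], 0 < e ->
    euclid_nbhs X P [set Q | U Q -> `|l Q - l P| < e].

(* Cech cohomology of the space of complex points with coefficients in int,   *)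
(* as a colimit over the open covers (U P)_P indexed by the points, with      *)
(* U P a neighbourhood of P; these are cofinal among all open covers.         *)
Definition open_cover X (U : set K -> set (set K)) : Prop :=
  forall P, Cpoint X P -> euclid_open X (U P) /\ U P P.

Definition cochain (q : nat) : Type := ('I_q.+1 -> set K) -> int.

Definition nerve X (U : set K -> set (set K)) q (s : 'I_q.+1 -> set K) : Prop :=
  (forall i, Cpoint X (s i)) /\ exists S, forall i, U (s i) S.

Definition cech_d q (c : cochain q) : cochain q.+1 :=
  fun s => \sum_(i < q.+2) (-1) ^+ i * c (fun j => s (lift i j)).

Definition cech_pair (q : nat) : Type := (set K -> set (set K)) * cochain q.

Definition cech_cocycle X q (x : cech_pair q) : Prop :=
  open_cover X x.1 /\ forall s, nerve X x.1 s -> cech_d x.2 s = 0.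

Definition cech_null X q (x : cech_pair q.+1) : Prop :=
  exists (W : set K -> set (set K)) (b : cochain q),
  [/\ open_cover X W, forall P, W P `<=` x.1 P
    & forall s, nerve X W s -> x.2 s = cech_d b s].

Definition cech_sub q (x y : cech_pair q) : cech_pair q :=
  (fun P => x.1 P `&` y.1 P, fun s => x.2 s - y.2 s).

Definition cech_cup p q (x : cech_pair p) (y : cech_pair q) : cech_pair (p + q) :=
  (fun P => x.1 P `&` y.1 P,
   fun s => x.2 (fun i => s (inord i)) * y.2 (fun j => s (inord (p + j)))).

Definition cech_aut (sigma : K -> K) q (x : cech_pair q) : cech_pair q :=
  (fun P => [set S | x.1 (sigma @^-1` P) (sigma @^-1` S)],
   fun s => x.2 (fun i => sigma @^-1` s i)).

Definition cech_invariant X (sigma : K -> K) (x : cech_pair 2) : Prop :=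
  cech_null X (cech_sub (cech_aut sigma x) x).

(* Orthogonality in H^2: since H^4 is infinite cyclic, generated by the       *)
(* fundamental class, x and y are orthogonal iff their cup product is 0.      *)
Definition orthogonal (X : set (set K)) (x y : cech_pair 2) : Prop :=
  cech_null X (cech_cup x y : cech_pair 4).

(* The co-invariant lattice Omega_4, the orthogonal of H^2(X, Z)^{tau^*}. *)
Definition Omega4 X (sigma : K -> K) (x : cech_pair 2) : Prop :=
  cech_cocycle X x /\
  forall y, cech_cocycle X y -> cech_invariant X sigma y -> orthogonal X x y.

Definition cexp (z : R[i]) : R[i] :=
  Complex (expR (complex.Re z) * cos (complex.Im z))
          (expR (complex.Re z) * sin (complex.Im z)).

(* The pair x represents the first Chern class of O_X(D), i.e., the image of  *)
(* the transition functions g_{PQ} = f_P / f_Q (f_P a local equation of D on  *)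
(* U_P) by the connecting map of the exponential sequence: with continuous    *)
(* logarithms l_{PQ} of the g_{PQ}, the cocycle is                            *)
(* (l_{QT} - l_{PT} + l_{PQ}) / (2 i pi).                                     *)
Definition chern_class X (D : set K -> int) (x : cech_pair 2) : Prop :=
  exists (f : set K -> K) (l : set K -> set K -> set K -> R[i]),
  [/\ open_cover X x.1,
      forall P S, Cpoint X P -> x.1 P S -> local_eq X D S (f P),
      forall P Q, Cpoint X P -> Cpoint X Q ->
        euclid_continuous X (x.1 P `&` x.1 Q) (l P Q) /\
        forall S, x.1 P S -> x.1 Q S ->
          has_value S (f P / f Q) (cexp (l P Q S))
    & forall P Q T S, Cpoint X P -> Cpoint X Q -> Cpoint X T ->
        x.1 P S -> x.1 Q S -> x.1 T S ->
        l Q T S - l P T S + l P Q S =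
        Complex 0 (2 * pi) * (x.2 (fun i => nth P [:: P; Q; T] i))%:~R].

(* The divisors whose class lies in the orthogonal of Omega_4 in NS(X). *)
Definition Omega4_perp X (sigma : K -> K) (D : set K -> int) : Prop :=
  is_divisor X D /\
  forall x y, chern_class X D x -> Omega4 X sigma y -> orthogonal X x y.

Definition generates_Omega4_perp X (sigma : K -> K) (L : set K -> int) : Prop :=
  forall D, is_divisor X D ->
    (Omega4_perp X sigma D <-> exists n : int, lin_equiv X D (scale_div n L)).

End Surfaces.

(* Main.v *)
Require Import Defs.
From HB Require Import structures.
From mathcomp Require Import all_boot all_order all_algebra.
From mathcomp Require Import all_classical all_reals all_analysis.
From mathcomp Require Import complex ring zify.
Set Implicit Arguments.
Unset Strict Implicit.
Unset Printing Implicit Defensive.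
Import Order.TTheory GRing.Theory Num.Theory.
Local Open Scope classical_set_scope.
Local Open Scope ring_scope.

(* The square of tau is a symplectic involution, and such an involution cannot act
   trivially on the residue field of a prime divisor E of X; hence tau is unramified
   in codimension one, E has a tau-invariant uniformizer, and its trace on the field
   of invariants is a prime divisor of Y with the same valuation.  As tau^* preserves
   Omega_4 and L is an ample generator of its orthogonal, tau^* L and L are linearly
   equivalent.  For each fourth root of unity lambda, Hilbert 90 gives a rational
   section h of L with tau^* h = lambda h.  The divisor L + div h is tau-invariant;
   let D take its values at the traces of the prime divisors of X, and large values
   on the curves contracted to X / tau.  Those curves then impose no condition on
   H^0(Y, D), since an invariant section defined near the orbit of a point has
   bounded poles along them, and s |-> s / h identifies the lambda-eigenspace of
   H^0(X, L) with H^0(Y, D). *)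

(** * Local rings, localizations and Noetherian rings *)

(** Smoothness is given only at complex points, as two generators of the maximal ideal, and
    dimension two only as one chain of local rings. Factoriality is therefore proved directly for
    local rings with two parameters: primes other than zero and the maximal ideal are principal,
    prime divisors are discrete valuation rings, and a function without poles along prime divisors
    is regular. The local fact needed for this, that at every complex point no parameter divides a
    power of the other, is carried from one point to all others by derivations of [K]: at a point
    where it failed there could not be two independent ones on the function field. The same
    derivations compute the action of an involution on the 2-form. The contracted curves of [Y] are
    never described. The bound for poles along them must be one divisor valid for all invariant
    sections, so hyperplanes with explicit coefficients are used: for each orbit, one out of a fixed
    finite list avoids it. The generator hypothesis only makes tau^* L equivalent to some n L; that
    n is 1 comes from ampleness, as sections of a very ample multiple of L are not all
    proportional. *)

Section Submodules.
Context {V : comNzRingType}.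
Implicit Types (A N : set V) (s : seq V).

Definition submodule A N : Prop :=
  [/\ N 0, forall a b, N a -> N b -> N (a + b)
    & forall a b, A a -> N b -> N (a * b)].

(** The coefficients may come from any set [N]; with [N] the maximal ideal this is the submodule
    that occurs in Nakayama's lemma. *)
Fixpoint span N s : set V :=
  if s is x :: s' then [set y | exists a b, [/\ N a, span N s' b & y = a * x + b]]
  else [set 0].

Lemma span_submodule A N s : submodule A N -> submodule A (span N s).
Proof.
move=> [N0 ND NM]; elim: s => [|x s [I0 ID IM]] /=.
  by split=> [//|a b -> ->|a b _ ->]; rewrite ?addr0 ?mulr0.
split; first by exists 0, 0; split; rewrite ?mul0r ?addr0.
- move=> _ _ [a [b [Na sb ->]]] [c [d [Nc sd ->]]].
  by exists (a + c), (b + d); split; [exact: ND|exact: ID|rewrite mulrDl addrACA].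
- move=> a _ Aa [b [c [Nb sc ->]]]; exists (a * b), (a * c).
  by split; [exact: NM|exact: IM|rewrite mulrDr mulrA].
Qed.

Lemma span_cons N s x y : N 0 -> span N s y -> span N (x :: s) y.
Proof. by move=> N0 sy; exists 0, y; rewrite mul0r add0r. Qed.

Lemma span_mul N s a x : N 0 -> N a -> x \in s -> span N s (a * x).
Proof.
move=> N0 Na; elim: s => [//|y s IH]; rewrite inE => /orP[/eqP ->|/IH].
  exists a, 0; split => //; last by rewrite addr0.
  by elim: s {IH} => [//|z s IH] /=; exists 0, 0; split; rewrite ?mul0r ?addr0.
exact: span_cons.
Qed.

Lemma span_sub (N M : set V) s : M 0 -> (forall a b, M a -> M b -> M (a + b)) ->
  (forall a x, N a -> x \in s -> M (a * x)) -> span N s `<=` M.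
Proof.
move=> M0 MD; elim: s => [|x s IH] MN y /=; first by move->.
case=> a [b [Na sb ->]]; apply: MD; first by apply: MN; rewrite ?mem_head.
by apply: IH sb => c z Nc zs; apply: MN; rewrite // inE zs orbT.
Qed.

Lemma submodule_sum (I : Type) (r : seq I) (P : pred I) (F : I -> V) A N :
  submodule A N -> (forall i, P i -> N (F i)) -> N (\sum_(i <- r | P i) F i).
Proof. by case=> N0 ND _ NF; apply: big_ind. Qed.

End Submodules.

Section Subrings.
Context {K : fieldType}.
Implicit Types (A O P N p : set K).

Lemma subring1 A : is_subring A -> A 1. Proof. by case. Qed.

Lemma subringB A a b : is_subring A -> A a -> A b -> A (a - b).
Proof. by case=> _ h Aa Ab; case: (h a b Aa Ab). Qed.

Lemma subringM A a b : is_subring A -> A a -> A b -> A (a * b).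
Proof. by case=> _ h Aa Ab; case: (h a b Aa Ab). Qed.

Lemma subring0 A : is_subring A -> A 0.
Proof. by move=> hA; rewrite -(subrr 1); apply: subringB => //; apply: subring1. Qed.

Lemma subringN A a : is_subring A -> A a -> A (- a).
Proof. by move=> hA Aa; rewrite -sub0r; apply: subringB => //; apply: subring0. Qed.

Lemma subringD A a b : is_subring A -> A a -> A b -> A (a + b).
Proof.
by move=> hA Aa Ab; rewrite -[b]opprK; apply: subringB => //; apply: subringN.
Qed.

Lemma subringX A a n : is_subring A -> A a -> A (a ^+ n).
Proof.
move=> hA Aa; elim: n => [|n IH]; first by rewrite expr0; apply: subring1.
by rewrite exprS; apply: subringM.
Qed.

Lemma subring_submodule A : is_subring A -> submodule A A.
Proof.
move=> hA; split; first exact: subring0.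
- by move=> a b; apply: subringD.
- by move=> a b; apply: subringM.
Qed.

Lemma subring_sum (I : Type) (r : seq I) (P : pred I) (F : I -> K) A :
  is_subring A -> (forall i, P i -> A (F i)) -> A (\sum_(i <- r | P i) F i).
Proof. by move=> /subring_submodule; apply: submodule_sum. Qed.

Lemma subring_prod (I : Type) (r : seq I) (P : pred I) (F : I -> K) A :
  is_subring A -> (forall i, P i -> A (F i)) -> A (\prod_(i <- r | P i) F i).
Proof.
by move=> hA AF; apply: big_ind => // [|x y]; [exact: subring1|exact: subringM].
Qed.

Lemma submoduleN A N a : is_subring A -> submodule A N -> N a -> N (- a).
Proof.
move=> hA [_ _ NM] Na; rewrite -mulN1r; apply: NM => //.
by apply: subringN => //; apply: subring1.
Qed.

Lemma submoduleB A N a b :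
  is_subring A -> submodule A N -> N a -> N b -> N (a - b).
Proof.
by move=> hA hN Na Nb; case: (hN) => _ + _; apply=> //; apply: (submoduleN hA hN).
Qed.

Definition principal (a : K) A : set K := [set a * b | b in A].

Lemma principal_submodule a A : is_subring A -> submodule A (principal a A).
Proof.
move=> hA; split; first by exists 0; [exact: subring0|rewrite mulr0].
- by move=> _ _ [x Ax <-] [y Ay <-]; exists (x + y);
    [exact: subringD|rewrite mulrDr].
- by move=> b _ Ab [x Ax <-]; exists (b * x); [exact: subringM|rewrite mulrCA].
Qed.

Definition sum_set (M N : set K) : set K :=
  [set y | exists a b, [/\ M a, N b & y = a + b]].

Lemma sum_set_submodule A M N :
  submodule A M -> submodule A N -> submodule A (sum_set M N).
Proof.
move=> [M0 MD MM] [N0 ND NM]; split; first by exists 0, 0; rewrite addr0.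
- move=> _ _ [a [b [Ma Nb ->]]] [c [d [Mc Nd ->]]]; exists (a + c), (b + d).
  by rewrite addrACA; split; [exact: MD|exact: ND|].
- move=> c _ Ac [a [b [Ma Nb ->]]]; exists (c * a), (c * b).
  by rewrite mulrDr; split; [exact: MM|exact: NM|].
Qed.

Definition local_ring O : Prop := is_subring O /\ submodule O (maxid O).

Lemma loc_unit1 O : is_subring O -> loc_unit O 1.
Proof. by move=> hO; split; rewrite ?invr1 ?oner_eq0 //; split; apply: subring1. Qed.

Lemma loc_unitM O a b : is_subring O ->
  loc_unit O a -> loc_unit O b -> loc_unit O (a * b).
Proof.
move=> hO [a0 [Oa Oa']] [b0 [Ob Ob']]; split; first by rewrite mulf_neq0.
by rewrite invfM; split; apply: subringM.
Qed.

Lemma loc_unitV O a : loc_unit O a -> loc_unit O a^-1.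
Proof. by move=> [a0 [Oa Oa']]; split; rewrite ?invr_eq0 // invrK. Qed.

Lemma maxid_sub O : maxid O `<=` O. Proof. by move=> a []. Qed.

Lemma maxidN1 O : is_subring O -> ~ maxid O 1.
Proof. by move=> hO [_]; apply; apply: loc_unit1. Qed.

Lemma loc_unitP O a : O a -> ~ maxid O a -> loc_unit O a.
Proof. by move=> Oa na; apply: contrapT => nu; apply: na. Qed.

Lemma maxid_inv O a : O a -> ~ maxid O a -> O a^-1.
Proof. by move=> Oa /(loc_unitP Oa) [_ []]. Qed.

Lemma loc_unit_addm O a b : local_ring O -> loc_unit O a -> maxid O b ->
  loc_unit O (a + b).
Proof.
move=> [hO hm] ua mb; apply: loc_unitP.
  by apply: subringD => //; [case: ua => _ []|exact: maxid_sub].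
move=> mab; case: (submoduleB hO hm mab mb) => _; apply.
by rewrite addrK.
Qed.

Lemma local_maxid_prime O : local_ring O -> prime_ideal O (maxid O).
Proof.
move=> [hO [m0 mD mM]]; split=> //; first exact: maxid_sub.
- by split=> //; apply: maxidN1.
move=> a b Oa Ob mab; apply: contrapT => /not_orP[na nb].
by case: mab => _; apply; apply: loc_unitM => //; apply: loc_unitP.
Qed.

Lemma prime_ideal_submodule A p : prime_ideal A p -> submodule A p.
Proof. by case=> _ []. Qed.

Lemma prime_ideal_X A p a n : is_subring A ->
  prime_ideal A p -> A a -> p (a ^+ n) -> p a.
Proof.
move=> hA [_ [p0 p1] _ _ pM] Aa; elim: n => [|n IH]; first by rewrite expr0.
by rewrite exprS => /pM[] //; apply: subringX.
Qed.

Lemma prime_zero A : is_subring A -> prime_ideal A [set 0].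
Proof.
move=> hA; split.
- by move=> _ ->; apply: subring0.
- by split=> // /eqP; rewrite oner_eq0.
- by move=> a b -> ->; rewrite addr0.
- by move=> a b _ ->; rewrite mulr0.
- by move=> a b _ _ /eqP; rewrite mulf_eq0 => /orP[] /eqP ->; [left|right].
Qed.

Section Localization.
Variables (A p : set K).
Hypotheses (hA : is_subring A) (hp : prime_ideal A p).

Let neq0 b : ~ p b -> b != 0.
Proof. by case: hp => _ [p0 _] _ _ _ nb; apply/eqP => b0; apply: nb; rewrite b0. Qed.

Let pNM a b : A a -> A b -> ~ p a -> ~ p b -> ~ p (a * b).
Proof. by case: hp => _ _ _ _ pM Aa Ab na nb /pM[]. Qed.

Lemma sub_localization : A `<=` localization A p.
Proof.
move=> a Aa; exists a, 1; split; rewrite ?divr1 //; first exact: subring1.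
by case: hp => _ [].
Qed.

Lemma localization_subring : is_subring (localization A p).
Proof.
split; first by apply: sub_localization; apply: subring1.
move=> _ _ [a [b [Aa Ab nb ->]]] [c [d [Ac Ad nd ->]]]; split.
  exists (a * d - c * b), (b * d); split; last by field; rewrite !neq0.
  - by apply: subringB => //; apply: subringM.
  - exact: subringM.
  - exact: pNM.
exists (a * c), (b * d); split; last by rewrite invfM mulrACA.
- exact: subringM.
- exact: subringM.
- exact: pNM.
Qed.

Lemma maxid_localization : maxid (localization A p) =
  [set f | exists a b, [/\ p a, A b, ~ p b & f = a / b]].
Proof.
have [pA [p0 p1] pD pM pP] := hp.
apply/seteqP; split=> f.
  case=> -[a [b [Aa Ab nb ->]]] nu; exists a, b; split=> //.
  apply: contrapT => na; apply: nu; split; first by rewrite mulf_neq0 ?invr_eq0 ?neq0.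
  by split; [exists a, b|exists b, a; rewrite invf_div].
case=> a [b [pa Ab nb ->]]; split; first by exists a, b; split => //; apply: pA.
case=> ab0 [_ [c [d [Ac Ad nd]]]]; rewrite invf_div => e.
have a0 : a != 0 by apply: contraNneq ab0 => ->; rewrite mul0r.
apply: (pNM Ab Ad nb nd).
have -> : b * d = c * a.
  by rewrite -[b](divfK a0) e mulrAC divfK ?neq0 // mulrC.
exact: pM.
Qed.

Lemma localization_local : local_ring (localization A p).
Proof.
have [pA [p0 p1] pD pM pP] := hp.
split; first exact: localization_subring.
rewrite maxid_localization; split.
- by exists 0, 1; rewrite mul0r; split=> //; apply: subring1.
- move=> _ _ [a [b [pa Ab nb ->]]] [c [d [pc Ad nd ->]]].
  exists (d * a + b * c), (b * d); split; last by field; rewrite !neq0.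
  + by apply: pD; apply: pM.
  + exact: subringM.
  + exact: pNM.
- move=> _ _ [a [b [Aa Ab nb ->]]] [c [d [pc Ad nd ->]]].
  exists (a * c), (b * d); split; last by rewrite invfM mulrACA.
  + exact: pM.
  + exact: subringM.
  + exact: pNM.
Qed.

Lemma maxid_localizationI : maxid (localization A p) `&` A = p.
Proof.
have [pA [p0 p1] pD pM pP] := hp.
apply/seteqP; split=> a.
  rewrite maxid_localization => -[[b [c [pb Ac nc ->]]] Abc].
  by case: (pP _ _ Abc Ac) => //; rewrite divfK ?neq0.
move=> pa; split; last exact: pA.
rewrite maxid_localization; exists a, 1.
by split; rewrite ?divr1 //; apply: subring1.
Qed.

Lemma prime_localizationI q :
  prime_ideal (localization A p) q -> prime_ideal A (q `&` A).
Proof.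
move=> [qL [q0 q1] qD qM qP]; split.
- by move=> a [].
- by split=> [|[]//]; split=> //; apply: subring0.
- by move=> a b [qa Aa] [qb Ab]; split; [exact: qD|exact: subringD].
- move=> a b Aa [qb Ab]; split; last exact: subringM.
  by apply: qM => //; apply: sub_localization.
- move=> a b Aa Ab [qab _].
  by case: (qP _ _ (sub_localization Aa) (sub_localization Ab) qab); [left|right].
Qed.

Lemma localization_localization q : prime_ideal (localization A p) q ->
  localization (localization A p) q = localization A (q `&` A).
Proof.
move=> hq; have hq' := prime_localizationI hq.
have [qL [q0 q1] qD qM qP] := hq.
apply/seteqP; split=> f; last first.
  move=> [a [b [Aa Ab nb ->]]]; exists a, b; split=> //.
  - exact: sub_localization.
  - exact: sub_localization.
  - by move=> qb; apply: nb.
move=> [_ [_ [[a [b [Aa Ab nb ->]]] [c [d [Ac Ad nd ->]]] nq ->]]].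
exists (a * d), (b * c); split; last first.
- by rewrite invf_div mulf_div.
- move=> [qbc _]; apply: nq; rewrite -[c]mulr1 -(divff (neq0 nb)).
  have -> : c * (b / b) / d = (1 / (b * d)) * (b * c).
    by field; rewrite !neq0.
  apply: qM => //; exists 1, (b * d); split=> //; [exact: subring1|exact: subringM|].
  exact: pNM.
- exact: subringM.
- exact: subringM.
Qed.

End Localization.

Lemma localization_sub A p O : is_subring A -> prime_ideal A p -> is_subring O ->
  A `<=` O -> (forall b, A b -> ~ p b -> O b^-1) -> localization A p `<=` O.
Proof.
move=> hA hp hO AO hinv _ [a [b [Aa Ab nb ->]]].
by apply: subringM => //; [exact: AO|exact: hinv].
Qed.

Lemma maxidI_prime A O : is_subring A -> local_ring O -> A `<=` O ->
  prime_ideal A (maxid O `&` A).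
Proof.
move=> hA hO AO; have [pO [p0 p1] pD pM pP] := local_maxid_prime hO.
split.
- by move=> a [].
- by split=> [|[]//]; split=> //; apply: subring0.
- by move=> a b [ma Aa] [mb Ab]; split; [exact: pD|exact: subringD].
- by move=> a b Aa [mb Ab]; split; [apply: pM => //; exact: AO|exact: subringM].
- by move=> a b Aa Ab [mab _]; case: (pP _ _ (AO _ Aa) (AO _ Ab) mab); [left|right].
Qed.

Lemma localization_maxidI_sub A O : is_subring A -> local_ring O -> A `<=` O ->
  localization A (maxid O `&` A) `<=` O.
Proof.
move=> hA hO AO; have [hO' _] := hO.
apply: localization_sub => //; first exact: maxidI_prime.
by move=> b Ab nb; apply: maxid_inv => [|mb]; [exact: AO|apply: nb].
Qed.

Lemma dominates_localization A O : is_subring A -> local_ring O -> A `<=` O ->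
  dominates O (localization A (maxid O `&` A)).
Proof.
move=> hA hO AO; split; first exact: localization_maxidI_sub.
rewrite maxid_localization //; last exact: maxidI_prime.
move=> _ [a [b [[ma Aa] Ab nb ->]]]; have [_ [_ _ mM]] := hO.
rewrite mulrC; apply: mM => //.
by apply: maxid_inv => [|mb]; [exact: AO|apply: nb].
Qed.

Lemma dominates_trans (O1 O2 O3 : set K) :
  dominates O1 O2 -> dominates O2 O3 -> dominates O1 O3.
Proof.
by move=> [h1 h2] [h3 h4]; split; [apply: subset_trans h1|apply: subset_trans h2].
Qed.

Lemma dominates_unit O' O a : dominates O' O -> O a -> loc_unit O' a -> loc_unit O a.
Proof. by move=> [_ h] Oa ua; apply: loc_unitP => // /h; case. Qed.

Lemma dominates_maxidI O' O : dominates O' O -> maxid O' `&` O = maxid O.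
Proof.
move=> [h1 h2]; apply/seteqP; split=> [a [ma Oa]|a ma].
  split=> // -[a0 [_ Oa']]; case: ma => _; apply.
  by split=> //; split; apply: h1.
by split; [exact: h2|exact: maxid_sub].
Qed.

Definition noetherian A : Prop := forall J, submodule A J -> J `<=` A ->
  exists s : seq K, (forall x, x \in s -> J x) /\ J `<=` span A s.

(** Zorn's lemma: the union of a chain of ideals is generated by finitely many elements, which all
    lie in one member of the chain, so the union is that member. *)
Lemma noetherian_maximal A (F : set (set K)) : is_subring A -> noetherian A ->
  F !=set0 -> (forall J, F J -> submodule A J /\ J `<=` A) ->
  exists J, F J /\ forall J', F J' -> J `<=` J' -> J' `<=` J.
Proof.
move=> hA nA [J0 FJ0] Fid.
(* The empty set is added because it is the union of the empty chain. *)
have [F' F'F F'tot|M [FM maxM]] := @Zorn_bigcup K (F `|` [set set0]).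
  have [[J1 F'J1 FJ1]|noJ] := pselect (exists2 J, F' J & F J); last first.
    right; apply/seteqP; split=> [x [J F'J Jx]|x []].
    by case: (F'F _ F'J) => [FJ|->//] in Jx *; case: noJ; exists J.
  have J1_0 : J1 0 by have [[]] := Fid _ FJ1.
  pose U := \bigcup_(X in F') X.
  have F'id J x : F' J -> J x -> F J.
    by move=> F'J Jx; case: (F'F _ F'J) => // J0'; rewrite J0' in Jx.
  have hU : submodule A U /\ U `<=` A.
    split; first split.
    - by exists J1.
    - move=> a b [Ja F'a Jaa] [Jb F'b Jbb].
      have [[_ Da _] _] := Fid _ (F'id _ _ F'a Jaa).
      have [[_ Db _] _] := Fid _ (F'id _ _ F'b Jbb).
      by case: (F'tot _ _ F'a F'b) => h; [exists Jb|exists Ja] => //;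
        [apply: Db => //; apply: h|apply: Da => //; apply: h].
    - move=> a b Aa [J F'J Jb]; exists J => //.
      by have [[_ _ JM] _] := Fid _ (F'id _ _ F'J Jb); apply: JM.
    - by move=> x [J F'J Jx]; have [_] := Fid _ (F'id _ _ F'J Jx); apply.
  have [s [sU Us]] := nA _ hU.1 hU.2.
  have [J F'J sJ] : exists2 J, F' J /\ F J & forall x, x \in s -> J x.
    elim: s sU {Us} => [|x s IH] sU; first by exists J1.
    have [|J [F'J FJ] sJ] := IH; first by move=> y ys; apply: sU; rewrite inE ys orbT.
    have [J' F'J' J'x] := sU x (mem_head _ _).
    have [JJ'|J'J] := F'tot _ _ F'J F'J'.
      exists J'; first by split=> //; apply: F'id J'x.
      by move=> y; rewrite inE => /orP[/eqP -> //|/sJ]; apply: JJ'.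
    exists J => // y; rewrite inE => /orP[/eqP ->|/sJ //]; exact: J'J.
  left; suff -> : \bigcup_(X in F') X = J by case: F'J.
  apply/seteqP; split=> [x /Us|x Jx]; last by exists J => //; case: F'J.
  have [[J_0 JD JM] _] := Fid _ F'J.2.
  by apply: span_sub => // a y Aa ys; apply: JM => //; apply: sJ.
have FM' : F M.
  case: FM => // M0; case: (maxM J0); last by left.
  rewrite M0; split=> //; have [[J00 _ _] _] := Fid _ FJ0 => /(_ _ J00) [].
exists M; split=> // J FJ MJ; apply: contrapT => JM.
by case: (maxM J); [split|left].
Qed.

Lemma noetherian_localization A p : is_subring A -> prime_ideal A p ->
  noetherian A -> noetherian (localization A p).
Proof.
move=> hA hp nA J [J0 JD JM] JL; have AL := sub_localization hA hp.
have [|a [Ja Aa]|s [sJ Js]] := nA (J `&` A); last 1 first.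
- exists s; split=> [x /sJ[]//|f Jf].
  have [a [b [Aa Ab nb ef]]] := JL _ Jf.
  have b0 : b != 0.
    by case: hp => _ [p0 _] _ _ _; apply/eqP => b0; apply: nb; rewrite b0.
  have Jfb : span (localization A p) s a.
    have : span A s a.
      apply: Js; split=> //.
      have -> : a = b * f by rewrite ef mulrCA divff // mulr1.
      by apply: JM => //; apply: AL.
    elim: (s) {sJ Js} (a) => [//|x r IH] c /= [d [e [Ad se ->]]].
    by exists d, e; split; [exact: AL|exact: IH|].
  have hL := localization_subring hA hp.
  have [_ _ h] := span_submodule s (subring_submodule hL).
  rewrite ef mulrC; apply: h => //; exists 1, b; split=> //; first exact: subring1.
  by rewrite mul1r.
- split; first by split=> //; apply: subring0.
  + by move=> a b [Ja Aa] [Jb Ab]; split; [exact: JD|exact: subringD].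
  + by move=> a b Aa [Jb Ab]; split; [apply: JM => //; exact: AL|exact: subringM].
- by [].
Qed.

(** Induction on the generators replaces the determinant: [1 - a] is a unit for [a] in the maximal
    ideal, so the relation of [w0] is solved for [w0] and substituted into the others. *)
Lemma nakayama (P N : set K) (s : seq K) : local_ring P -> submodule P N ->
  (forall w, w \in s -> sum_set N (span (maxid P) s) w) ->
  forall w, w \in s -> N w.
Proof.
move=> hP hN; have [hP' hm] := hP; have [N0 ND NM] := hN; have [m0 mD mM] := hm.
elim: s => [//|w0 s IH] hs.
have hsp := span_submodule s hm; have [sp0 spD spM] := hsp.
have [n [_ [Nn [a [b [ma sb ->]]] ew0]]] := hs w0 (mem_head _ _).
have u1a : loc_unit P (1 - a).
  apply: loc_unit_addm => //; first exact: loc_unit1.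
  exact: (submoduleN hP' hm).
have [a10 [Pa1 Pa1']] := u1a.
have ew0' : w0 = (1 - a)^-1 * n + (1 - a)^-1 * b.
  apply: (mulfI a10); rewrite -mulrDr mulVKf //.
  by rewrite mulrBl mul1r {1}ew0 [a * w0 + b]addrC addrA addrK.
have Ns w : w \in s -> N w.
  apply: IH => {}w ws; have [|n' [_ [Nn' [a' [b' [ma' sb' ->]]] ew]]] := hs w.
    by rewrite inE ws orbT.
  exists (n' + a' * ((1 - a)^-1 * n)), (a' * ((1 - a)^-1 * b) + b').
  split.
  - by apply: ND => //; apply: (NM); [exact: maxid_sub|exact: NM].
  - by apply: spD => //; apply: (spM); [exact: maxid_sub|exact: spM].
  - by rewrite ew {1}ew0' mulrDr !addrA.
move=> w; rewrite inE => /orP[/eqP ->|]; last exact: Ns.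
rewrite ew0'; apply: (ND); apply: (NM) => //.
apply: (span_sub N0 ND) sb => c x mc xs; apply: (NM); [exact: maxid_sub|exact: Ns].
Qed.

End Subrings.

Section HilbertBasis.
Context {K : fieldType}.
Implicit Types (A J : set K) (x : K).

Definition adjoin A x : set K := [set p.[x] | p in [set p : {poly K} | forall i, A p`_i]].

Let coefs A : set {poly K} := [set p | forall i, A p`_i].

Lemma coefs_submodule A : is_subring A -> submodule (coefs A) (coefs A).
Proof.
move=> hA; split.
- by move=> i; rewrite coef0; apply: subring0.
- by move=> p q Ap Aq i; rewrite coefD; apply: subringD.
- by move=> p q Ap Aq i; rewrite coefM; apply: subring_sum => // j _; apply: subringM.
Qed.

Lemma adjoin_subring A x : is_subring A -> is_subring (adjoin A x).
Proof.
move=> hA; have [c0 cD cM] := coefs_submodule hA; split.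
  exists 1; last by rewrite hornerC.
  by move=> i; rewrite coef1; case: (i == 0)%N; [exact: subring1|exact: subring0].
move=> _ _ [p Ap <-] [q Aq <-]; split.
  exists (p - q); last by rewrite hornerD hornerN.
  by move=> i; rewrite coefB; apply: subringB.
by exists (p * q); [exact: cM|rewrite hornerM].
Qed.

Lemma sub_adjoin A x : is_subring A -> A `<=` adjoin A x.
Proof.
move=> hA a Aa; exists a%:P; last by rewrite hornerC.
by move=> i; rewrite coefC; case: (i == 0)%N => //; apply: subring0.
Qed.

Lemma mem_adjoin A x : is_subring A -> adjoin A x x.
Proof.
move=> hA; exists 'X; last by rewrite hornerX.
by move=> i; rewrite coefX; case: (i == 1)%N; [exact: subring1|exact: subring0].
Qed.

(* Elements of I of minimal degree outside the span of the previous ones would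
   have leading coefficients generating an ideal of A that is not finitely
   generated. *)
Lemma hilbert_basis A x : is_subring A -> noetherian A -> noetherian (adjoin A x).
Proof.
move=> hA nA J [J0 JD JM] JA; have hcA := coefs_submodule hA.
have [c0 cD cM] := hcA.
have hAx := adjoin_subring x hA.
pose I := [set p | coefs A p /\ J p.[x]].
pose sp s := span (coefs A) s.
have [[s [sI Is]]|nfg] := pselect (exists s, (forall p, p \in s -> I p) /\ I `<=` sp s).
  exists [seq p.[x] | p <- s]; split=> [_ /mapP[p ps ->]|y Jy].
    by case: (sI _ ps).
  have [p Ap ey] := JA _ Jy; have : sp s p by apply: Is; split=> //; rewrite ey.
  rewrite -ey; elim: (s) p {sI Is Ap ey} => [p ->|q r IH p [a [b [Aa sb ->]]]] /=.
    by rewrite horner0.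
  by exists a.[x], b.[x]; split; [exists a|exact: IH|rewrite hornerD hornerM].
exfalso.
have I0 : I 0 by split; rewrite ?horner0.
have ID p q : I p -> I q -> I (p + q).
  by move=> [? ?] [? ?]; split; [exact: cD|rewrite hornerD; exact: JD].
have IM p q : coefs A p -> I q -> I (p * q).
  by move=> ? [? ?]; split; [exact: cM|rewrite hornerM; apply: JM => //; exists p].
have nxt (s : seq {poly K}) : exists p, (forall q, q \in s -> I q) ->
    [/\ I p, ~ sp s p & forall q, I q -> ~ sp s q -> (size p <= size q)%N].
  have [sI|nsI] := pselect (forall q, q \in s -> I q); last by exists 0 => /nsI.
  have [p0 [Ip0 np0]] : exists p, I p /\ ~ sp s p.
    apply: contrapT => h; apply: nfg; exists s; split=> // p Ip.
    by apply: contrapT => np; apply: h; exists p.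
  have ex : exists n, `[< exists2 p, I p /\ ~ sp s p & size p = n >].
    by exists (size p0); apply/asboolP; exists p0.
  case: (ex_minnP ex) => n /asboolP[p [Ip np] ep] hmin.
  exists p => _; split=> // q Iq nq; rewrite ep; apply: hmin.
  by apply/asboolP; exists q.
have [nx hnx] := choice nxt.
pose f n := iter n (fun s => nx s :: s) [::].
have fI n q : q \in f n -> I q.
  elim: n q => [//|n IH] q; rewrite inE => /orP[/eqP ->|]; last exact: IH.
  by case: (hnx _ IH).
have spS n p : sp (f n) p -> sp (f n.+1) p by apply: span_cons.
have nxP n := hnx _ (fI n).
have szS n : (size (nx (f n)) <= size (nx (f n.+1)))%N.
  have [_ _ h] := nxP n; have [Ip np _] := nxP n.+1.
  by apply: h => // /spS.
have szle n q : q \in f n -> (size q <= size (nx (f n)))%N.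
  elim: n q => [//|n IH] q; rewrite inE => /orP[/eqP ->|/IH]; first exact: szS.
  by move=> h; apply: leq_trans h _; apply: szS.
have nx0 n : nx (f n) != 0.
  have [_ np _] := nxP n; apply/eqP => e; apply: np; rewrite e.
  by have [] := span_submodule (f n) hcA.
have f0 n q : q \in f n -> q != 0.
  elim: n q => [//|n IH] q; rewrite inE => /orP[/eqP ->|]; [exact: nx0|exact: IH].
pose lc n := [seq lead_coef p | p <- f n].
have lcS m n y : (m <= n)%N -> span A (lc m) y -> span A (lc n) y.
  move=> /subnKC <-; elim: (n - m)%N => [|k IH]; first by rewrite addn0.
  by move=> /IH h; rewrite addnS; apply: span_cons => //; apply: subring0.
pose L := \bigcup_n span A (lc n).
have hAA := subring_submodule hA.
have hlc n := span_submodule (lc n) hAA.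
have [||s [sL Ls]] := nA L.
- split; first by exists 0%N.
  + move=> a b [m _ ma] [n _ nb]; exists (maxn m n) => //.
    by have [_ h _] := hlc (maxn m n); apply: h;
      [apply: lcS ma; apply: leq_maxl|apply: lcS nb; apply: leq_maxr].
  + by move=> a b Aa [n _ nb]; exists n => //; have [_ _ h] := hlc n; apply: h.
- move=> y [n _]; apply: span_sub; first exact: subring0.
    by move=> a b; apply: subringD.
  move=> a z Aa /mapP[p /fI[Ap _] ->]; apply: subringM => //; exact: Ap.
have [N sN] : exists N, forall y, y \in s -> span A (lc N) y.
  elim: (s) sL {Ls} => [|y r IH] sL; first by exists 0%N.
  have [|N hN] := IH; first by move=> z zr; apply: sL; rewrite inE zr orbT.
  have [M _ hM] := sL y (mem_head _ _).
  exists (maxn N M) => z; rewrite inE => /orP[/eqP ->|/hN h].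
    by apply: lcS hM; apply: leq_maxr.
  by apply: lcS h; apply: leq_maxl.
have LN : L `<=` span A (lc N).
  move=> y /Ls; have [h0 hD hM] := hlc N.
  by apply: span_sub => // a z Aa /sN; apply: hM.
set p := nx (f N); have [Ip np minp] := nxP N.
have Llp : span A (lc N) (lead_coef p).
  apply: LN; exists N.+1 => //; rewrite -[lead_coef p]mul1r.
  by apply: span_mul; rewrite /= ?mem_head //; [exact: subring0|exact: subring1].
(* Powers of ['X] raise the earlier generators to the degree of [p], so some combination [q] has the
   same top coefficient; then [p - q] is smaller and still outside the span. *)
have [q [sq Iq szq cq]] : exists q, [/\ sp (f N) q, I q, (size q <= size p)%N
    & q`_(size p).-1 = lead_coef p].
  have spow k a : A a -> coefs A (a *: 'X^k).
    move=> Aa i; rewrite coefZ coefXn; case: (i == k); rewrite ?mulr1 ?mulr0 //.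
    exact: subring0.
  have : forall r, (forall g, g \in r -> [/\ I g, (size g <= size p)%N & g != 0]) ->
    forall y, span A [seq lead_coef g | g <- r] y ->
    exists q, [/\ sp r q, I q, (size q <= size p)%N & q`_(size p).-1 = y].
    elim=> [|g r IH] hr y /=.
      by move->; exists 0; split; rewrite ?size_poly0 ?coef0.
    move=> [a [b [Aa sb ->]]].
    have [|q [sq Iq szq eq]] := IH _ _ sb.
      by move=> h hh; apply: hr; rewrite inE hh orbT.
    have [Ig szg g0] := hr g (mem_head _ _).
    have ca := spow (size p - size g)%N a Aa.
    exists (a *: 'X^(size p - size g) * g + q); split.
    - by exists (a *: 'X^(size p - size g)), q; split.
    - by apply: ID => //; apply: IM.
    - apply: leq_trans (size_polyD _ _) _; rewrite geq_max szq andbT.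
      rewrite -scalerAl mulrC; apply: leq_trans (size_scale_leq _ _) _.
      by rewrite size_mulXn // subnK.
    - rewrite coefD eq -scalerAl coefZ coefXnM; congr (_ * _ + _).
      rewrite lead_coefE; have : (0 < size g)%N by rewrite size_poly_gt0.
      case: (ltnP (size p).-1) => [h1 h2|h1 h2]; first by exfalso; move: (size g) (size p) h1 h2 szg; lia.
      by congr (g`_ _); move: (size g) (size p) h1 h2 szg; lia.
  apply => //; move=> g gf; split; [exact: fI gf|exact: szle|exact: f0 gf].
have Ipq : I (p - q).
  rewrite -[- q]mulN1r; apply: ID => //; apply: IM => //.
  move=> i; rewrite coefN coef1; apply: subringN => //.
  by case: (i == 0)%N; [exact: subring1|exact: subring0].
have p0 := nx0 N.
have npq : ~ sp (f N) (p - q).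
  move=> spq; apply: np; rewrite -/p -[p](subrK q).
  by have [_ h _] := span_submodule (f N) hcA; apply: h.
have := minp _ Ipq npq; apply/negP; rewrite -ltnNge -/p.
have szp : (0 < size p)%N by rewrite size_poly_gt0.
rewrite -[X in (_ < X)%N](prednK szp) ltnS; apply/leq_sizeP => j hj.
rewrite coefB; move: hj; rewrite leq_eqVlt => /orP[/eqP <-|hj].
  by rewrite cq lead_coefE subrr.
have hj' : (size p <= j)%N by rewrite -(prednK szp).
by rewrite !nth_default ?subrr // (leq_trans szq).
Qed.

End HilbertBasis.

(** * Projective models *)

Section Models.
Context {R : realType} {K : fieldType} (iota : {rmorphism R[i] -> K}).
Implicit Types (A O P N p : set K).

Local Notation consts := (range iota).

Lemma constsP c : consts (iota c). Proof. by exists c. Qed.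

Lemma consts_subring : is_subring consts.
Proof.
split; first by exists 1; rewrite ?rmorph1.
move=> _ _ [a _ <-] [b _ <-]; split; first by exists (a - b); rewrite ?rmorphB.
by exists (a * b); rewrite ?rmorphM.
Qed.

Lemma noetherian_consts : noetherian consts.
Proof.
move=> J [J0 JD JM] JC.
have [[c [Jc c0]]|h] := pselect (exists c, J (iota c) /\ c != 0); last first.
  exists [::]; split=> // y Jy /=; have [c _ ec] := JC _ Jy.
  have [c0|c0] := eqVneq c 0; first by rewrite -ec c0 rmorph0.
  by case: h; exists c; rewrite ec.
exists [:: 1]; split=> [x|y Jy /=].
  rewrite inE => /eqP ->; have -> : 1 = iota c^-1 * iota c.
    by rewrite -rmorphM mulVf // rmorph1.
  exact: JM.
by exists y, 0; rewrite mulr1 addr0; split => //; exact: JC.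
Qed.

Section Forms.
Variables (n : nat) (x : 'I_n.+1 -> K).
Hypothesis x_neq0 : forall i, x i != 0.

Fixpoint monomials d : seq K :=
  if d is d'.+1 then [seq x i * m | i <- enum 'I_n.+1, m <- monomials d'] else [:: 1].

(** Forms are represented by their values in [K] at the generic point, so each degree has a finite
    spanning list and quotients of forms need no separate construction. *)
Definition forms d : set K := span consts (monomials d).

Lemma forms_submodule d : submodule consts (forms d).
Proof. exact/span_submodule/subring_submodule/consts_subring. Qed.

Lemma forms_mulx d i y : forms d y -> forms d.+1 (x i * y).
Proof.
have [f0 fD fM] := forms_submodule d.+1.
pose M := [set y | forms d.+1 (x i * y)].
apply: (@span_sub _ _ M); rewrite /M /=.
- by rewrite mulr0.
- by move=> a b ha hb; rewrite mulrDr; apply: fD.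
- move=> a m [c _ <-] hm; rewrite mulrCA; apply: span_mul => //.
  + by exists 0; rewrite ?rmorph0.
  + by apply/allpairsP; exists (i, m); rewrite mem_enum.
Qed.

Lemma forms_const c : forms 0 (iota c).
Proof. by exists (iota c), 0; rewrite mulr1 addr0; split; rewrite //=; exact: constsP. Qed.

Lemma formsM d e a b : forms d a -> forms e b -> forms (d + e) (a * b).
Proof.
move=> + fb; pose M := [set y | forms (d + e) (y * b)].
have [f0 fD fM] := forms_submodule (d + e).
suff h : forall m, m \in monomials d -> M m.
  apply: (@span_sub _ _ M); rewrite /M /=; first by rewrite mul0r.
    by move=> y z hy hz; rewrite mulrDl; apply: fD.
  by move=> y m hy /h hm; rewrite -mulrA; apply: fM.
rewrite /M {M f0 fD fM}; elim: d => [|d IH] m /=.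
  by rewrite inE => /eqP ->; rewrite mul1r.
by move=> /allpairsP[[i m'] /= [_ hm ->]]; rewrite -mulrA addSn; apply/forms_mulx/IH.
Qed.

Lemma forms_x i : forms 1 (x i).
Proof. by rewrite -[x i]mulr1 -(rmorph1 iota); apply/forms_mulx/forms_const. Qed.

Lemma formsX d a : forms 1 a -> forms d (a ^+ d).
Proof.
move=> fa; elim: d => [|d IH]; first by rewrite expr0 -(rmorph1 iota); apply: forms_const.
by rewrite exprS -add1n; apply: formsM.
Qed.

(* The coordinate ring of the complement of the hyperplane z = 0. *)
Definition affine z : set K := [set f | exists d, forms d (f * z ^+ d)].

Section Affine.
Variable z : K.
Hypotheses (fz : forms 1 z) (z0 : z != 0).

Lemma affine_const : consts `<=` affine z.
Proof. by move=> _ [c _ <-]; exists 0%N; rewrite expr0 mulr1; apply: forms_const. Qed.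

Lemma affine_subring : is_subring (affine z).
Proof.
split; first by rewrite -(rmorph1 iota); apply/affine_const/constsP.
move=> a b [d fa] [e fb]; split; exists (d + e)%N.
  have -> : (a - b) * z ^+ (d + e) = a * z ^+ d * z ^+ e - b * z ^+ e * z ^+ d.
    by rewrite exprD; ring.
  apply: submoduleB; [exact: consts_subring|exact: forms_submodule| |].
    by apply: formsM => //; apply: formsX.
  by rewrite addnC; apply: formsM => //; apply: formsX.
by rewrite exprD mulrACA; apply: formsM.
Qed.

Lemma affine_subalgebra : is_subalgebra iota (affine z).
Proof. by split; [exact: affine_subring|exact: affine_const]. Qed.

Lemma affine_form w : forms 1 w -> affine z (w / z).
Proof. by move=> fw; exists 1%N; rewrite expr1 divfK. Qed.

Lemma affine_change w f : w != 0 -> affine w f ->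
  exists2 g, affine z g & exists d, f = g / (w / z) ^+ d.
Proof.
move=> w0 [d fd]; exists (f * (w / z) ^+ d); last first.
  by exists d; rewrite mulfK // expf_neq0 // mulf_neq0 ?invr_eq0.
by exists d; rewrite expr_div_n -mulrA divfK // expf_neq0.
Qed.

End Affine.

Lemma chartE i : chart iota x i = affine (x i).
Proof.
apply/seteqP; split.
  apply: smallest_sub; first exact/affine_subalgebra/forms_x.
  by move=> _ [j _ <-]; apply: affine_form => //; apply: forms_x.
move=> f [d fd]; rewrite -[f](mulfK (expf_neq0 d (x_neq0 i))).
move: fd; set y := f * _ => fd; move: y fd => {f}.
move=> y fd A [[hA CA] xA].
pose M := [set y | A (y / x i ^+ d)].
apply: (@span_sub _ _ M) fd; rewrite /M /=.
- by rewrite mul0r; apply: subring0.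
- by move=> a b; rewrite mulrDl; apply: subringD.
- move=> a m Ca hm; rewrite -mulrA; apply: subringM => //; first exact: CA.
  elim: d m hm {M} => [|d IH] m /=.
    by rewrite inE => /eqP ->; rewrite mul1r invr1; apply: subring1.
  move=> /allpairsP[[j m'] /= [_ hm ->]].
  rewrite exprS -mulf_div; apply: subringM => //; last exact: IH.
  by apply: xA; exists j.
Qed.

Lemma chart_subring i : is_subring (chart iota x i).
Proof. by rewrite chartE; apply/affine_subring/forms_x. Qed.

Lemma chart_const i : consts `<=` chart iota x i.
Proof. by rewrite chartE; apply: affine_const. Qed.

Lemma chart_gen i j : chart iota x i (x j / x i).
Proof. by move=> A [_]; apply; exists j. Qed.

(** The coordinates are adjoined to the field of constants one at a time, by Hilbert's basis
    theorem. *)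
Lemma noetherian_chart i : noetherian (chart iota x i).
Proof.
pose B (r : seq 'I_n.+1) := foldr (fun j A => adjoin A (x j / x i)) consts r.
have hB r : is_subring (B r).
  by elim: r => [|j r IH] /=; [exact: consts_subring|exact: adjoin_subring].
have nB r : noetherian (B r).
  by elim: r => [|j r IH] /=; [exact: noetherian_consts|exact: hilbert_basis].
suff -> : chart iota x i = B (enum 'I_n.+1) by [].
apply/seteqP; split.
  apply: smallest_sub.
    split=> //; elim: (enum _) => [//|j r IH] /=.
    by apply: subset_trans IH _; apply: sub_adjoin.
  move=> _ [j _ <-]; have : j \in enum 'I_n.+1 by rewrite mem_enum.
  elim: (enum _) => [//|k r IH]; rewrite inE => /orP[/eqP <-|/IH h] /=.
    exact: mem_adjoin.
  exact: sub_adjoin.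
elim: (enum _) => [|j r IH] /=; first exact: chart_const.
move=> _ [p hp <-]; rewrite horner_coef; apply: subring_sum; first exact: chart_subring.
move=> k _; have hc := chart_subring i.
apply: (subringM hc); first by apply: IH; apply: (hp k).
by apply: (subringX _ hc); apply: chart_gen.
Qed.

Lemma model_affine O : model iota x O ->
  exists i p, prime_ideal (affine (x i)) p /\ O = localization (affine (x i)) p.
Proof. by move=> [i [p]]; rewrite chartE => h; exists i, p. Qed.

Lemma affine_model i p : prime_ideal (affine (x i)) p ->
  model iota x (localization (affine (x i)) p).
Proof. by move=> hp; exists i, p; rewrite chartE. Qed.

Lemma model_local O : model iota x O -> local_ring O.
Proof.
move=> [i [p [hp ->]]]; apply: localization_local => //; exact: chart_subring.
Qed.

Lemma model_const O : model iota x O -> consts `<=` O.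
Proof.
move=> [i [p [hp ->]]] a Ca.
by apply: (sub_localization (chart_subring i) hp); apply: chart_const.
Qed.

Lemma noetherian_model O : model iota x O -> noetherian O.
Proof.
move=> [i [p [hp ->]]]; apply: noetherian_localization => //.
- exact: chart_subring.
- exact: noetherian_chart.
Qed.

Lemma model_chart_sub O : model iota x O -> exists i, affine (x i) `<=` O.
Proof.
move=> /model_affine[i [p [hp ->]]]; exists i.
by apply: sub_localization => //; apply/affine_subring/forms_x.
Qed.

(** The hyperplane [z = 0] is arbitrary, so that a single affine chart can later contain several
    points. Since [x i / z] is a unit of [O], fractions over the chart of [x i] can be rewritten
    over that of [z]. *)
Lemma model_localization O z : model iota x O -> forms 1 z -> z != 0 ->
  affine z `<=` O -> O = localization (affine z) (maxid O `&` affine z).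
Proof.
move=> XO fz z0 zO; have hO := model_local XO; have [hO' _] := hO.
apply/seteqP; split; last exact: localization_maxidI_sub (affine_subring fz) _ _.
have [i [p [hp eO]]] := model_affine XO; have fxi := forms_x i.
have hi := affine_subring fxi; have hz := affine_subring fz.
have iO : affine (x i) `<=` O by rewrite eO; apply: sub_localization.
have w0 : x i / z != 0 by rewrite mulf_neq0 ?invr_eq0.
have wz : affine z (x i / z) by apply: affine_form.
have uw : loc_unit O (x i / z).
  split=> //; split; first exact: zO.
  by rewrite invf_div; apply/iO/affine_form.
have uX d : loc_unit O ((x i / z) ^+ d).
  elim: d => [|d IH]; first by rewrite expr0; apply: loc_unit1.
  by rewrite exprS; apply: loc_unitM.
move=> f; rewrite {1}eO => -[a [b [ia ib nb ->]]].
have [a' za' [d ea]] := affine_change z0 (x_neq0 i) ia.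
have [b' zb' [e eb]] := affine_change z0 (x_neq0 i) ib.
have ub : loc_unit O b.
  apply: loc_unitP; first exact: iO.
  by move=> mb; apply: nb; rewrite -(maxid_localizationI hi hp) -eO.
have b0 : b != 0 by case: ub.
set w := x i / z in w0 wz uw uX ea eb *.
have eb' : b' = b * w ^+ e by rewrite eb divfK // expf_neq0.
exists (a' * w ^+ e), (b' * w ^+ d); split.
- by apply: subringM => //; apply: subringX.
- by apply: subringM => //; apply: subringX.
- by move=> [[_ +] _]; apply; rewrite eb'; do 2?apply: loc_unitM.
- by rewrite ea eb'; field; rewrite b0 !expf_neq0.
Qed.

Lemma model_center V i : local_ring V -> affine (x i) `<=` V ->
  exists2 O, model iota x O & dominates V O.
Proof.
move=> hV iV; have hi := affine_subring (forms_x i).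
exists (localization (affine (x i)) (maxid V `&` affine (x i))).
  by apply/affine_model/maxidI_prime.
exact: dominates_localization.
Qed.

(** Separatedness: [x j / x i] is a unit of [V], hence of [O1], so both centers lie in the chart of
    [x j], where they are the localization at the same prime. *)
Lemma model_center_unique V O1 O2 : model iota x O1 -> model iota x O2 ->
  dominates V O1 -> dominates V O2 -> O1 = O2.
Proof.
move=> XO1 XO2 d1 d2.
have [i iO1] := model_chart_sub XO1; have [j jO2] := model_chart_sub XO2.
have [hO1 _] := model_local XO1.
have u : loc_unit O1 (x j / x i).
  have xji : O1 (x j / x i) by apply/iO1/affine_form/forms_x.
  apply: (dominates_unit d1) => //; split.
    by rewrite mulf_neq0 ?invr_eq0.
  split; first by case: d1 => h _; apply: h.
  by rewrite invf_div; case: d2 => h _; apply/h/jO2/affine_form/forms_x.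
have jO1 : affine (x j) `<=` O1.
  move=> f /(affine_change (x_neq0 i) (x_neq0 j))[g ig [d ->]].
  apply: subringM => //; first exact: iO1.
  by rewrite -exprVn; apply: subringX => //; case: u => _ [].
rewrite (model_localization XO1 (forms_x j) (x_neq0 j) jO1).
rewrite (model_localization XO2 (forms_x j) (x_neq0 j) jO2).
congr (localization _ _); apply/seteqP; split=> a [ma ja]; split=> //.
  rewrite -(dominates_maxidI d2); split; last exact: jO2.
  by case: d1 => _; apply.
rewrite -(dominates_maxidI d1); split; last exact: jO1.
by case: d2 => _; apply.
Qed.

Lemma model_sub_localization O O' : model iota x O -> model iota x O' ->
  O `<=` O' -> O' = localization O (maxid O' `&` O).
Proof.
move=> XO XO' OO'; have [i iO] := model_chart_sub XO.
have [hO _] := model_local XO; have hO' := model_local XO'.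
apply/seteqP; split; last exact: localization_maxidI_sub.
rewrite {1}(model_localization XO' (forms_x i) (x_neq0 i) (subset_trans iO OO')).
move=> _ [a [b [ia ib nb ->]]]; exists a, b; split => //.
- exact: iO.
- exact: iO.
- by move=> [mb _]; apply: nb.
Qed.

Lemma model_localization_mem O q : model iota x O -> prime_ideal O q ->
  model iota x (localization O q).
Proof.
move=> /model_affine[i [p [hp ->]]] hq; have hi := affine_subring (forms_x i).
rewrite localization_localization //; apply: affine_model.
exact: prime_localizationI hq.
Qed.

Lemma affine_frac i j : localization (affine (x i)) [set 0] `<=`
  localization (affine (x j)) [set 0].
Proof.
have hj := affine_subring (forms_x j).
move=> _ [a [b [ia ib /eqP b0 ->]]].
have [a' ja' [d ea]] := affine_change (x_neq0 j) (x_neq0 i) ia.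
have [b' jb' [e eb]] := affine_change (x_neq0 j) (x_neq0 i) ib.
have w0 : x i / x j != 0 by rewrite mulf_neq0 ?invr_eq0.
have jw : affine (x j) (x i / x j) by apply: affine_form => //; apply: forms_x.
have b'0 : b' != 0 by apply: contraNneq b0; rewrite eb => ->; rewrite mul0r.
exists (a' * (x i / x j) ^+ e), (b' * (x i / x j) ^+ d); split.
- by apply: subringM => //; apply: subringX.
- by apply: subringM => //; apply: subringX.
- by apply/eqP; rewrite mulf_neq0 ?expf_neq0.
- rewrite ea eb; set w := x i / x j in w0 *; field.
  by rewrite b'0 /= !expf_neq0.
Qed.

Lemma funfieldE i : funfield (model iota x) = localization (affine (x i)) [set 0].
Proof.
have hi := affine_subring (forms_x i).
apply/seteqP; split=> f; last first.
  move=> h; exists (localization (affine (x i)) [set 0]) => //.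
  exact/affine_model/prime_zero.
move=> [Q /model_affine[j [p [hp ->]]]] [a [b [ja jb nb ->]]].
apply: (affine_frac (i := j)); exists a, b; split=> // b0; apply: nb; rewrite b0.
by case: hp => _ [].
Qed.

Lemma funfield_model : model iota x (funfield (model iota x)).
Proof. by rewrite (funfieldE ord0); apply/affine_model/prime_zero/affine_subring/forms_x. Qed.

Lemma funfield_inv f : funfield (model iota x) f -> funfield (model iota x) f^-1.
Proof.
rewrite (funfieldE ord0) => -[a [b [ia ib b0 ->]]]; rewrite invf_div.
have [a0|a0] := eqVneq a 0; last by exists b, a; split=> //; apply/eqP.
exists 0, 1; rewrite a0 invr0 mulr0 mul0r; split=> //.
- by apply: subring0; apply: affine_subring; apply: forms_x.
- by apply: subring1; apply: affine_subring; apply: forms_x.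
- by apply/eqP; rewrite oner_eq0.
Qed.

Lemma model_funfield_sub O : model iota x O -> O `<=` funfield (model iota x).
Proof. by move=> XO f Of; exists O. Qed.

Lemma model_frac O f : model iota x O -> funfield (model iota x) f ->
  exists a b, [/\ O a, O b, b != 0 & f = a / b].
Proof.
move=> XO; have [i iO] := model_chart_sub XO.
rewrite (funfieldE i) => -[a [b [ia ib /eqP b0 ->]]]; exists a, b.
by split=> //; apply: iO.
Qed.

Lemma form_quotient_funfield i j : funfield (model iota x) (x i / x j).
Proof.
rewrite (funfieldE j); apply: sub_localization.
- exact/affine_subring/forms_x.
- exact/prime_zero/affine_subring/forms_x.
- by apply: affine_form => //; apply: forms_x.
Qed.

(* The valuative criterion of properness. *)
Lemma valuation_ring_chart V : is_subring V -> consts `<=` V ->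
  (forall f, funfield (model iota x) f -> f != 0 -> V f \/ V f^-1) ->
  exists i, affine (x i) `<=` V.
Proof.
move=> hV CV vV.
(* [i] is a coordinate of least value, found by comparing the coordinates one after another. *)
have [i hi] : exists i, forall j, j \in enum 'I_n.+1 -> V (x j / x i).
  elim: (enum _) => [|j r [i hi]]; first by exists ord0.
  have [h|h] := vV _ (form_quotient_funfield j i)
    (mulf_neq0 (x_neq0 j) (invr_neq0 (x_neq0 i))).
    by exists i => k; rewrite inE => /orP[/eqP ->|/hi].
  exists j => k; rewrite inE => /orP[/eqP ->|/hi h'].
    by rewrite divff //; apply: subring1.
  have -> : x k / x j = x k / x i * (x j / x i)^-1.
    by rewrite invf_div mulrA divfK.
  exact: subringM.
exists i; rewrite -chartE; apply: smallest_sub => //.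
by move=> _ [j _ <-]; apply: hi; rewrite mem_enum.
Qed.

End Forms.
End Models.

(** * Complex points *)

Section LinearDependence.
Context {F : fieldType} {K : fieldType} (f : {rmorphism F -> K}).

Lemma spanE (s : seq K) y : span (range f) s y ->
  exists c : nat -> F, y = \sum_(j < size s) f (c j) * s`_j.
Proof.
elim: s y => [|x s IH] y /=; first by move->; exists (fun=> 0); rewrite big_ord0.
move=> [_ [b [[a _ <-] /IH[c ->] ->]]].
by exists (fun j => if j is j'.+1 then c j' else a); rewrite big_ord_recl.
Qed.

Lemma span_dependent (s : seq K) m (y : 'I_m -> K) :
  (size s < m)%N -> (forall i, span (range f) s (y i)) ->
  exists a : 'I_m -> F, (exists i, a i != 0) /\ \sum_i f (a i) * y i = 0.
Proof.
move=> sm hy; have /choice[c hc] := fun i => spanE (hy i).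
pose A := \matrix_(i < m, j < size s) c i j.
have : ~~ row_free A.
  by rewrite /row_free neq_ltn (leq_ltn_trans (rank_leq_col A) sm).
move=> /negP hA.
have [v vA v0] : exists2 v : 'rV_m, v *m A = 0 & v <> 0.
  apply: contrapT => h; have : row_free A; last by move/hA.
  apply: inj_row_free => v vA; apply: contrapT => v0; apply: h.
  by exists v.
exists (v 0); split.
  apply: contrapT => h; apply: v0; apply/rowP => i; rewrite mxE.
  by apply/eqP/negPn/negP => vi; apply: h; exists i.
under eq_bigr do rewrite hc mulr_sumr.
rewrite exchange_big /= big1 // => j _.
transitivity (f ((v *m A) 0 j) * s`_j); last by rewrite vA mxE rmorph0 mul0r.
rewrite mxE rmorph_sum mulr_suml; apply: eq_bigr => i _.
by rewrite mxE rmorphM mulrA.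
Qed.

End LinearDependence.

(** * The Nullstellensatz and global regular functions *)

Section Nullstellensatz.
Context {R : realType} {K : fieldType} (iota : {rmorphism R[i] -> K}).
Implicit Types (A O P p J : set K).

Local Notation consts := (range iota).

(** If the [S d] covered the complex numbers, the reals would be countable and [0, 1] would have
    Lebesgue measure 0. *)
Lemma complex_not_countable_union (S : nat -> set R[i]) :
  (forall d, finite_set (S d)) -> ~ (forall c, exists d, S d c).
Proof.
move=> fS hS; have cT : countable [set: R].
  have -> : [set: R] = \bigcup_d (real_complex R @^-1` S d).
    by apply/seteqP; split=> // r _; have [d] := hS r%:C%C; exists d.
  apply: bigcup_countable => // d _; apply: finite_set_countable.
  by apply: finite_preimage => // a b _ _; apply: complexI.
have c01 : countable [set` `[(0:R), 1]].
  by apply: sub_countable cT; apply: subset_card_le.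
have := countable_lebesgue_measure0 c01.
rewrite lebesgue_measure_itv /= lte_fin ltr01 -EFinB subr0 => -[] /eqP.
by rewrite oner_eq0.
Qed.

(** The complex numbers are algebraically closed, so [q] splits, and a prime ideal contains one of
    the linear factors. *)
Lemma prime_poly_root A p t (q : {poly R[i]}) : is_subring A -> consts `<=` A ->
  prime_ideal A p -> A t -> q != 0 -> p (map_poly iota q).[t] ->
  exists c, p (t - iota c).
Proof.
move=> hA CA hp At q0; have [pA [p0 p1] pD pM pP] := hp.
have [r ->] := closed_field_poly_normal q.
have Ac c : A (iota c) by apply: CA; exists c.
rewrite map_polyZ hornerZ map_prod_XsubC horner_prod.
have AtB c : A ('X - (iota c)%:P).[t] by rewrite hornerXsubC; exact: subringB.
move=> /pP[].
- exact: Ac.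
- exact: subring_prod.
- move=> pl; case: p1; have -> : 1 = iota (lead_coef q)^-1 * iota (lead_coef q).
    by rewrite -rmorphM mulVf ?lead_coef_eq0 // rmorph1.
  exact: pM.
elim: r => [|c r IH]; rewrite ?big_nil // big_cons => /pP[].
- exact: AtB.
- exact: subring_prod.
- by rewrite hornerXsubC => h; exists c.
- exact: IH.
Qed.

Lemma poly_root_const t (q : {poly R[i]}) : q != 0 -> (map_poly iota q).[t] = 0 ->
  exists c, t = iota c.
Proof.
move=> q0 hq; have hT : is_subring [set: K] by split.
have [c /eqP] := prime_poly_root hT (@subsetT _ _) (prime_zero hT) I q0 hq.
by rewrite subr_eq0 => /eqP; exists c.
Qed.

Variables (n : nat) (x : 'I_n.+1 -> K).
Hypothesis x_neq0 : forall i, x i != 0.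

Local Notation X := (model iota x).
Local Notation forms := (forms iota x).
Local Notation affine := (affine iota x).

Definition maximal_ideal A m : Prop :=
  [/\ submodule A m, m `<=` A, ~ m 1
    & forall J, submodule A J -> J `<=` A -> ~ J 1 -> m `<=` J -> J `<=` m].

Lemma maximal_ideal_inv A m a : is_subring A -> maximal_ideal A m -> A a -> ~ m a ->
  exists2 y, A y & m (1 - a * y).
Proof.
move=> hA [hm mA m1 mmax] Aa na; pose J := sum_set m (principal a A).
have hJ : submodule A J by apply: sum_set_submodule => //; apply: principal_submodule.
have [m0 _ _] := hm.
have [J1|nJ1] := pselect (J 1).
  have [u [_ [mu [y Ay <-] e]]] := J1; exists y => //.
  by rewrite e addrK.
exfalso; apply: na; apply: (mmax J) => //.
- by move=> _ [u [_ [mu [y Ay <-] ->]]]; apply: subringD => //; [exact: mA|exact: subringM].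
- move=> u mu; exists u, 0; split; rewrite ?addr0 //.
  by exists 0; [exact: subring0|rewrite mulr0].
- exists 0, a; split; rewrite ?add0r //.
  by exists 1; [exact: subring1|rewrite mulr1].
Qed.

Lemma maximal_ideal_prime A m : is_subring A -> maximal_ideal A m -> prime_ideal A m.
Proof.
move=> hA hm; have [[m0 mD mM] mA m1 _] := hm; split=> // a b Aa Ab mab.
have [ma|na] := pselect (m a); [by left|right].
have [y Ay my] := maximal_ideal_inv hA hm Aa na.
have -> : b = b * (1 - a * y) + y * (a * b) by ring.
by apply: mD; apply: mM.
Qed.

(* If t - c were invertible modulo m for all c, the inverses would be linearly
   independent, but the coordinate ring has countable dimension. *)
Lemma maximal_ideal_value z m t : forms 1 z -> z != 0 ->
  maximal_ideal (affine z) m -> affine z t -> exists c, m (t - iota c).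
Proof.
move=> fz z0 hm At; apply: contrapT => hc.
have hA := affine_subring fz; have CA : consts `<=` affine z by apply: affine_const.
have Ac c : affine z (iota c) by apply: CA; exists c.
have inv c : exists y, affine z y /\ m (1 - (t - iota c) * y).
  have [||y Ay my] := @maximal_ideal_inv _ _ (t - iota c) hA hm.
  - exact: subringB.
  - by move=> mc; apply: hc; exists c.
  by exists y.
have [y hy] := choice inv.
(* [S d] collects the [c] whose chosen inverse has denominator [z ^+ d]. Some [S d] is infinite, and
   more of its members than there are monomials of degree [d] give a linear relation between
   inverses. *)
pose S d := [set c | forms d (y c * z ^+ d)].
have [fS|/existsNP[d infS]] := pselect (forall d, finite_set (S d)).
  apply: (complex_not_countable_union fS) => c.
  by have [[d hd] _] := hy c; exists d.
have [B BS szB] := infinite_set_fset (size (monomials x d)).+1 infS.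
pose s := finmap.enum_fset B; have us : uniq s by apply: finmap.fset_uniq.
pose k := size s; pose c (i : 'I_k) := s`_i.
have ci i : S d (c i) by apply: BS; apply: mem_nth.
have [a [[i0 ai0] ha]] := @span_dependent _ _ iota (monomials x d) k
  (fun i => y (c i) * z ^+ d) szB ci.
have ha' : \sum_i iota (a i) * y (c i) = 0.
  apply: (mulIf (expf_neq0 d z0)); rewrite mul0r -[RHS]ha mulr_suml.
  by apply: eq_bigr => i _; rewrite mulrA.
have cinj i j : c i = c j -> i = j.
  by move=> /eqP; rewrite nth_uniq // => /eqP/val_inj.
pose e i := \prod_(j < k | j != i) ('X - (c j)%:P).
(* Clearing the denominators [t - c i] of the relation gives [q]. Its value at [c i0] is [a i0]
   times a product of nonzero differences, so [q] is not zero. *)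
pose q := \sum_i a i *: e i.
have q0 : q != 0.
  apply/eqP => /(congr1 (horner^~ (c i0))); rewrite horner0 horner_sum.
  rewrite (bigD1 i0) //= big1 ?addr0 => [|i ii0].
    rewrite hornerZ => /eqP; rewrite mulf_eq0 (negPf ai0) /= /e horner_prod.
    rewrite prodf_seq_eq0 => /hasP[j _ /andP[ji]]; rewrite hornerXsubC subr_eq0.
    by move=> /eqP/cinj e'; rewrite e' eqxx in ji.
  rewrite hornerZ /e horner_prod (bigD1 i0) /=; last by rewrite eq_sym.
  by rewrite hornerXsubC subrr mul0r mulr0.
pose u i := (map_poly iota (e i)).[t].
have uE i : u i = \prod_(j < k | j != i) (t - iota (c j)).
  rewrite /u /e map_prod_XsubC horner_prod; apply: eq_bigr => j _.
  by rewrite hornerXsubC.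
have Au i : affine z (u i).
  by rewrite uE; apply: subring_prod => // j _; apply: subringB.
have [hm' mA m1 _] := hm; have [m0 mD mM] := hm'.
have hmp := maximal_ideal_prime hA hm.
apply: hc; apply: (prime_poly_root hA CA hmp At q0).
have -> : (map_poly iota q).[t] = \sum_i iota (a i) * u i * (1 - (t - iota (c i)) * y (c i)).
  transitivity (\sum_i iota (a i) * u i).
    rewrite /q rmorph_sum horner_sum; apply: eq_bigr => i _.
    by rewrite /= map_polyZ hornerZ.
  pose Pr := \prod_(j < k) (t - iota (c j)).
  rewrite -[LHS]subr0 -[X in _ - X](mulr0 Pr) -[X in _ * X]ha' mulr_sumr -sumrB.
  apply: eq_bigr => i _; rewrite mulrBr mulr1; congr (_ - _).
  by rewrite /Pr (bigD1 i) //= -uE; ring.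
apply: submodule_sum hm' _ => i _; apply: mM; last by case: (hy (c i)).
exact: subringM.
Qed.

(** Weak Nullstellensatz: the point is a maximal ideal above [J], and [maximal_ideal_value]
    evaluates the numerators and denominators of its local ring. *)
Lemma exists_Cpoint i J : submodule (affine (x i)) J -> J `<=` affine (x i) -> ~ J 1 ->
  exists P, [/\ Cpoint iota X P, affine (x i) `<=` P & J `<=` maxid P].
Proof.
move=> hJ JA J1; have fx := forms_x iota x i; have hA := affine_subring fx.
have nA : noetherian (affine (x i)) by rewrite -(chartE iota x_neq0); apply: noetherian_chart.
pose F := [set I | [/\ submodule (affine (x i)) I, I `<=` affine (x i), ~ I 1 & J `<=` I]].
have [||m [[hm mA m1 Jm] maxm]] := @noetherian_maximal _ _ F hA nA.
- by exists J; split.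
- by move=> I [].
have hmax : maximal_ideal (affine (x i)) m.
  split=> // I hI IA I1 mI; apply: maxm => //; split=> //.
  exact: subset_trans mI.
have hmp := maximal_ideal_prime hA hmax.
exists (localization (affine (x i)) m); split; last first.
- move=> a Ja; have : m a by apply: Jm.
  by rewrite -{1}(maxid_localizationI hA hmp) => -[].
- exact: sub_localization.
split; first exact: affine_model.
move=> _ [a [b [Aa Ab nb ->]]].
have [ca ma] := maximal_ideal_value fx (x_neq0 i) hmax Aa.
have [cb mb] := maximal_ideal_value fx (x_neq0 i) hmax Ab.
have [m0 mD mM] := hm.
have Ac c : affine (x i) (iota c) by apply: affine_const; exists c.
have cb0 : cb != 0 by apply: contra_not_neq nb => cb0; rewrite cb0 rmorph0 subr0 in mb.
have b0 : b != 0 by apply: contra_not_neq nb => ->.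
exists (ca / cb); rewrite /has_value maxid_localization //.
exists (iota cb^-1 * (iota cb * (a - iota ca) - iota ca * (b - iota cb))), b; split=> //.
  by apply: (mM) => //; apply: (submoduleB hA hm); apply: mM.
rewrite fmorph_div fmorphV; field.
by rewrite b0 fmorph_eq0.
Qed.

Lemma model_sub_Cpoint O : X O -> exists2 P, Cpoint iota X P & P `<=` O.
Proof.
move=> XO; have [i iO] := model_chart_sub x_neq0 XO.
have hO := model_local x_neq0 XO; have fx := forms_x iota x i.
have hA := affine_subring fx.
have hp := maxidI_prime hA hO iO; have [pA [p0 p1] _ _ _] := hp.
have [P [CP iP pP]] := exists_Cpoint (prime_ideal_submodule hp) pA p1.
exists P => //; rewrite (model_localization x_neq0 CP.1 fx (x_neq0 i) iP).
apply: localization_sub => //; first by apply: maxidI_prime => //; apply: model_local CP.1.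
- by case: hO.
move=> b ib nb; apply: maxid_inv => [|mb]; first exact: iO.
by apply: nb; split=> //; apply: pP.
Qed.

(** The ideal [J] of denominators of [f], if proper, would lie in the maximal ideal of a complex
    point; but [f] is regular there and has a denominator outside that ideal. *)
Lemma regular_chart f i : (forall P, Cpoint iota X P -> P f) -> affine (x i) f.
Proof.
move=> hf; have fx := forms_x iota x i; have hA := affine_subring fx.
pose J := [set a | affine (x i) a /\ affine (x i) (a * f)].
apply: contrapT => nf; have [|||P [CP iP JP]] := @exists_Cpoint i J.
- split; first by split; rewrite ?mul0r; apply: subring0.
  + by move=> a b [Aa Af] [Ab Abf]; split; rewrite ?mulrDl; apply: subringD.
  + by move=> a b Aa [Ab Abf]; split; rewrite -?mulrA; apply: subringM.
- by move=> a [].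
- by move=> [_]; rewrite mul1r.
have := hf P CP; rewrite {1}(model_localization x_neq0 CP.1 fx (x_neq0 i) iP).
move=> [a [b [ia ib nb ef]]]; have b0 : b != 0.
  apply: contra_not_neq nb => ->; split; last exact: subring0.
  by have [_ []] := model_local x_neq0 CP.1.
apply: nb; split=> //; apply: JP; split=> //.
by rewrite ef mulrC divfK.
Qed.

Lemma monomial_exponents d m : m \in monomials x d ->
  exists2 e : 'I_n.+1 -> nat, (\sum_i e i = d)%N & m = \prod_i x i ^+ e i.
Proof.
elim: d m => [|d IH] m /=.
  by rewrite inE => /eqP ->; exists (fun=> 0%N); rewrite big1.
move=> /allpairsP[[i m'] /= [_ /IH[e <- ->] ->]].
exists (fun j => e j + (j == i))%N.
  rewrite big_split -[RHS]addn1; congr (_ + _)%N.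
  by rewrite (bigD1 i) //= eqxx big1 // => j /negPf ->.
rewrite (bigD1 i) //= [RHS](bigD1 i) //= mulrA eqxx addn1 exprS; congr (_ * _).
by apply: eq_bigr => j /negPf ->; rewrite addn0.
Qed.

Lemma forms_prod (e : 'I_n.+1 -> nat) : forms (\sum_i e i) (\prod_i x i ^+ e i).
Proof.
elim: (index_enum _) => [|i r IH].
  by rewrite !big_nil -(rmorph1 iota); apply: forms_const.
by rewrite !big_cons; apply: formsM => //; apply/formsX/forms_x.
Qed.

(* Multiplication by f preserves the forms of large degree, so f is algebraic
   over the constants. *)
Lemma regular_const f : (forall P, Cpoint iota X P -> P f) -> exists c, f = iota c.
Proof.
move=> hf; have hi i := regular_chart i hf; have [d0 hd0] := choice hi.
pose d := (\max_i d0 i)%N.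
have hd i : forms d (f * x i ^+ d).
  have le : (d0 i <= d)%N by apply: leq_bigmax.
  rewrite -{2}(subnKC le) exprD mulrA -{1}(subnKC le).
  by apply: formsM => //; apply/formsX/forms_x.
(* Among [n + 1] exponents with sum [(n + 1) * d] one is at least [d], and [f * x i ^+ d] is a form;
   hence multiplication by [f] preserves [forms N]. *)
pose N := (n.+1 * d)%N.
have fN y : forms N y -> forms N (f * y).
  have [f0 fD fM] := forms_submodule iota x N.
  pose M := [set y | forms N (f * y)].
  apply: (@span_sub _ _ M); rewrite /M /=; first by rewrite mulr0.
    by move=> a b ha hb; rewrite mulrDr; apply: fD.
  move=> a m Ca /monomial_exponents[e se ->]; rewrite mulrCA; apply: fM => //.
  have [i ei] : exists i, (d <= e i)%N.
    apply: contrapT => /forallNP h.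
    case: (posnP d) => [d_0|d_gt0]; first by apply: (h ord0); rewrite d_0.
    have : (\sum_i e i <= \sum_(i < n.+1) d.-1)%N.
      by apply: leq_sum => i _; move: (h i) => /negP; rewrite -ltnNge -{1}(prednK d_gt0).
    rewrite se sum_nat_const card_ord leq_mul2l /=.
    by rewrite -{1}(prednK d_gt0) ltnn.
  pose e' j := if j == i then (e i - d)%N else e j.
  have es : (\sum_j e' j + d = N)%N.
    rewrite -se (bigD1 i) //= [in RHS](bigD1 i) //= /e' eqxx addnAC subnK //.
    by congr addn; apply: eq_bigr => j /negPf ->.
  have ep : \prod_j x j ^+ e j = \prod_j x j ^+ e' j * x i ^+ d.
    rewrite (bigD1 i) //= [in RHS](bigD1 i) //= /e' eqxx mulrAC -exprD subnK //.
    by congr (_ * _); apply: eq_bigr => j /negPf ->.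
  rewrite ep mulrCA -es; apply: formsM => //; exact: forms_prod.
have fk k : forms N (f ^+ k * x ord0 ^+ N).
  elim: k => [|k IH]; first by rewrite mul1r; apply/formsX/forms_x.
  by rewrite exprS -mulrA; apply: fN.
have [a [[i0 ai0] ha]] := @span_dependent _ _ iota (monomials x N) _
  (fun i : 'I_(size (monomials x N)).+1 => f ^+ i * x ord0 ^+ N) (ltnSn _) (fun i => fk i).
pose q := \poly_(i < (size (monomials x N)).+1) a (inord i).
apply: (@poly_root_const f q).
  apply: contraNneq ai0 => /(congr1 (fun p : {poly _} => p`_i0)).
  by rewrite coef_poly ltn_ord coef0 inord_val => ->.
apply: (mulIf (expf_neq0 N (x_neq0 ord0))); rewrite mul0r -[RHS]ha.
rewrite (horner_coef_wide _ (leq_trans (size_poly _ _) (size_poly _ _))).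
rewrite mulr_suml; apply: eq_bigr => i _.
by rewrite coef_map coef_poly ltn_ord inord_val mulrA.
Qed.

End Nullstellensatz.

(** * Regular local rings of dimension two *)

Section Principal.
Context {K : fieldType}.
Implicit Types (A P q E F : set K) (a b f u v : K).

Lemma principal_self A f : is_subring A -> principal f A f.
Proof. by move=> hA; exists 1; [exact: subring1|rewrite mulr1]. Qed.

Lemma principal_sub A f : is_subring A -> A f -> principal f A `<=` A.
Proof. by move=> hA Af _ [a Aa <-]; apply: subringM. Qed.

Lemma principal_maxid P f : local_ring P -> maxid P f -> principal f P `<=` maxid P.
Proof. by move=> [hP [_ _ mM]] mf _ [a Pa <-]; rewrite mulrC; apply: mM. Qed.

Lemma maxid_one_sub P f : local_ring P -> maxid P f -> loc_unit P (1 - f).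
Proof.
move=> hP mf; have [hP' hm] := hP.
by apply: loc_unit_addm => //; [exact: loc_unit1|exact: (submoduleN hP' hm)].
Qed.

(** Krull's intersection theorem for a principal ideal: the quotients of [a] by the powers of [f]
    generate an ascending chain of ideals, and where it stops [1 - f * c] would be zero although it
    is a unit. *)
Lemma principal_krull P f a : local_ring P -> noetherian P -> maxid P f ->
  (forall n, principal (f ^+ n) P a) -> a = 0.
Proof.
move=> hP nP mf ha; have [hP' hm] := hP; apply/eqP; apply: contrapT => /negP a0.
have f0 : f != 0.
  by apply: contra_neq a0 => f0; have [b _ <-] := ha 1%N; rewrite f0 expr1 mul0r.
pose F := [set J | exists b, (exists2 n, P b & a = f ^+ n * b) /\ J = principal b P].
have [||J [[b [[n Pb eb] ->]] maxJ]] := @noetherian_maximal _ P F hP' nP.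
- exists (principal a P), a; split=> //; exists 0%N; rewrite ?mul1r //.
  by have [b Pb <-] := ha 0%N; rewrite mul1r.
- move=> _ [b [[n Pb _] ->]]; split; [exact: principal_submodule|exact: principal_sub].
have [b' Pb' eb'] := ha n.+1.
have ebb : b = f * b'.
  by apply: (mulfI (expf_neq0 n f0)); rewrite -eb -eb' exprSr mulrA.
have [|||c Pc ec] := maxJ (principal b' P) _ _ b'; last 1 first.
- have [u0 _] := maxid_one_sub hP (principal_maxid hP mf (ex_intro2 _ _ c Pc erefl)).
  apply: (negP u0); rewrite subr_eq0 eq_sym; apply/eqP.
  have b'0 : b' != 0 by apply: contra_neq a0 => b'0; rewrite -eb' b'0 mulr0.
  by apply: (mulIf b'0); rewrite mul1r -{2}ec ebb; ring.
- by exists b'; split=> //; exists n.+1.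
- move=> _ [c Pc <-]; exists (f * c); last by rewrite ebb; ring.
  by apply: subringM => //; apply: maxid_sub.
- exact: principal_self.
Qed.

(** The field [F] is a parameter because prime divisors of [X] and of [Y] are valuation rings of
    different subfields of [K]. *)
Definition dvr F E : Prop :=
  [/\ local_ring E, E `<=` F & exists t, [/\ t != 0, maxid E = principal t E
    & forall f, F f -> f != 0 -> exists (n : int) e, loc_unit E e /\ f = t ^ n * e]].

(** By [principal_krull] every nonzero element of [P] is a power of [p] times an element outside
    [principal p P]. *)
Lemma dvr_localization F P p : local_ring P -> noetherian P ->
  p != 0 -> prime_ideal P (principal p P) -> localization P (principal p P) `<=` F ->
  (forall f, F f -> exists a b, [/\ P a, P b, b != 0 & f = a / b]) ->
  dvr F (localization P (principal p P)).
Proof.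
move=> hP nP p0 hp EF Ffrac; have [hP' _] := hP; have [pP [pp0 pp1] pD pM pPr] := hp.
split=> //; first exact: localization_local.
have Pp : P p by apply/pP/principal_self.
have mp : maxid P p.
  by split=> // -[_ [_ Pp']]; apply: pp1; exists p^-1; rewrite ?mulfV.
exists p; split=> //.
  rewrite maxid_localization //; apply/seteqP; split=> f.
    move=> [_ [b [[a Pa <-] Pb nb ->]]]; exists (a / b); last by rewrite mulrA.
    by exists a, b.
  move=> [_ [a [b [Pa Pb nb ->]]] <-]; exists (p * a), b; rewrite mulrA.
  by split=> //; exists a.
have fact a : P a -> a != 0 -> exists n a', [/\ P a', ~ principal p P a' & a = p ^+ n * a'].
  move=> Pa a0; apply: contrapT => h.
  move: a0; rewrite (@principal_krull P p a) ?eqxx // => n.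
  elim: n => [|n [b Pb eb]]; first by exists a; rewrite ?mul1r.
  have [[c Pc ec]|nb] := pselect (principal p P b); last by case: h; exists n, b.
  by exists c => //; rewrite exprSr -mulrA ec.
move=> f Ff f0; have [a [b [Pa Pb b0 ef]]] := Ffrac f Ff.
have a0 : a != 0 by apply: contra_neq f0 => a0; rewrite ef a0 mul0r.
have [m [a' [Pa' na ea]]] := fact a Pa a0.
have [k [b' [Pb' nb eb]]] := fact b Pb b0.
have a'0 : a' != 0 by apply: contra_neq a0 => a0; rewrite ea a0 mulr0.
have b'0 : b' != 0 by apply: contra_neq b0 => b0; rewrite eb b0 mulr0.
exists (m%:Z - k%:Z), (a' / b'); split; last first.
  rewrite expfzDr // -invr_expz -!exprnP ef ea eb; field.
  by rewrite b'0 expf_neq0.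
split; first by rewrite mulf_neq0 ?invr_eq0.
by split; rewrite ?invf_div; [exists a', b'|exists b', a'].
Qed.

Section TwoParameters.
Context {P : set K}.
Hypotheses (hP : local_ring P) (nP : noetherian P).

Let hP' : is_subring P. Proof. by case: hP. Qed.
Let hm : submodule P (maxid P). Proof. by case: hP. Qed.

Lemma prime_sub_maxid q : prime_ideal P q -> q `<=` maxid P.
Proof.
move=> [qP [_ q1] _ qM _] a qa; split; first exact: qP.
by move=> [a0 [_ Pa']]; apply: q1; rewrite -(mulVf a0); apply: qM.
Qed.

Lemma parametersC u v : parameters P u v -> parameters P v u.
Proof.
move=> huv; rewrite /parameters huv; apply/seteqP; split=> _ [[a b] [/= Pa Pb] <-];
by exists (b, a) => //=; rewrite addrC.
Qed.

Lemma parametersP u v a : parameters P u v -> maxid P a ->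
  exists b c, [/\ P b, P c & a = u * b + v * c].
Proof. by move=> ->; move=> [[b c] [/= Pb Pc] <-]; exists b, c. Qed.

Lemma parameters_left u v : parameters P u v -> maxid P u.
Proof.
move=> ->; exists (1, 0); first by split=> /=; [exact: subring1|exact: subring0].
by rewrite /= mulr1 mulr0 addr0.
Qed.

(** Modulo [u] every nonzero element is a unit times a power of [v]: the ideals generated by [u] and
    [b], where [a] is [b * v ^+ n] modulo [u], grow as [v] is extracted from [b], and must stop. *)
Lemma parameters_expand u v a : parameters P u v -> P a -> ~ principal u P a ->
  exists n e, loc_unit P e /\ principal u P (a - e * v ^+ n).
Proof.
move=> huv Pa na; have hu := principal_submodule u hP'.
have mu := parameters_left huv; have Pu := maxid_sub mu.
have mv := parameters_left (parametersC huv); have Pv := maxid_sub mv.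
have [uP0 uPD uPM] := hu.
pose S b := sum_set (principal b P) (principal u P).
pose F := [set J | exists b, (exists2 n, P b & principal u P (a - b * v ^+ n)) /\ J = S b].
have [||J [[b [[n Pb ub] ->]] maxJ]] := @noetherian_maximal _ P F hP' nP.
- by exists (S a), a; split=> //; exists 0%N => //; rewrite mulr1 subrr.
- move=> _ [b [[n Pb _] ->]]; split; first exact/sum_set_submodule/hu/principal_submodule.
  by move=> _ [_ [_ [[c Pc <-] [d Pd <-] ->]]]; apply: subringD => //; apply: subringM.
have [ub'|nub] := pselect (loc_unit P b); first by exists n, b.
exfalso; have [c [b' [Pc Pb' eb]]] := parametersP huv (conj Pb nub).
have ub' : principal u P (a - b' * v ^+ n.+1).
  have -> : a - b' * v ^+ n.+1 = (a - b * v ^+ n) + v ^+ n * (u * c).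
    by rewrite eb exprS; ring.
  by apply: (uPD) => //; apply: (uPM); [exact: subringX|exists c].
have [|||_ [_ [[x Px <-] [y Py <-] eb']]] := maxJ (S b') _ _ b'.
- by exists b'; split=> //; exists n.+1.
- move=> _ [_ [_ [[x Px <-] [y Py <-] ->]]].
  exists (b' * (v * x)), (u * (c * x + y)); split; last by rewrite eb; ring.
    by exists (v * x) => //; apply: subringM.
  by exists (c * x + y) => //; apply: subringD => //; apply: subringM.
- exists b', 0; rewrite addr0; split=> //; exact: principal_self.
have [w0 [_ Pw]] := maxid_one_sub hP (principal_maxid hP mv (ex_intro2 _ _ x Px erefl)).
apply: na; have -> : a = (a - b' * v ^+ n.+1) + v ^+ n.+1 * b' by ring.
apply: (uPD) => //; apply: (uPM); first exact: subringX.
have -> : b' = (1 - v * x)^-1 * (u * (c * x + y)).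
  apply: (mulfI w0); rewrite mulVKf // mulrBl mul1r {1}eb' eb; ring.
apply: (uPM) => //; exists (c * x + y) => //.
by apply: subringD => //; apply: subringM.
Qed.

Lemma span_maxid_mul s u y : maxid P u -> span P s y -> span (maxid P) s (u * y).
Proof.
move=> mu; have [m0 mD mM] := hm.
elim: s y => [|x s IH] y /=; first by move->; rewrite mulr0.
move=> [a [b [Pa sb ->]]]; exists (u * a), (u * b).
by split; [rewrite mulrC; exact: mM|exact: IH|rewrite mulrDr mulrA].
Qed.

(** Let [f] in [q] have the least exponent of [v] modulo [u]. Any [w] in [q] is a multiple of [f]
    plus a multiple of [u], whose cofactor is again in [q]; so q = (f) + u q, and Nakayama's lemma
    applies. *)
Lemma prime_principal_left u v q : parameters P u v -> prime_ideal P q -> ~ q u ->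
  (exists2 a, q a & a != 0) -> exists2 f, f != 0 & q = principal f P.
Proof.
move=> huv hq nu [a0 qa0 a00]; have [qP [q0 q1] qD qM qPr] := hq.
have mu := parameters_left huv; have Pu := maxid_sub mu.
have mv := parameters_left (parametersC huv); have Pv := maxid_sub mv.
have hu := principal_submodule u hP'; have [uP0 uPD uPM] := hu.
have qdiv c : P c -> q (u * c) -> q c by move=> Pc /qPr[].
(* Otherwise elements of [q] could be divided by [u] inside [q] indefinitely. *)
have [a qa na] : exists2 a, q a & ~ principal u P a.
  apply: contrapT => h; move: a00; rewrite (@principal_krull P u a0) ?eqxx // => n.
  suff [c qc <-] : exists2 c, q c & u ^+ n * c = a0 by exists c => //; apply: qP.
  elim: n => [|n [c qc <-]]; first by exists a0; rewrite ?mul1r.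
  have [d Pd ed] : principal u P c by apply: contrapT => nc; apply: h; exists c.
  by exists d; [apply: qdiv => //; rewrite ed|rewrite exprSr -mulrA ed].
pose Q n := exists f e, [/\ q f, loc_unit P e & principal u P (f - e * v ^+ n)].
have exQ : exists n, `[< Q n >].
  by have [n [e [ue ha]]] := parameters_expand huv (qP _ qa) na; exists n; apply/asboolP; exists a, e.
case: (ex_minnP exQ) => n /asboolP[f [e [qf [e0 [Pe Pe']] uf]]] minn.
have Pf := qP _ qf.
have hf := principal_submodule f hP'.
have fq : principal f P `<=` q by move=> _ [c Pc <-]; rewrite mulrC; apply: qM.
have red w : q w -> exists x y, [/\ P x, q y & w = f * x + u * y].
  move=> qw; have [[c Pc ec]|nw] := pselect (principal u P w).
    exists 0, c; rewrite mulr0 add0r; split=> //; first exact: subring0.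
    by apply: qdiv => //; rewrite ec.
  have [n' [e' [ue' hw]]] := parameters_expand huv (qP _ qw) nw.
  have le : (n <= n')%N by apply: minn; apply/asboolP; exists w, e'.
  have [_ [Pe2 _]] := ue'.
  pose x := e' / e * v ^+ (n' - n).
  have Px : P x by do 2?apply: subringM => //; apply: subringX.
  have [y Py ey] : principal u P (w - f * x).
    have -> : w - f * x = (w - e' * v ^+ n') + (- x) * (f - e * v ^+ n).
      have -> : v ^+ n' = v ^+ n * v ^+ (n' - n) by rewrite -exprD subnKC.
      by rewrite /x; set vd := v ^+ (n' - n); field.
    by apply: (uPD) => //; apply: (uPM) => //; apply: subringN.
  exists x, y; split=> //; last by rewrite ey addrC subrK.
  apply: qdiv => //; rewrite ey; apply: (submoduleB hP' (prime_ideal_submodule hq)) => //.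
  by rewrite mulrC; apply: qM.
have [s [sq qs]] := nP (prime_ideal_submodule hq) qP.
have Nw : forall w, w \in s -> principal f P w.
  apply: (nakayama hP hf) => w /sq/red[x [y [Px qy ->]]].
  exists (f * x), (u * y); split=> //; first by exists x.
  exact/span_maxid_mul/qs.
have qE : q = principal f P.
  apply/seteqP; split=> // w /qs; have [N0 ND NM] := hf.
  by apply: span_sub => // c x Pc /Nw; apply: NM.
exists f => //; apply: contra_neq a00 => f0; move: qa0; rewrite qE f0 => -[c _ <-].
by rewrite mul0r.
Qed.

Lemma prime_principal u v q : parameters P u v -> prime_ideal P q -> q <> maxid P ->
  (exists2 a, q a & a != 0) -> exists2 f, f != 0 & q = principal f P.
Proof.
move=> huv hq qm q0; have [qP [_ q1] qD qM _] := hq.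
have [qu|nu] := pselect (q u); last exact: prime_principal_left huv hq nu q0.
have [qv|nv] := pselect (q v); last exact: prime_principal_left (parametersC huv) hq nv q0.
case: qm; apply/seteqP; split; first exact: prime_sub_maxid.
move=> a /(parametersP huv)[b [c [Pb Pc ->]]].
by apply: qD; rewrite mulrC; apply: qM.
Qed.

Lemma principal_modX u a b n : P a -> P b -> P u ->
  principal u P (a - b) -> principal u P (a ^+ n - b ^+ n).
Proof.
move=> Pa Pb Pu uab; have [_ _ uPM] := principal_submodule u hP'.
rewrite subrXX mulrC; apply: uPM => //; apply: subring_sum => // i _.
by apply: subringM => //; apply: subringX.
Qed.

(* Krull's principal ideal theorem in this setting: if P had dimension one,
   a prime q = (f) would contain no element prime to u. *)
Lemma parameters_pow u v q k : parameters P u v -> prime_ideal P q -> q <> maxid P ->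
  (exists2 a, q a & a != 0) -> ~ principal u P (v ^+ k).
Proof.
move=> huv hq qm q0 [c Pc ec]; have [qP [q0' q1] qD qM qPr] := hq.
have mu := parameters_left huv; have Pu := maxid_sub mu.
have mv := parameters_left (parametersC huv); have Pv := maxid_sub mv.
have nu : ~ q u.
  move=> qu; apply: qm; apply/seteqP; split=> a; first exact: prime_sub_maxid.
  have qv : q v by apply: (@prime_ideal_X _ P q v k) => //; rewrite -ec mulrC; apply: qM.
  move=> /(parametersP huv)[b [d [Pb Pd ->]]].
  by apply: qD; rewrite mulrC; apply: qM.
have [f f0 qE] := prime_principal huv hq qm q0.
have qf : q f by rewrite qE; apply: principal_self.
have Pf := qP _ qf.
have udiv a : P a -> principal f P (u * a) -> principal f P a.
  by rewrite -qE => Pa /qPr[].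
have noX j : ~ principal u P (f ^+ j).
  elim: j => [|j IH] [a Pa ea].
    have [_ _ mM] := hm.
    by apply: (maxidN1 hP'); rewrite -(expr0 f) -ea mulrC; apply: mM.
  have [b Pb eb] : principal f P a.
    by apply: udiv => //; rewrite ea; exists (f ^+ j); [exact: subringX|rewrite -exprS].
  apply: IH; exists b => //; apply: (mulfI f0); rewrite -exprS -ea -eb; ring.
have nf : ~ principal u P f by rewrite -(expr1 f).
have [n [e [ue uf]]] := parameters_expand huv Pf nf.
have [e0 [Pe Pe']] := ue; have hu := principal_submodule u hP'; have [uP0 uPD uPM] := hu.
have n0 : (0 < n)%N.
  rewrite lt0n; apply/eqP => n0; move: uf; rewrite n0 mulr1 => uf.
  have mfe : maxid P (f - e) by apply: principal_maxid uf.
  have mf : maxid P f by apply: (prime_sub_maxid hq).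
  have := submoduleB hP' hm mf mfe; rewrite opprB addrCA subrr addr0.
  by case=> _; apply.
(* Modulo [u], [f] is a unit times a positive power of [v], so [u] would divide [f ^+ k] as soon as
   it divides [v ^+ k]. *)
apply: (noX k); have -> : f ^+ k = (f ^+ k - (e * v ^+ n) ^+ k) + e ^+ k * v ^+ (n.-1 * k) * (v ^+ k).
  rewrite exprMn -exprM -[in RHS]mulrA -exprD addnC -mulSn prednK // subrK //.
apply: (uPD).
  apply: principal_modX => //; apply: subringM => //; exact: subringX.
by apply: (uPM); [apply: subringM => //; exact: subringX|exists c].
Qed.

Section Factorial.
Variables (u v : K).
Hypotheses (huv : parameters P u v) (u0 : u != 0)
  (upow : forall k, ~ principal u P (v ^+ k)).

Let mu : maxid P u := parameters_left huv.
Let mv : maxid P v := parameters_left (parametersC huv).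
Let Pu : P u := maxid_sub mu.
Let Pv : P v := maxid_sub mv.
Let hu : submodule P (principal u P) := principal_submodule u hP'.

(** Modulo [u], a product of two units times powers of [v] is again one, and by [upow] it is not
    zero. *)
Lemma parameter_prime : prime_ideal P (principal u P).
Proof.
have [uP0 uPD uPM] := hu; split=> //.
- exact: principal_sub.
- by split=> // h; apply: (upow (k := 0)).
move=> a b Pa Pb uab; apply: contrapT => /not_orP[na nb].
have [n [e [[e0 [Pe Pe']] ha]]] := parameters_expand huv Pa na.
have [m [d [[d0 [Pd Pd']] hb]]] := parameters_expand huv Pb nb.
apply: (@upow (n + m)).
have -> : v ^+ (n + m) = e^-1 * d^-1 * (a * b) - (e^-1 * d^-1 * b * (a - e * v ^+ n)
   + d^-1 * v ^+ n * (b - d * v ^+ m)).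
  by rewrite exprD; field; rewrite e0 d0.
apply: (submoduleB hP' hu); first by apply: uPM => //; apply: subringM.
apply: (uPD); apply: (uPM) => //.
  by apply: subringM => //; apply: subringM.
by apply: subringM => //; apply: subringX.
Qed.

Lemma parameter_not_maximal : principal u P <> maxid P.
Proof. by move=> e; apply: (@upow 1); rewrite expr1 e. Qed.

(** If [u] does not divide [b], an ideal containing [b] and maximal among those without powers of
    [u] is prime; not containing [u], it is principal. *)
Lemma prime_divisor_element b : maxid P b -> b != 0 -> exists p,
  [/\ p != 0, prime_ideal P (principal p P), principal p P <> maxid P & principal p P b].
Proof.
move=> mb b0; have Pb := maxid_sub mb.
have [ub|nub] := pselect (principal u P b).
  by exists u; split=> //; [exact: parameter_prime|exact: parameter_not_maximal].
have [uP [_ u1] uD uM uPr] := parameter_prime.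
pose F := [set J | [/\ submodule P J, J `<=` P, J b & forall n, ~ J (u ^+ n)]].
have [||J [[hJ JP Jb Ju] maxJ]] := @noetherian_maximal _ P F hP' nP.
- exists (principal b P); split; [exact: principal_submodule|exact: principal_sub|exact: principal_self|].
  elim=> [|n IH] [a Pa ea].
    by apply: (maxidN1 hP'); rewrite -(expr0 u) -ea; apply: (principal_maxid hP mb); exists a.
  have [//|[c Pc ec]] : principal u P b \/ principal u P a.
    by apply: uPr => //; rewrite ea; exists (u ^+ n); [exact: subringX|rewrite -exprS].
  apply: IH; exists c => //; apply: (mulfI u0); rewrite -exprS -ea -ec; ring.
- by move=> J [].
have [J0 JD JM] := hJ.
have JX a : P a -> ~ J a -> exists n, sum_set J (principal a P) (u ^+ n).
  move=> Pa na; apply: contrapT => h; apply: na.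
  apply: (maxJ (sum_set J (principal a P))).
  - split.
    + exact/sum_set_submodule/principal_submodule.
    + move=> _ [c [_ [Jc [d Pd <-] ->]]]; apply: subringD => //; [exact: JP|exact: subringM].
    + by exists b, 0; rewrite addr0; split=> //; exists 0; [exact: subring0|rewrite mulr0].
    + by move=> n hn; apply: h; exists n.
  - by move=> c Jc; exists c, 0; rewrite addr0; split=> //; exists 0; [exact: subring0|rewrite mulr0].
  - by exists 0, a; rewrite add0r; split=> //; apply: principal_self.
have hJp : prime_ideal P J.
  split=> //; first by split=> // J1; apply: (Ju 0%N).
  move=> a c Pa Pc Jac; apply: contrapT => /not_orP[na nc].
  have [n [x [_ [Jx [y Py <-] en]]]] := JX a Pa na.
  have [m [z [_ [Jz [w Pw <-] em]]]] := JX c Pc nc.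
  apply: (Ju (n + m)%N); rewrite exprD en em.
  have -> : (x + a * y) * (z + c * w) = (z + c * w) * x + a * y * z + y * w * (a * c) by ring.
  apply: (JD); [apply: (JD)|]; apply: (JM) => //; last exact: subringM.
    by apply: subringD; [|exact: JP|exact: subringM].
  exact: subringM.
have nJu : ~ J u by rewrite -(expr1 u).
have [|p p0 JE] := prime_principal_left huv hJp nJu; first by exists b.
exists p; split; rewrite -?JE // => e; apply: nJu; rewrite e; exact: mu.
Qed.

(** A denominator of [f] generating a maximal ideal is a unit: otherwise a prime factor [p] of it
    could be cancelled, because [f] is regular along [p]. *)
Lemma factorial_normal f a b : P a -> P b -> b != 0 -> f = a / b ->
  (forall p, p != 0 -> prime_ideal P (principal p P) -> principal p P <> maxid P ->
     localization P (principal p P) f) -> P f.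
Proof.
move=> Pa Pb b0 ef hf.
pose F := [set J | exists b, [/\ P b, b != 0, P (b * f) & J = principal b P]].
have [||J [[c [Pc c0 Pcf ->]] maxJ]] := @noetherian_maximal _ P F hP' nP.
- by exists (principal b P), b; split=> //; rewrite ef mulrC divfK.
- by move=> _ [c [Pc _ _ ->]]; split; [exact: principal_submodule|exact: principal_sub].
have [mc|nc] := pselect (maxid P c); last first.
  have -> : f = c^-1 * (c * f) by rewrite mulKf.
  by apply: subringM => //; apply: maxid_inv.
exfalso; have [p [p0 hp pm [c' Pc' ec]]] := prime_divisor_element mc c0.
have [pP [pp0 pp1] pD pM pPr] := hp.
have c'0 : c' != 0 by apply: contra_neq c0 => c'0; rewrite -ec c'0 mulr0.
have [x [d [Px Pd nd efd]]] := hf p p0 hp pm.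
have d0 : d != 0 by apply: contra_not_neq nd => ->.
have [//|[y Py ey]] : principal p P d \/ principal p P (c * f).
  apply: pPr => //; rewrite efd -ec; exists (c' * x); first exact: subringM.
  by field.
have Pc'f : P (c' * f).
  by have -> : c' * f = y by apply: (mulfI p0); rewrite ey -ec mulrA.
have [|||z Pz ez] := maxJ (principal c' P) _ _ c'.
- by exists c'.
- by move=> _ [z Pz <-]; exists (p * z); [apply: subringM => //; apply/pP/principal_self|rewrite -ec; ring].
- exact: principal_self.
apply: pp1; exists z => //; apply: (mulfI c'0); rewrite mulr1 -{2}ez -ec; ring.
Qed.

End Factorial.
End TwoParameters.
End Principal.

(** * Derivations *)

Section Derivations.
Context {R : realType} {K : fieldType} (iota : {rmorphism R[i] -> K}).
Implicit Types (G : set (K * K)) (x y : K) (p q : {poly K}).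

(* A derivation on a subring, given by its graph: a subalgebra of the dual
   numbers over K that meets the ideal of infinitesimals trivially. *)
Definition der_graph G : Prop :=
  [/\ forall c, G (iota c, 0),
      forall a a' b b', G (a, a') -> G (b, b') -> G (a - b, a' - b'),
      forall a a' b b', G (a, a') -> G (b, b') -> G (a * b, a * b' + b * a')
    & forall a', G (0, a') -> a' = 0].

Lemma der_graph0 G : der_graph G -> G (0, 0).
Proof. by case=> /(_ 0); rewrite rmorph0. Qed.

Lemma der_graph1 G : der_graph G -> G (1, 0).
Proof. by case=> /(_ 1); rewrite rmorph1. Qed.

Lemma der_graphN G a a' : der_graph G -> G (a, a') -> G (- a, - a').
Proof.
move=> hG Ga; have [_ GB _ _] := hG.
by have := GB _ _ _ _ (der_graph0 hG) Ga; rewrite !sub0r.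
Qed.

Lemma der_graphD G a a' b b' : der_graph G -> G (a, a') -> G (b, b') -> G (a + b, a' + b').
Proof.
move=> hG Ga Gb; have [_ GB _ _] := hG.
by have := GB _ _ _ _ Ga (der_graphN hG Gb); rewrite !opprK.
Qed.

Lemma der_graph_sum G n (f g : 'I_n -> K) : der_graph G ->
  (forall i, G (f i, g i)) -> G (\sum_i f i, \sum_i g i).
Proof.
move=> hG h; elim: (index_enum _) => [|i r IH].
  by rewrite !big_nil; apply: der_graph0.
by rewrite !big_cons; apply: der_graphD.
Qed.

Lemma der_graph_fun G a a' a'' : der_graph G -> G (a, a') -> G (a, a'') -> a' = a''.
Proof.
move=> [_ GB _ Gi] h1 h2; have := GB _ _ _ _ h1 h2; rewrite subrr => /Gi.
by move=> /eqP; rewrite subr_eq0 => /eqP.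
Qed.

Definition coef_graph G p q : Prop := forall i, G (p`_i, q`_i).

Definition adjoin_graph G x y : set (K * K) :=
  [set z | exists p q, coef_graph G p q /\ z = (p.[x], q.[x] + p^`().[x] * y)].

Lemma adjoin_graph_der G x y : der_graph G ->
  (forall p q, coef_graph G p q -> p.[x] = 0 -> q.[x] + p^`().[x] * y = 0) ->
  der_graph (adjoin_graph G x y).
Proof.
move=> hG hxy; have [GC GB GM Gi] := hG; split.
- move=> c; exists (iota c)%:P, 0; split=> [i|].
    by rewrite coefC coef0; case: (i == 0)%N => //; apply: der_graph0.
  by rewrite hornerC derivC !horner0 mul0r addr0.
- move=> a a' b b' [p [q [h [-> ->]]]] [r [s [h' [-> ->]]]].
  exists (p - r), (q - s); split=> [i|]; first by rewrite !coefB; apply: GB.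
  by rewrite derivB !hornerE; congr pair; ring.
- move=> a a' b b' [p [q [h [-> ->]]]] [r [s [h' [-> ->]]]].
  exists (p * r), (p * s + r * q); split=> [i|].
    rewrite coefD (mulrC r q) !coefM -big_split /=.
    by apply: der_graph_sum => // j; rewrite (mulrC q`_j); apply: GM.
  by rewrite derivM !hornerE; congr pair; ring.
- by move=> a' [p [q [h [/esym hp ->]]]]; apply: hxy.
Qed.

Lemma sub_adjoin_graph G x y : der_graph G -> G `<=` adjoin_graph G x y.
Proof.
move=> hG [a a'] Ga; exists a%:P, a'%:P; split=> [i|].
  by rewrite !coefC; case: (i == 0)%N => //; apply: der_graph0.
by rewrite !hornerC derivC horner0 mul0r addr0.
Qed.

Lemma mem_adjoin_graph G x y : der_graph G -> adjoin_graph G x y (x, y).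
Proof.
move=> hG; exists 'X, 0; split=> [i|].
  by rewrite coefX coef0; case: (i == 1)%N; [exact: der_graph1|exact: der_graph0].
by rewrite hornerX horner0 derivX hornerC mul1r add0r.
Qed.

Lemma adjoin_graph_free G x y : der_graph G ->
  (forall p q, coef_graph G p q -> p.[x] = 0 -> p = 0) ->
  der_graph (adjoin_graph G x y).
Proof.
move=> hG hx; apply: adjoin_graph_der => // p q h /(hx _ _ h) p0.
have [_ _ _ Gi] := hG; have -> : q = 0.
  by apply/polyP => i; rewrite coef0; apply: Gi; have := h i; rewrite p0 coef0.
by rewrite p0 derivC !horner0 mul0r addr0.
Qed.

Lemma deriv_neq0 p : (1 < size p)%N -> p^`() != 0.
Proof.
case sz: (size p) => [|[|k]] // _; apply/eqP => /(congr1 (fun p : {poly K} => p`_k)).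
rewrite coef_deriv coef0 -mulr_natr => /eqP; rewrite mulf_eq0.
have -> : p`_k.+1 = lead_coef p by rewrite lead_coefE sz.
rewrite lead_coef_eq0 -size_poly_eq0 sz /= -(rmorph_nat iota) fmorph_eq0.
by rewrite pnatr_eq0.
Qed.

(** A relation of least degree determines [y]: its formal derivative does not vanish at [x], by
    minimality and characteristic 0. Every other relation reduces to it by pseudo-division, since
    coefficients of the graph form only a ring. *)
Lemma adjoin_graph_algebraic G x p0 q0 : der_graph G ->
  coef_graph G p0 q0 -> p0 != 0 -> p0.[x] = 0 ->
  exists y, der_graph (adjoin_graph G x y).
Proof.
move=> hG c0 p00 x0; have [GC GB GM Gi] := hG.
pose Q n := `[< exists p q, [/\ coef_graph G p q, p != 0, p.[x] = 0 & size p = n] >].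
have exQ : exists n, Q n by exists (size p0); apply/asboolP; exists p0, q0.
case: (ex_minnP exQ) => n /asboolP[{x0 p00 c0}p0 [{}q0 [c0 p00 x0 sz]]] minn.
have natG k : G (k%:R, 0) by rewrite -(rmorph_nat iota); apply: GC.
have d0 : p0^`().[x] != 0.
  apply/eqP => d0.
  have szp : (1 < size p0)%N.
    rewrite ltnNge; apply/negP => /size1_polyC e; move: x0 p00.
    by rewrite e hornerC => ->; rewrite polyC0 eqxx.
  have dn0 := deriv_neq0 szp.
  have : (n <= size p0^`())%N.
    apply: minn; apply/asboolP; exists p0^`(), q0^`(); split=> // i.
    rewrite !coef_deriv -(mulr_natr p0`_i.+1) -(mulr_natr q0`_i.+1).
    by have := GM _ _ _ _ (c0 i.+1) (natG i.+1); rewrite mulr0 add0r [_ * q0`_i.+1]mulrC.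
  by rewrite -sz leqNgt lt_size_deriv.
pose y := - q0.[x] / p0^`().[x]; exists y; apply: adjoin_graph_der => //.
have D0 : q0.[x] + p0^`().[x] * y = 0 by rewrite /y; field.

move=> p; have [k] := ubnP (size p); elim: k p => [//|k IH] p szp q c px.
have [pn0|pn0] := eqVneq p 0; last first.
  have le : (size p0 <= size p)%N.
    by rewrite sz; apply: minn; apply/asboolP; exists p, q.
  pose m := (size p - size p0)%N.
  pose a := lead_coef p0; pose a' := q0`_(size p0).-1.
  pose b := lead_coef p; pose b' := q`_(size p).-1.
  have Ga : G (a, a') by apply: c0.
  have Gb : G (b, b') by apply: c.
  have a0 : a != 0 by rewrite lead_coef_eq0.
  (* One step of pseudo-division; [q2] is the coefficientwise derivative of [p2], by the Leibniz
     rule. *)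
  pose p2 := a *: p - b *: (p0 * 'X^m).
  pose q2 := a *: q + a' *: p - (b *: (q0 * 'X^m) + b' *: (p0 * 'X^m)).
  have c2 : coef_graph G p2 q2.
    move=> i; rewrite !(coefB, coefD, coefZ, coefMXn).
    apply: GB.
      by have := GM _ _ _ _ Ga (c i); rewrite (mulrC _ a').
    case: ltnP => _; first by rewrite !mulr0 addr0; apply: der_graph0.
    by have := GM _ _ _ _ Gb (c0 (i - m)%N); rewrite (mulrC _ b').
  have sz2 : (size p2 < k)%N.
    have pgt0 : (0 < size p)%N by rewrite size_poly_gt0.
    rewrite -ltnS; apply: leq_trans szp; rewrite ltnS -[X in (_ < X)%N](prednK pgt0) ltnS.
    apply/leq_sizeP => j; rewrite leq_eqVlt coefB !coefZ coefMXn => /orP[/eqP <-|hj].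
      have -> : ((size p).-1 < m)%N = false.
        rewrite /m; move: (size p0) (size p) pgt0 le (size_poly_gt0 p0); rewrite p00.
        by lia.
      have -> : ((size p).-1 - m)%N = (size p0).-1.
        rewrite /m; move: (size p0) (size p) pgt0 le (size_poly_gt0 p0); rewrite p00.
        by lia.
      by rewrite -!lead_coefE -/a -/b mulrC subrr.
    have hj' : (size p <= j)%N by rewrite -(prednK pgt0).
    rewrite nth_default // mulr0 sub0r; case: ltnP => [|h]; rewrite ?mulr0 ?oppr0 //.
    rewrite nth_default ?mulr0 ?oppr0 //; rewrite /m.
    by move: (size p0) (size p) le hj'; lia.
  have px2 : p2.[x] = 0 by rewrite /p2 hornerD hornerN !hornerZ hornerM px x0; ring.
  apply: (mulfI a0); rewrite mulr0 -[RHS](IH p2 sz2 q2 c2 px2).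
  rewrite -[RHS]addr0 -(mulr0 (b * x ^+ m)) -D0.
  have -> : q2.[x] = a * q.[x] - b * (q0.[x] * x ^+ m).
    by rewrite hornerD hornerN !hornerD !hornerZ !hornerM hornerXn px x0; ring.
  have -> : p2^`().[x] = a * p^`().[x] - b * (p0^`().[x] * x ^+ m).
    rewrite derivB !derivZ derivM hornerD hornerN !hornerZ hornerD !hornerM.
    by rewrite hornerXn x0; ring.
  by move: (x ^+ m) => xm; ring.
have -> : q = 0.
  by apply/polyP => i; rewrite coef0; apply: Gi; have := c i; rewrite pn0 coef0.
by rewrite pn0 derivC !horner0 mul0r addr0.
Qed.

(** A maximal graph is total: an algebraic [x] can be adjoined with its forced derivative, a
    transcendental one with derivative 0. *)
Lemma derivation_extension G : der_graph G ->
  exists2 d, derivation iota d & forall a a', G (a, a') -> d a = a'.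
Proof.
move=> hG.
pose F := [set H | der_graph H /\ G `<=` H].
have [F' F'F F'tot|M [FM maxM]] := @Zorn_bigcup (K * K)%type (F `|` [set set0]).
  have [[H1 F'H1 FH1]|noH] := pselect (exists2 H, F' H & F H); last first.
    right; apply/seteqP; split=> [z [H F'H Hz]|z []].
    by case: (F'F _ F'H) => [FH|H0]; [case: noH; exists H|rewrite H0 in Hz].
  have F'id H z : F' H -> H z -> F H.
    by move=> F'H Hz; case: (F'F _ F'H) => // H0; rewrite H0 in Hz.
  have two z1 z2 H1' H2 : F' H1' -> H1' z1 -> F' H2 -> H2 z2 ->
      exists H, [/\ F' H, der_graph H, H z1 & H z2].
    move=> F1 Hz1 F2 Hz2; have [h|h] := F'tot _ _ F1 F2.
      by exists H2; split=> //; [case: (F'id _ _ F2 Hz2)|exact: h].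
    by exists H1'; split=> //; [case: (F'id _ _ F1 Hz1)|exact: h].
  left; split; last by move=> z Gz; exists H1 => //; apply: FH1.2.
  split.
  - by move=> c; exists H1 => //; case: FH1 => -[].
  - move=> a a' b b' [H F1 Ha] [H' F2 Hb].
    by have [H2 [F3 [_ GB _ _] h1 h2]] := two _ _ _ _ F1 Ha F2 Hb; exists H2 => //; apply: GB.
  - move=> a a' b b' [H F1 Ha] [H' F2 Hb].
    by have [H2 [F3 [_ _ GM _] h1 h2]] := two _ _ _ _ F1 Ha F2 Hb; exists H2 => //; apply: GM.
  - by move=> a' [H F1 Ha]; have [[_ _ _ Hi] _] := F'id _ _ F1 Ha; apply: Hi.
have FG : F G by split.
have FM' : F M.
  case: FM => // M0; case: (maxM G); last by left.
  by rewrite M0; split=> // /(_ _ (der_graph0 hG)).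
have maxM' H : der_graph H -> M `<=` H -> H `<=` M.
  move=> hH MH; apply: contrapT => HM; case: (maxM H); first by split.
  by left; split=> //; apply: subset_trans MH; case: FM'.
have [hM GM] := FM'.
have tot x : exists y, M (x, y).
  have [[p [q [c p0 px]]]|nalg] := pselect (exists p q, [/\ coef_graph M p q, p != 0 & p.[x] = 0]).
    have [y hy] := adjoin_graph_algebraic hM c p0 px; exists y.
    by apply: (maxM' _ hy); [exact: sub_adjoin_graph|exact: mem_adjoin_graph].
  exists 0; have hy : der_graph (adjoin_graph M x 0).
    apply: adjoin_graph_free => // p q c px; apply/eqP/negPn/negP => p0.
    by apply: nalg; exists p, q.
  by apply: (maxM' _ hy); [exact: sub_adjoin_graph|exact: mem_adjoin_graph].
have [d hd] := choice tot; exists d.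
  have [MC MB MM Mi] := hM; split.
  - by move=> a b; apply: (der_graph_fun hM (hd _)); apply: der_graphD.
  - by move=> a b; apply: (der_graph_fun hM (hd _)); apply: MM.
  - by move=> c; apply: (der_graph_fun hM (hd _)).
by move=> a a' /GM; apply: (der_graph_fun hM (hd _)).
Qed.

Definition consts_graph : set (K * K) := [set z | exists c, z = (iota c, 0)].

Lemma consts_graph_der : der_graph consts_graph.
Proof.
split.
- by move=> c; exists c.
- by move=> a a' b b' [c [-> ->]] [d [-> ->]]; exists (c - d); rewrite rmorphB subrr.
- by move=> a a' b b' [c [-> ->]] [d [-> ->]]; exists (c * d); rewrite rmorphM !mulr0 addr0.
- by move=> a' [c [_ ->]].
Qed.

(** Coefficients are evaluated at [v] and the outer variable at [u], which matches adjoining first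
    [v] and then [u]. *)
Definition eval2 u v (P : {poly {poly R[i]}}) : K :=
  (map_poly (horner_eval v \o map_poly iota) P).[u].

Lemma exists_derivation u v a b : (forall P, eval2 u v P = 0 -> P = 0) ->
  exists2 d, derivation iota d & d u = a /\ d v = b.
Proof.
move=> indep; pose ev : {rmorphism {poly R[i]} -> K} := horner_eval v \o map_poly iota.

have hG1 : der_graph (adjoin_graph consts_graph v b).
  apply: adjoin_graph_free; first exact: consts_graph_der.
  move=> p q c pv.
  have /choice[g hg] : forall i, exists t, p`_i = iota t.
    by move=> i; have [t [-> _]] := c i; exists t.
  pose r := \poly_(i < size p) g i.
  have pr : p = map_poly iota r.
    apply/polyP => i; rewrite coef_map coef_poly; case: ltnP => // h.
    by rewrite nth_default //; apply/esym/rmorph0.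
  have : r%:P = 0.
    by apply: indep; rewrite /eval2 map_polyC hornerC /= -pr.
  by move=> /eqP; rewrite polyC_eq0 => /eqP r0; rewrite pr r0 rmorph0.
have hG2 : der_graph (adjoin_graph (adjoin_graph consts_graph v b) u a).
  apply: adjoin_graph_free => // p q c pu.
  have /choice[g hg] : forall i, exists t, p`_i = ev t.
    move=> i; have [r [s [cr [-> _]]]] := c i.
    have /choice[h hh] : forall j, exists t, r`_j = iota t.
      by move=> j; have [t [-> _]] := cr j; exists t.
    exists (\poly_(j < size r) h j); rewrite /= /horner_eval; congr horner.
    apply/polyP => j; rewrite coef_map coef_poly; case: ltnP => // hj.
    by rewrite nth_default //; apply/esym/rmorph0.
  pose P := \poly_(i < size p) g i.
  have pP : p = map_poly ev P.
    apply/polyP => i; rewrite coef_map coef_poly; case: ltnP => // h.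
    by rewrite nth_default //; apply/esym/rmorph0.
  have P0 : P = 0 by apply: indep; rewrite /eval2 -[map_poly _ _]/(map_poly ev P) -pP.
  by rewrite pP P0 map_poly0.
have [d hd dG] := derivation_extension hG2; exists d => //; split; apply: dG.
  exact: mem_adjoin_graph.
by apply: sub_adjoin_graph => //; apply/mem_adjoin_graph/consts_graph_der.
Qed.

End Derivations.

(** * Parameters and derivations at smooth complex points *)

Section SmoothPoints.
Context {R : realType} {K : fieldType} (iota : {rmorphism R[i] -> K}).
Implicit Types (P N : set K) (u v : K) (X : set (set K)).

Local Notation consts := (range iota).

Lemma derivationX d a n : derivation iota d -> d (a ^+ n.+1) = n.+1%:R * a ^+ n * d a.
Proof.
move=> [dD dM dC]; elim: n => [|n IH]; first by rewrite expr0 !mul1r.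
rewrite exprS dM IH; have -> : n.+2%:R = n.+1%:R + 1 :> K by rewrite natr1.
by rewrite (exprS a n); ring.
Qed.

Lemma derivation_div d a b : derivation iota d -> b != 0 ->
  d (a / b) = (d a * b - a * d b) / b ^+ 2.
Proof.
move=> [dD dM dC] b0; have -> : d a = a / b * d b + b * d (a / b).
  by rewrite -dM divfK.
by set z := d (a / b); field.
Qed.

Lemma derivation_lin d d' a b : derivation iota d -> derivation iota d' ->
  derivation iota (fun f => a * d f + b * d' f).
Proof.
move=> [dD dM dC] [dD' dM' dC']; split.
- by move=> f g; rewrite dD dD'; ring.
- by move=> f g; rewrite dM dM'; ring.
- by move=> c; rewrite dC dC'; ring.
Qed.

Lemma poly_eval_mem P v s : is_subring P -> consts `<=` P -> P v ->
  P (map_poly iota s).[v].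
Proof.
move=> hP CP Pv; rewrite horner_coef; apply: subring_sum => // i _.
by apply: subringM => //; [apply: CP; rewrite coef_map; exists s`_i|exact: subringX].
Qed.

Lemma eval2_mem P u v Q : is_subring P -> consts `<=` P -> P u -> P v ->
  P (eval2 iota u v Q).
Proof.
move=> hP CP Pu Pv; rewrite /eval2 horner_coef; apply: subring_sum => // i _.
by apply: subringM => //; [rewrite coef_map; exact: poly_eval_mem|exact: subringX].
Qed.

Lemma poly_parameter P v s : local_ring P -> consts `<=` P -> maxid P v ->
  s != 0 -> exists k e, loc_unit P e /\ (map_poly iota s).[v] = v ^+ k * e.
Proof.
move=> hP CP mv; have [hP' [m0 mD mM]] := hP.
elim/poly_ind: s => [|s c IH]; first by rewrite eqxx.
have -> : (map_poly iota (s * 'X + c%:P)).[v] = (map_poly iota s).[v] * v + iota c.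
  by rewrite rmorphD rmorphM /= map_polyX map_polyC hornerD hornerM hornerX hornerC.
have [c0 s0|c0 _] := eqVneq c 0.
  have [|k [e [ue ->]]] := IH.
    by apply: contra_neq s0 => ->; rewrite c0 mul0r add0r.
  have -> : iota c = 0 by rewrite c0; apply: rmorph0.
  by exists k.+1, e; split=> //; rewrite addr0 exprS mulrAC [v * _]mulrC.
exists 0%N, (iota c + (map_poly iota s).[v] * v); split; last by rewrite expr0 mul1r addrC.
apply: loc_unit_addm => //.
  split; first by rewrite fmorph_eq0.
  by rewrite -fmorphV; split; apply: CP; [exists c|exists c^-1].
by apply: (mM) => //; apply: poly_eval_mem => //; exact: maxid_sub.
Qed.

(** If the constant term [r] in [u] of a relation is nonzero, its value is a unit times a power of
    [v] and is divisible by [u], which is excluded; if it is zero, the relation can be divided by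
    [u]. *)
Lemma parameters_independent P u v : local_ring P -> consts `<=` P -> maxid P v ->
  P u -> u != 0 -> (forall k, ~ principal u P (v ^+ k)) ->
  forall Q, eval2 iota u v Q = 0 -> Q = 0.
Proof.
move=> hP CP mv Pu u0 upow; have [hP' _] := hP; have Pv := maxid_sub mv.
elim/poly_ind => [//|Q r IH].
rewrite /eval2 rmorphD rmorphM /= map_polyX map_polyC hornerD hornerM hornerX hornerC.
rewrite -/(eval2 iota u v Q) /= /horner_eval => e.
have [r0|r0] := eqVneq r 0.
  rewrite r0 rmorph0 horner0 addr0 in e; rewrite r0 addr0 IH ?mul0r //.
  by apply/eqP; move/eqP: e; rewrite mulf_eq0 (negPf u0) orbF.
exfalso; have [k [d [[d0 [Pd Pd']] ed]]] := poly_parameter hP CP mv r0.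
apply: (upow k); exists (- eval2 iota u v Q / d).
  by apply: subringM => //; apply: subringN => //; apply: eval2_mem.
apply: (mulIf d0); rewrite -ed; move/eqP: e; rewrite addrC addr_eq0 => /eqP ->.
by field.
Qed.

Section Model.
Variables (n : nat) (x : 'I_n.+1 -> K).
Hypothesis x_neq0 : forall i, x i != 0.
Local Notation X := (model iota x).

(* Omega_P is generated by finitely many elements, and by du, dv modulo m_P. *)
Lemma derivation_submodule P u v N (d : K -> K) :
  Cpoint iota X P -> parameters P u v -> submodule P N ->
  (forall a b, P a -> P b -> d (a + b) = d a + d b) ->
  (forall a b, P a -> P b -> N (d (a * b) - a * d b - b * d a)) ->
  (forall c, d (iota c) = 0) -> N (d u) -> N (d v) -> forall a, P a -> N (d a).
Proof.
move=> [XP valP] huv hN dD dM dC Ndu Ndv.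
have hP := model_local x_neq0 XP; have [hP' hm] := hP; have CP := model_const x_neq0 XP.
have [N0 ND NM] := hN; have mu := parameters_left hP huv.
have mv := parameters_left hP (parametersC huv).
have Pu := maxid_sub mu; have Pv := maxid_sub mv.
have Pc c : P (iota c) by apply: CP; exists c.
have [i [p [hp eP]]] := XP.
pose W := [seq d (x j / x i) | j <- enum 'I_n.+1].
have hsp := span_submodule W (subring_submodule hP').
have hM := sum_set_submodule hN hsp; set M := sum_set N _ in hM.
have [M0 MD MM] := hM.
have NM' : N `<=` M by move=> a Na; exists a, 0; rewrite addr0; split=> //; case: hsp.
have d0 : d 0 = 0 by have := dC 0; rewrite rmorph0.
have dN a : P a -> d (- a) = - d a.
  move=> Pa; apply/eqP; rewrite -subr_eq0 opprK -dD //; last exact: subringN.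
  by rewrite addrC subrr d0.
have chartP : chart iota x i `<=` P.
  by rewrite eP; apply: sub_localization => //; apply: chart_subring.
have chartM : chart iota x i `<=` [set a | P a /\ M (d a)].
  apply: smallest_sub.
    split; last by move=> _ [c _ <-]; rewrite /= dC.
    split; first by rewrite -(rmorph1 iota) /= dC; split.
    move=> a b [Pa Ma] [Pb Mb]; split.
      split; first exact: subringB.
      by rewrite dD ?dN //; [apply: submoduleB hM _ _|exact: subringN].
    split; first exact: subringM.
    have -> : d (a * b) = (d (a * b) - a * d b - b * d a) + (a * d b + b * d a) by ring.
    by apply: (MD); [exact/NM'/dM|apply: (MD); exact: MM].
  move=> _ [j _ <-]; split; first by apply: chartP; apply: chart_gen.
  exists 0, (d (x j / x i)); rewrite add0r; split=> //.
  rewrite -[d _]mul1r; apply: span_mul; [exact: subring0|exact: subring1|].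
  by apply/mapP; exists j; rewrite ?mem_enum.
have PM a : P a -> M (d a).
  move=> Pa; move: (Pa); rewrite {1}eP => -[b [c [ib ic nc ea]]].
  have [Pb Mb] := chartM _ ib; have [Pc' Mc] := chartM _ ic.
  have uc : loc_unit P c.
    apply: loc_unitP => // mc; apply: nc.
    by rewrite -(maxid_localizationI (chart_subring iota x_neq0 i) hp) -eP.
  have [c0 [_ Pci]] := uc.
  have eb : b = a * c by rewrite ea divfK.
  have -> : d a = c^-1 * (d b - a * d c - (d (a * c) - a * d c - c * d a)).
    by rewrite eb; field.
  apply: (MM) => //; apply: (submoduleB hP' hM); last exact/NM'/dM.
  by apply: (submoduleB hP' hM) => //; apply: MM.
(* A coordinate is a constant plus [u * a + v * b], so its image under [d] lies in [N] plus the
   maximal ideal times the span of all such images. *)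
have NW : forall w, w \in W -> N w.
  apply: (nakayama hP hN) => _ /mapP[j _ ->].
  have Py : P (x j / x i) by apply: chartP; apply: chart_gen.
  have [c mc] := valP _ Py.
  have [a [b [Pa Pb eab]]] := parametersP huv mc.
  have -> : d (x j / x i) = (d (u * a) - u * d a - a * d u) + (d (v * b) - v * d b - b * d v)
     + (a * d u + b * d v) + (u * d a + v * d b).
    have -> : x j / x i = u * a + v * b + iota c by rewrite -eab subrK.
    have Pua : P (u * a) by apply: subringM.
    have Pvb : P (v * b) by apply: subringM.
    by rewrite !dD ?dC //; [ring|exact: subringD].
  have hms := span_submodule W hm; have [ms0 msD msM] := hms.
  have [na [sa [Nna ssa eda]]] := PM _ Pa.
  have [nb [sb [Nnb ssb edb]]] := PM _ Pb.
  have -> : u * d a + v * d b = u * na + v * nb + (u * sa + v * sb).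
    by rewrite eda edb; ring.
  exists ((d (u * a) - u * d a - a * d u) + (d (v * b) - v * d b - b * d v)
     + (a * d u + b * d v) + (u * na + v * nb)), (u * sa + v * sb).
  split; [|by apply: msD; apply: span_maxid_mul|by rewrite addrA].
  apply: (ND); last by apply: (ND); exact: NM.
  apply: (ND); last by apply: (ND); exact: NM.
  by apply: (ND); exact: dM.
move=> a Pa; have [na [sa [Nna ssa ->]]] := PM _ Pa.
by apply: (ND) => //; apply: (span_sub N0 ND) ssa => b w Pb /NW; apply: NM.
Qed.

Lemma derivation_frac0 P d : X P -> derivation iota d -> (forall a, P a -> d a = 0) ->
  forall f, funfield X f -> d f = 0.
Proof.
move=> XP hd h f /(model_frac x_neq0 XP)[a [b [Pa Pb b0 ->]]].
by rewrite derivation_div // !h // mul0r mulr0 subr0 mul0r.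
Qed.

(** All values of [d] on [P] are multiples of [d v]. If [d v] is nonzero, deriving
    [v ^+ k.+1 = u * c] shows that [u] divides [v ^+ k]; by descent [u] would divide 1. *)
Lemma parameters_derivation0 P u v k d : Cpoint iota X P -> parameters P u v ->
  principal u P (v ^+ k) -> derivation iota d -> d u = 0 ->
  forall f, funfield X f -> d f = 0.
Proof.
move=> CP huv + hd du0; have [XP _] := CP; have [dD dM dC] := hd.
have hP := model_local x_neq0 XP; have [hP' hm] := hP.
have mu := parameters_left hP huv; have Pu := maxid_sub mu.
have mv := parameters_left hP (parametersC huv); have Pv := maxid_sub mv.
have hN := principal_submodule (d v) hP'.
have dP a : P a -> principal (d v) P (d a).
  apply: (derivation_submodule CP huv hN) => //.
  - move=> b c _ _; rewrite dM addrAC addrK subrr; exact: (let: And3 N0 _ _ := hN in N0).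
  - by rewrite du0; case: hN.
  - exact: principal_self.
have [dv0 _|dv0] := eqVneq (d v) 0.
  apply: (derivation_frac0 XP hd) => a Pa; have [b _ <-] := dP a Pa.
  by rewrite dv0 mul0r.
elim: k => [|k IH] [c Pc ec].
  exfalso; apply: (maxidN1 hP'); rewrite -(expr0 v) -ec.
  by apply: (principal_maxid hP mu); exists c.
apply: IH; have [e Pe ede] := dP c Pc.
have Ck : P (iota (k.+1%:R)^-1) by apply: (model_const x_neq0 XP); exists (k.+1%:R)^-1.
exists (iota (k.+1%:R)^-1 * e); first exact: subringM.
have := congr1 d ec; rewrite derivationX // dM du0 mulr0 addr0 -ede => h.
have k0 : (k.+1%:R : K) != 0 by rewrite -(rmorph_nat iota) fmorph_eq0 pnatr_eq0.
apply: (mulfI k0); apply: (mulIf dv0); rewrite -h fmorphV rmorph_nat; field.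
by rewrite nat1r.
Qed.

End Model.

(** The middle member of a chain of three local rings gives, at a complex point below the chain, a
    prime that is neither zero nor maximal, and [parameters_pow] applies. *)
Lemma surface_chain X : smooth_projective_surface iota X ->
  exists P u v, [/\ Cpoint iota X P, parameters P u v, u != 0,
     forall k, ~ principal u P (v ^+ k) & forall k, ~ principal v P (u ^+ k)].
Proof.
move=> [[n [x [x0 eX]]] [[A [B [C [XA XB XC AB BC]]]] _] sm]; rewrite eX in XA XB XC sm.
have [P CP PA] := model_sub_Cpoint x0 XA.
have [u [v huv]] := sm _ CP; have [XP _] := CP.
have hP := model_local x0 XP; have [hP' hm] := hP.
have hB := model_local x0 XB.
have PB : P `<=` B by apply: subset_trans PA _; case: AB.
pose q := maxid B `&` P; have hq : prime_ideal P q := maxidI_prime hP' hB PB.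
have eB : B = localization P q := model_sub_localization x0 XP XB PB.
have qm : q <> maxid P.
  move=> qm; have [_ BA] := AB; apply: BA; apply: subset_trans PA.
  rewrite eB qm; apply: localization_sub => //; first exact: local_maxid_prime.
  by move=> b Pb; apply: maxid_inv.
have q0 : exists2 a, q a & a != 0.
  apply: contrapT => h; have [_ CB] := BC; apply: CB => f Cf.
  have [a [b [Pa Pb b0 ->]]] := model_frac x0 XP (model_funfield_sub XC Cf).
  rewrite eB; exists a, b; split=> // qb; apply: h; by exists b.
have upow k : ~ principal u P (v ^+ k).
  exact: (parameters_pow hP (noetherian_model x0 XP) huv hq qm q0).
have vpow k : ~ principal v P (u ^+ k).
  exact: (parameters_pow hP (noetherian_model x0 XP) (parametersC huv) hq qm q0).
exists P, u, v; rewrite eX; split=> //.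
apply/eqP => u0; apply: (vpow 1%N); rewrite expr1 u0.
by exists 0; rewrite ?mulr0 //; apply: subring0.
Qed.

(** The point of [surface_chain] provides derivations dual to its parameters. If [u'] divided a
    power of [v'] at [P], every derivation killing [u'] would vanish on the function field; applied
    to [D1 u' * D2 - D2 u' * D1] this forces [D1 u' = 0], and then [D1] itself vanishes. *)
Lemma surface_parameters X P u v : smooth_projective_surface iota X ->
  Cpoint iota X P -> parameters P u v ->
  u != 0 /\ forall k, ~ principal u P (v ^+ k).
Proof.
move=> hX CP huv; have [[n [x [x0 eX]]] _ _] := hX.
have [P0 [u0 [v0 [CP0 huv0 u00 upow0 _]]]] := surface_chain hX.
rewrite eX in CP CP0; have [XP _] := CP; have [XP0 _] := CP0.
have hP := model_local x0 XP; have hP0 := model_local x0 XP0.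
have mu0 := parameters_left hP0 huv0.
have mv0 := parameters_left hP0 (parametersC huv0).
have indep := parameters_independent hP0 (model_const x0 XP0) mv0 (maxid_sub mu0) u00 upow0.
have [D1 hD1 [D1u D1v]] := exists_derivation 1 0 indep.
have [D2 hD2 [D2u D2v]] := exists_derivation 0 1 indep.
have Fu0 : funfield (model iota x) u0 by apply: model_funfield_sub XP0 _ (maxid_sub mu0).
have Fv0 : funfield (model iota x) v0 by apply: model_funfield_sub XP0 _ (maxid_sub mv0).
have upow u' v' k : parameters P u' v' -> ~ principal u' P (v' ^+ k).
  move=> huv' hk; have kill := parameters_derivation0 x0 CP huv' hk.
  have hd := derivation_lin (D1 u') (- D2 u') hD2 hD1.
  have du : D1 u' * D2 u' + - D2 u' * D1 u' = 0 by ring.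
  have := kill _ hd du u0 Fu0; rewrite D2u D1u mulr0 add0r mulr1 => /eqP.
  have := kill _ hd du v0 Fv0; rewrite D2v D1v mulr0 addr0 mulr1 => D1u' _.
  by have /eqP := kill _ hD1 D1u' u0 Fu0; rewrite D1u oner_eq0.
split=> [|k]; last exact: upow.
apply/eqP => u_0; apply: (upow v u 1%N (parametersC huv)); rewrite expr1 u_0.
by exists 0; rewrite ?mulr0 //; apply: subring0; case: hP.
Qed.

(** The partial derivatives with respect to [u] and [v]; they preserve [P] by [derivation_submodule]
    with [N = P]. *)
Lemma dual_derivations X P u v : smooth_projective_surface iota X ->
  Cpoint iota X P -> parameters P u v ->
  exists D1 D2, [/\ derivation iota D1, derivation iota D2,
    [/\ D1 u = 1, D1 v = 0, D2 u = 0 & D2 v = 1],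
    forall a, P a -> P (D1 a) & forall a, P a -> P (D2 a)].
Proof.
move=> hX CP huv; have [u0 upow] := surface_parameters hX CP huv.
have [[n [x [x0 eX]]] _ _] := hX; rewrite eX in CP; have [XP _] := CP.
have hP := model_local x0 XP; have [hP' _] := hP.
have mu := parameters_left hP huv.
have mv := parameters_left hP (parametersC huv).
have indep := parameters_independent hP (model_const x0 XP) mv (maxid_sub mu) u0 upow.
have [D1 hD1 [D1u D1v]] := exists_derivation 1 0 indep.
have [D2 hD2 [D2u D2v]] := exists_derivation 0 1 indep.
have DP D : derivation iota D -> P (D u) -> P (D v) -> forall a, P a -> P (D a).
  move=> [dD dM dC]; apply: (derivation_submodule x0 CP huv (subring_submodule hP')) => //.
  move=> a b Pa Pb; rewrite dM.
  have -> : a * D b + b * D a - a * D b - b * D a = 0 by ring.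
  exact: subring0.
by exists D1, D2; split=> //; apply: DP => //; rewrite ?D1u ?D1v ?D2u ?D2v;
  do ?[exact: subring1|exact: subring0].
Qed.

End SmoothPoints.

(** * Valuations *)

Section Order.
Context {K : fieldType}.
Implicit Types (E F O : set K) (f g : K).

Section Dvr.
Variables (F E : set K).
Hypothesis hE : dvr F E.

Lemma dvr_local : local_ring E. Proof. by case: hE. Qed.
Lemma dvr_subring : is_subring E. Proof. by case: dvr_local. Qed.
Lemma dvr_sub : E `<=` F. Proof. by case: hE. Qed.

Lemma uniformizer_maxid t : maxid E = principal t E -> maxid E t.
Proof. by move=> ->; apply/principal_self/dvr_subring. Qed.

Lemma loc_unit_expz e (n : int) : loc_unit E e -> loc_unit E (e ^ n).
Proof.
move=> ue; have hX (k : nat) : loc_unit E (e ^+ k).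
  elim: k => [|k IH]; first exact/loc_unit1/dvr_subring.
  by rewrite exprS; apply: loc_unitM IH => //; apply: dvr_subring.
by case: n => n; [exact: hX|rewrite NegzE -invr_expz -exprnP; exact/loc_unitV].
Qed.

Lemma uniformizer_expz t (n : int) : maxid E t -> 0 < n -> maxid E (t ^ n).
Proof.
have [hE' [_ _ mM]] := dvr_local; move=> mt; case: n => // -[//|n] _.
rewrite -exprnP exprS mulrC; apply: mM => //.
by apply: subringX => //; apply: maxid_sub.
Qed.

Lemma uniformizer_unit t e (n : int) : maxid E t -> t != 0 -> loc_unit E e ->
  loc_unit E (t ^ n * e) -> n = 0.
Proof.
move=> mt t0 ue u; have hE' := dvr_subring.
have ut : loc_unit E (t ^ n).
  have [e0 _] := ue; rewrite -[t ^ n](mulfK e0).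
  by apply: loc_unitM => //; apply: loc_unitV.
case: (ltgtP n 0) => // n0; last by case: (uniformizer_expz mt n0).
have [] : maxid E (t ^ (- n)) by apply: uniformizer_expz; rewrite ?oppr_gt0.
by move=> _ nu; case: nu; rewrite -invr_expz; apply: loc_unitV.
Qed.

Lemma has_ord_unique f n m : has_ord E f n -> has_ord E f m -> n = m.
Proof.
have hE' := dvr_subring; move=> [t [e [ht ue ->]]] [t' [e' [ht' ue' eq]]].
have mt := uniformizer_maxid ht; have mt' := uniformizer_maxid ht'.
(* [has_ord] does not exclude [t = 0], which would make the maximal ideal zero. *)
have [t0|t0] := eqVneq t 0.
  have [_ _ [s [s0 hs _]]] := hE.
  have : maxid E s by apply: uniformizer_maxid.
  by rewrite ht t0 => -[a _]; rewrite mul0r => s_0; rewrite -s_0 eqxx in s0.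
have [a Ea ea] : principal t' E t by rewrite -[principal t' E]ht'.
have [b Eb eb] : principal t E t' by rewrite -[principal t E]ht.
have t'0 : t' != 0 by apply: contra_neq t0 => t'0; rewrite -ea t'0 mul0r.
have ab : a * b = 1 by apply: (mulfI t'0); rewrite mulrA ea eb mulr1.
have ua : loc_unit E a.
  have a0 : a != 0 by apply/eqP => a0; move/eqP: ab; rewrite a0 mul0r eq_sym oner_eq0.
  by split=> //; split=> //; rewrite -[a^-1]mulr1 -ab mulKf.
have [e'0 _] := ue'.
have : loc_unit E (t' ^ (n - m) * (a ^ n * e)).
  have -> : t' ^ (n - m) * (a ^ n * e) = e'.
    rewrite expfzDr // -mulrA (mulrC (t' ^ (- m))) mulrA mulrA -expfzMl ea eq.
    by rewrite mulrAC -expfzDr // subrr expr0z mul1r.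
  exact: ue'.
have uae : loc_unit E (a ^ n * e) := loc_unitM hE' (loc_unit_expz n ua) ue.
by move=> /(uniformizer_unit mt' t'0 uae)/eqP; rewrite subr_eq0 => /eqP.
Qed.

Lemma ordE f n : has_ord E f n -> ord E f = n.
Proof.
move=> h; apply: (@has_ord_unique f) => //.
by have := @xgetPex _ 0 [set n | has_ord E f n]; apply; exists n.
Qed.

Lemma has_ordP f : F f -> f != 0 -> has_ord E f (ord E f).
Proof.
move=> Ff f0; have [_ _ [t [t0 ht tot]]] := hE; have [n [e [ue ef]]] := tot f Ff f0.
suff h : has_ord E f n by rewrite (ordE h).
by exists t, e.
Qed.

Lemma ord_uniformizer t f : maxid E = principal t E -> F f -> f != 0 ->
  exists2 e, loc_unit E e & f = t ^ (ord E f) * e.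
Proof.
move=> ht Ff f0; have hE' := dvr_subring.
have [s [e [hs ue ef]]] := has_ordP Ff f0.
have [a Ea ea] : principal t E s by rewrite -[principal t E]ht; apply: uniformizer_maxid.
have [b Eb eb] : principal s E t by rewrite -[principal s E]hs; apply: uniformizer_maxid.
have [s0|s0] := eqVneq s 0.
  have [_ _ [r [r0 hr _]]] := hE.
  have : maxid E r by apply: uniformizer_maxid.
  by rewrite hs s0 => -[c _]; rewrite mul0r => r_0; rewrite -r_0 eqxx in r0.
have ab : a * b = 1 by apply: (mulfI s0); rewrite mulr1 mulrA mulrAC eb ea.
have ua : loc_unit E a.
  have a0 : a != 0 by apply/eqP => a0; move/eqP: ab; rewrite a0 mul0r eq_sym oner_eq0.
  by split=> //; split=> //; rewrite -[a^-1]mulr1 -ab mulKf.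
exists (a ^ (ord E f) * e); first exact: loc_unitM (loc_unit_expz _ ua) ue.
by rewrite mulrA -expfzMl ea.
Qed.

Lemma dvr_uniformizer : exists t, t != 0 /\ maxid E = principal t E.
Proof. by have [_ _ [t [t0 ht _]]] := hE; exists t. Qed.

Lemma ord_expz t e n : t != 0 -> maxid E = principal t E -> loc_unit E e ->
  ord E (t ^ n * e) = n.
Proof. by move=> t0 ht ue; apply: ordE; exists t, e. Qed.

Lemma ord_unit e : loc_unit E e -> ord E e = 0.
Proof.
by move=> ue; have [t [t0 ht]] := dvr_uniformizer; rewrite -[e]mul1r -(expr0z t) ord_expz.
Qed.

Lemma ord1 : ord E 1 = 0. Proof. exact/ord_unit/loc_unit1/dvr_subring. Qed.

Lemma ordM f g : F f -> F g -> f != 0 -> g != 0 -> ord E (f * g) = ord E f + ord E g.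
Proof.
move=> Ff Fg f0 g0; have [t [t0 ht]] := dvr_uniformizer.
have [e ue ef] := ord_uniformizer ht Ff f0; have [d ud eg] := ord_uniformizer ht Fg g0.
rewrite {1}ef {1}eg mulrACA -expfzDr // ord_expz //.
by apply: loc_unitM => //; apply: dvr_subring.
Qed.

Lemma ordV f : F f -> f != 0 -> ord E f^-1 = - ord E f.
Proof.
move=> Ff f0; have [t [t0 ht]] := dvr_uniformizer.
have [e ue ef] := ord_uniformizer ht Ff f0.
rewrite {1}ef invfM invr_expz ord_expz //; exact: loc_unitV.
Qed.

Lemma ord_mem f : F f -> f != 0 -> (0 <= ord E f) <-> E f.
Proof.
move=> Ff f0; have [t [t0 ht]] := dvr_uniformizer; have hE' := dvr_subring.
have [e ue ef] := ord_uniformizer ht Ff f0; have [e0 [Ee Ee']] := ue.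
have mt := uniformizer_maxid ht.
split=> [h|Ef].
  rewrite ef; case: (ord E f) h => // n _; rewrite -exprnP.
  by apply: subringM => //; apply: subringX => //; apply: maxid_sub.
rewrite leNgt; apply/negP => h.
have m : maxid E (t ^ (- ord E f)) by apply: uniformizer_expz; rewrite ?oppr_gt0.
have [_ [_ _ mM]] := dvr_local.
apply: (maxidN1 hE').
have -> : 1 = (f * e^-1) * t ^ (- ord E f).
  by rewrite {1}ef mulfK // -expfzDr // subrr expr0z.
by apply: mM => //; apply: subringM.
Qed.

Lemma ord_unitP f : F f -> f != 0 -> ord E f = 0 <-> loc_unit E f.
Proof.
move=> Ff f0; split=> [h|]; last exact: ord_unit.
have [t [t0 ht]] := dvr_uniformizer; have [e ue ef] := ord_uniformizer ht Ff f0.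
by rewrite ef h expr0z mul1r.
Qed.

Lemma ord_maxid f : F f -> f != 0 -> (0 < ord E f) <-> maxid E f.
Proof.
move=> Ff f0; split.
  move=> h; split; first by apply/(ord_mem Ff f0)/ltW.
  by move=> /ord_unit h'; rewrite h' ltxx in h.
move=> [/(ord_mem Ff f0)]; rewrite le_eqVlt => /orP[/eqP h|//] nu.
by case: nu; apply/ord_unitP.
Qed.

Lemma dvr_inv_mem f : F f -> f != 0 -> ~ E f -> maxid E f^-1.
Proof.
move=> Ff f0 nE; have [t [t0 ht]] := dvr_uniformizer.
have [e ue ef] := ord_uniformizer ht Ff f0.
have h : ord E f < 0 by rewrite ltNge; apply/negP => /(ord_mem Ff f0).
have [_ [_ _ mM]] := dvr_local.
rewrite ef invfM invr_expz mulrC; apply: mM; first by case: ue => _ [].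
by apply: uniformizer_expz; rewrite ?oppr_gt0 //; apply: uniformizer_maxid.
Qed.

Lemma dvr_valuation f : F f -> f != 0 -> E f \/ E f^-1.
Proof.
move=> Ff f0; have [h|h] := pselect (E f); [by left|right].
by apply: maxid_sub; apply: dvr_inv_mem.
Qed.

(** A discrete valuation ring is a maximal proper subring: adjoining an element of negative order
    inverts the uniformizer. *)
Lemma dvr_maximal O f : is_subring O -> E `<=` O -> O f -> F f -> ~ E f -> F `<=` O.
Proof.
move=> hO EO Of Ff nf g Fg; have [g0|g0] := eqVneq g 0; first by rewrite g0; apply: subring0.
have f0 : f != 0 by apply: contra_not_neq nf => ->; apply: subring0 dvr_subring.
have [t [t0 ht]] := dvr_uniformizer; have mt := uniformizer_maxid ht.
have [e ue ef] := ord_uniformizer ht Ff f0; have [d [_ [Ed _]] eg] := ord_uniformizer ht Fg g0.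
have h : ord E f < 0 by rewrite ltNge; apply/negP => /(ord_mem Ff f0).
have Ot : O t^-1.
  have -> : t^-1 = f * e^-1 * t ^ (- ord E f - 1).
    rewrite {1}ef mulfK; last by case: ue.
    by rewrite -expfzDr // addrA subrr add0r.
  apply: subringM => //; first by apply: subringM => //; apply: EO; case: ue => _ [].
  have : 0 <= - ord E f - 1 by move: h; lia.
  case: (- ord E f - 1) => // k _; rewrite -exprnP; apply: subringX => //.
  by apply: EO; apply: maxid_sub.
rewrite eg; apply: subringM => //; last exact: EO.
case: (ord E g) => k; first by rewrite -exprnP; apply: subringX => //; apply: EO; apply: maxid_sub.
by rewrite NegzE -invr_expz -exprnP -exprVn; apply: subringX.
Qed.

Lemma dominates_dvr O : O `<=` F -> dominates O E -> O = E.
Proof.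
move=> OF [EO mO]; apply/seteqP; split=> // f Of; apply: contrapT => nf.
have f0 : f != 0 by apply: contra_not_neq nf => ->; apply: subring0 dvr_subring.
have [Of' nu] := mO _ (dvr_inv_mem (OF _ Of) f0 nf); apply: nu.
by split; rewrite ?invr_eq0 ?invrK.
Qed.

Lemma ordX f n : (forall a b, F a -> F b -> F (a * b)) -> F f -> f != 0 ->
  ord E (f ^+ n) = ord E f *+ n.
Proof.
move=> FM Ff f0; elim: n => [|n IH]; first by rewrite expr0 ord1.
have Fn : F (f ^+ n).
  by elim: n {IH} => [|n IH]; [apply: dvr_sub; apply: subring1; apply: dvr_subring|rewrite exprS; apply: FM].
by rewrite exprS ordM // ?expf_neq0 // IH mulrS.
Qed.

Lemma ordD f g n : F f -> F g -> F (f + g) -> f + g != 0 ->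
  (f != 0 -> n <= ord E f) -> (g != 0 -> n <= ord E g) -> n <= ord E (f + g).
Proof.
move=> Ff Fg Ffg fg0 hf hg; have [t [t0 ht]] := dvr_uniformizer.
have hE' := dvr_subring; have mt := uniformizer_maxid ht.
have div h : F h -> (h != 0 -> n <= ord E h) -> exists2 a, E a & h = t ^ n * a.
  move=> Fh hh; have [->|h0] := eqVneq h 0.
    by exists 0; rewrite ?mulr0 //; apply: subring0.
  have [e ue eh] := ord_uniformizer ht Fh h0.
  exists (t ^ (ord E h - n) * e); last by rewrite mulrA -expfzDr // addrC subrK.
  apply: subringM => //; last by case: ue => _ [].
  have : 0 <= ord E h - n by rewrite subr_ge0 hh.
  case: (ord E h - n) => // k _; rewrite -exprnP; apply: subringX => //.
  by apply: maxid_sub.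
have [a Ea ea] := div f Ff hf; have [b Eb eb] := div g Fg hg.
have ab0 : a + b != 0 by apply: contra_neq fg0; rewrite ea eb -mulrDr => ->; rewrite mulr0.
have Eab : E (a + b) by apply: subringD.
have [d ud ed] := ord_uniformizer ht (dvr_sub Eab) ab0.
rewrite ea eb -mulrDr ed mulrA -expfzDr // ord_expz //.
by rewrite lerDl; apply/(ord_mem (dvr_sub Eab) ab0).
Qed.

End Dvr.

Lemma ord_preimage (sigma : {rmorphism K -> K}) E f : bijective sigma ->
  ord (sigma @^-1` E) f = ord E (sigma f).
Proof.
move=> [tau sK tK].
have su a : loc_unit (sigma @^-1` E) a <-> loc_unit E (sigma a).
  by rewrite /loc_unit /= fmorph_eq0 fmorphV.
have smax : maxid (sigma @^-1` E) = sigma @^-1` maxid E.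
  by apply/seteqP; split=> a [Ea nu]; split=> // /su.
congr xget; apply/seteqP; split=> n /= [t [e [ht ue ef]]].
  exists (sigma t), (sigma e); split.
  - apply/seteqP; split=> a.
      rewrite -(tK a) => ma; have : maxid (sigma @^-1` E) (tau a) by rewrite smax.
      by rewrite ht => -[b Eb <-]; exists (sigma b); rewrite ?rmorphM.
    move=> [b Eb <-]; have : maxid (sigma @^-1` E) (t * tau b).
      by rewrite ht; exists (tau b); rewrite /= ?tK.
    by rewrite smax /= rmorphM tK.
  - exact/su.
  - by rewrite ef rmorphM fmorphXz.
exists (tau t), (tau e); split.
- rewrite smax; apply/seteqP; split=> a /=.
    rewrite ht => -[b Eb eb]; exists (tau b); rewrite /= ?tK //.
    by apply: (fmorph_inj sigma); rewrite rmorphM !tK.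
  move=> [b Eb <-]; rewrite rmorphM tK ht; by exists (sigma b).
- by apply/su; rewrite tK.
- by apply: (fmorph_inj sigma); rewrite rmorphM fmorphXz !tK.
Qed.

End Order.

(** * Prime divisors of a smooth projective surface *)

Section Surfaces.
Context {R : realType} {K : fieldType} (iota : {rmorphism R[i] -> K}).
Implicit Types (A O P N E p q : set K) (u v : K).

Local Notation consts := (range iota).

(* Noetherian induction: every ideal contains a product of primes above it. *)
Lemma primes_over A I : is_subring A -> noetherian A -> submodule A I -> I `<=` A ->
  exists S : set (set K), [/\ finite_set S, forall p, S p -> prime_ideal A p /\ I `<=` p
    & forall q, prime_ideal A q -> I `<=` q -> exists2 p, S p & p `<=` q].
Proof.
move=> hA nA hI IA; pose good J := exists S : set (set K), [/\ finite_set S,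
  forall p, S p -> prime_ideal A p /\ J `<=` p
  & forall q, prime_ideal A q -> J `<=` q -> exists2 p, S p & p `<=` q].
apply: contrapT => nI.
pose F := [set J | [/\ submodule A J, J `<=` A & ~ good J]].
have [||J [[hJ JA nJ] maxJ]] := @noetherian_maximal _ A F hA nA.
- by exists I.
- by move=> J [].
have [J0 JD JM] := hJ.
have J1 : ~ J 1.
  move=> J1; apply: nJ; exists set0; split=> // q [_ [_ q1] _ _ _] /(_ _ J1) //.
have [hp|np] := pselect (prime_ideal A J).
  apply: nJ; exists [set J]; split; first exact: finite_set1.
    by move=> p ->; split.
  by move=> q _ Jq; exists J.
have [a [b [Aa Ab na nb Jab]]] : exists a b, [/\ A a, A b, ~ J a, ~ J b & J (a * b)].
  apply: contrapT => h; apply: np; split=> // a b Aa Ab Jab.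
  by apply: contrapT => /not_orP[na nb]; apply: h; exists a, b.
have up c : A c -> ~ J c -> good (sum_set J (principal c A)).
  move=> Ac nc; apply: contrapT => ng; apply: nc; apply: (maxJ (sum_set J (principal c A))).
  - split=> //; first exact/sum_set_submodule/principal_submodule.
    by move=> _ [d [_ [Jd [e Ae <-] ->]]]; apply: subringD => //; [exact: JA|exact: subringM].
  - by move=> d Jd; exists d, 0; rewrite addr0; split=> //; exists 0; [exact: subring0|rewrite mulr0].
  - by exists 0, c; rewrite add0r; split=> //; apply: principal_self.
have [Sa [fa ha ca]] := up a Aa na; have [Sb [fb hb cb]] := up b Ab nb.
have Jsum c : J `<=` sum_set J (principal c A).
  by move=> d Jd; exists d, 0; rewrite addr0; split=> //; exists 0; [exact: subring0|rewrite mulr0].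
apply: nJ; exists (Sa `|` Sb); split.
- by rewrite finite_setU.
- by move=> p [/ha|/hb] [hp cp]; split=> //; apply: subset_trans cp; apply: Jsum.
move=> q hq Jq; have [qA [q0 q1] qD qM qP] := hq.
have cover c : A c -> q c -> sum_set J (principal c A) `<=` q.
  move=> Ac qc _ [d [_ [Jd [e Ae <-] ->]]]; apply: qD; first exact: Jq.
  by rewrite mulrC; apply: qM.
have [qa|qb] := qP _ _ Aa Ab (Jq _ Jab).
  by have [p Sp pq] := ca q hq (cover _ Aa qa); exists p => //; left.
by have [p Sp pq] := cb q hq (cover _ Ab qb); exists p => //; right.
Qed.

Variable X : set (set K).
Hypothesis hX : smooth_projective_surface iota X.
Local Notation F := (funfield X).

Lemma surface_presents : exists n (x : 'I_n.+1 -> K), (forall i, x i != 0) /\ X = model iota x.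
Proof. by have [[n [x hx]] _ _] := hX; exists n, x. Qed.

Lemma surface_local O : X O -> local_ring O.
Proof.
by have [n [x [x0 ->]]] := surface_presents; apply: model_local.
Qed.

Lemma surface_const O : X O -> consts `<=` O.
Proof. by have [n [x [x0 ->]]] := surface_presents; apply: model_const. Qed.

Lemma surface_funfield : X F.
Proof. by have [n [x [x0 ->]]] := surface_presents; apply: funfield_model. Qed.

Lemma funfieldV f : F f -> F f^-1.
Proof. by have [n [x [x0 ->]]] := surface_presents; apply: funfield_inv. Qed.

Lemma surface_sub_funfield O : X O -> O `<=` F.
Proof. by move=> XO f Of; exists O. Qed.

Lemma surface_frac O f : X O -> F f -> exists a b, [/\ O a, O b, b != 0 & f = a / b].
Proof. by have [n [x [x0 ->]]] := surface_presents; apply: model_frac. Qed.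

Lemma surface_noetherian O : X O -> noetherian O.
Proof. by have [n [x [x0 ->]]] := surface_presents; apply: noetherian_model. Qed.

Lemma surface_localization O q : X O -> prime_ideal O q -> X (localization O q).
Proof. by have [n [x [x0 ->]]] := surface_presents; apply: model_localization_mem. Qed.

Lemma surface_sub_localization O O' : X O -> X O' -> O `<=` O' ->
  O' = localization O (maxid O' `&` O).
Proof. by have [n [x [x0 ->]]] := surface_presents; apply: model_sub_localization. Qed.

Lemma surface_center_unique V O1 O2 : X O1 -> X O2 ->
  dominates V O1 -> dominates V O2 -> O1 = O2.
Proof. by have [n [x [x0 ->]]] := surface_presents; apply: model_center_unique. Qed.

Lemma surface_Cpoint O : X O -> exists2 P, Cpoint iota X P & P `<=` O.
Proof. by have [n [x [x0 ->]]] := surface_presents; apply: model_sub_Cpoint. Qed.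

Lemma surface_center V : local_ring V -> consts `<=` V ->
  (forall f, F f -> f != 0 -> V f \/ V f^-1) -> exists2 O, X O & dominates V O.
Proof.
have [n [x [x0 ->]]] := surface_presents => hV CV vV.
have [i iV] := valuation_ring_chart x0 hV.1 CV vV.
exact: model_center iV.
Qed.

Lemma dvr_not_funfield E : dvr F E -> E <> F.
Proof.
move=> hE eE; have [t [t0 ht]] := dvr_uniformizer hE.
have mt := uniformizer_maxid hE ht; have [Et nu] := mt; apply: nu.
by split=> //; split=> //; rewrite eE; apply: funfieldV; rewrite -eE.
Qed.

Lemma dvr_prime_divisor E : X E -> dvr F E -> prime_divisor X E.
Proof.
move=> XE hE; split=> //; first split.
- exact: surface_sub_funfield.
- by move=> FE; apply: (dvr_not_funfield hE); apply/seteqP; split=> //; apply: surface_sub_funfield.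
move=> Q XQ [EQ nQE]; apply/seteqP; split; first exact: surface_sub_funfield.
have [f Qf nf] : exists2 f, Q f & ~ E f.
  by apply: contrapT => h; apply: nQE => f Qf; apply: contrapT => nf; apply: h; exists f.
by apply: (dvr_maximal hE (surface_local XQ).1 EQ Qf _ nf); apply: surface_sub_funfield Qf.
Qed.

Section AtPoint.
Variable P : set K.
Hypothesis CP : Cpoint iota X P.

Let XP : X P. Proof. by case: CP. Qed.
Let hP : local_ring P. Proof. exact: surface_local. Qed.
Let nP : noetherian P. Proof. exact: surface_noetherian. Qed.

Lemma prime_element_dvr (p : K) : p != 0 -> prime_ideal P (principal p P) ->
  dvr F (localization P (principal p P)).
Proof.
move=> p0 hp; apply: dvr_localization => //.
- by apply: surface_sub_funfield; apply: surface_localization.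
- by move=> f Ff; apply: surface_frac.
Qed.

Lemma prime_element_divisor (p : K) : p != 0 -> prime_ideal P (principal p P) ->
  prime_divisor X (localization P (principal p P)).
Proof.
by move=> p0 hp; apply: dvr_prime_divisor; [exact: surface_localization|exact: prime_element_dvr].
Qed.

Lemma exists_parameters : exists u v, [/\ parameters P u v, u != 0
  & forall k, ~ principal u P (v ^+ k)].
Proof.
have [_ _ sm] := hX; have [u [v huv]] := sm _ CP.
by have [u0 upow] := surface_parameters hX CP huv; exists u, v.
Qed.

(** The localization at the prime generated by [u] lies strictly between [P] and the function field:
    it inverts [v] but not [u]. *)
Lemma Cpoint_not_prime_divisor : ~ prime_divisor X P.
Proof.
move=> [_ _ maxP]; have [u [v [huv u0 upow]]] := exists_parameters.
have hp := parameter_prime hP nP huv upow.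
have hE := prime_element_dvr u0 hp.
have PE := sub_localization hP.1 hp.
apply: (dvr_not_funfield hE); apply: maxP; first exact: surface_localization.
split=> // EP; have mv := parameters_left hP (parametersC huv).
have nv : ~ principal u P v by rewrite -(expr1 v).
have Pv := maxid_sub mv; case: mv => _; apply; split.
  by apply/eqP => v0; apply: nv; rewrite v0; case: (principal_submodule u hP.1).
split=> //; apply: EP; exists 1, v; split=> //; first exact: subring1 hP.1.
by rewrite mul1r.
Qed.

Lemma over_Cpoint O : X O -> P `<=` O ->
  [\/ O = F, O = P | exists p : K, [/\ p != 0, prime_ideal P (principal p P)
        & O = localization P (principal p P)]].
Proof.
move=> XO PO; have [u [v [huv u0 upow]]] := exists_parameters.
have hO := surface_local XO; have hq := maxidI_prime hP.1 hO PO.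
have eO := surface_sub_localization XP XO PO.
have [qm|qm] := pselect (maxid O `&` P = maxid P).
  apply: Or32; rewrite eO qm; apply/seteqP; split; last first.
    by apply: sub_localization; [exact: hP.1|exact: local_maxid_prime].
  apply: localization_sub => //; [exact: hP.1|exact: local_maxid_prime|exact: hP.1|].
  by move=> b Pb; apply: maxid_inv.
have [q0|q0] := pselect (exists2 a, (maxid O `&` P) a & a != 0).
  have [p p0 ep] := prime_principal hP nP huv hq qm q0.
  by apply: Or33; exists p; rewrite -ep.
apply: Or31; apply/seteqP; split; first exact: surface_sub_funfield.
move=> f /(surface_frac XP)[a [b [Pa Pb b0 ->]]]; rewrite eO; exists a, b.
by split=> // qb; apply: q0; exists b.
Qed.

Lemma Cpoint_normal f : F f ->
  (forall E, prime_divisor X E -> P `<=` E -> E f) -> P f.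
Proof.
move=> Ff hf; have [u [v [huv u0 upow]]] := exists_parameters.
have [a [b [Pa Pb b0 ef]]] := surface_frac XP Ff.
apply: (factorial_normal hP nP huv u0 upow Pa Pb b0 ef) => p p0 hp pm.
by apply: hf; [exact: prime_element_divisor|apply: sub_localization => //; exact: hP.1].
Qed.

End AtPoint.

Lemma prime_divisor_dvr E : prime_divisor X E -> dvr F E.
Proof.
move=> hE; have [XE [_ nFE] _] := hE; have [P CP PE] := surface_Cpoint XE.
have [eE|eE|[p [p0 hp ->]]] := over_Cpoint CP XE PE.
- by case: nFE; rewrite -eE.
- by case: (Cpoint_not_prime_divisor CP); rewrite -eE.
- exact: prime_element_dvr.
Qed.

Lemma surface_cases O : X O -> [\/ O = F, Cpoint iota X O | prime_divisor X O].
Proof.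
move=> XO; have [P CP PO] := surface_Cpoint XO.
have [eE|eE|[p [p0 hp ->]]] := over_Cpoint CP XO PO.
- exact: Or31.
- by apply: Or32; rewrite eE.
- by apply: Or33; apply: prime_element_divisor.
Qed.

Lemma regular_divisor_const f : F f ->
  (forall E, prime_divisor X E -> E f) -> exists c, f = iota c.
Proof.
move=> Ff hf.
have hP P : Cpoint iota X P -> P f.
  by move=> CP; apply: Cpoint_normal => // E hE _; apply: hf.
by have [n [x [x0 eX]]] := surface_presents; rewrite eX in hP; apply: regular_const hP.
Qed.

Lemma ord0_const f : F f -> f != 0 ->
  (forall E, prime_divisor X E -> ord E f = 0) -> exists2 c, c != 0 & f = iota c.
Proof.
move=> Ff f0 hf; have [|c ec] := regular_divisor_const Ff.
  by move=> E hE; apply/(ord_mem (prime_divisor_dvr hE) Ff f0); rewrite hf.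
by exists c => //; apply: contra_neq f0 => c0; rewrite ec c0; apply: rmorph0.
Qed.

(** On each of the finitely many charts [f = a / b]. A divisor of the support has [a * b] in its
    maximal ideal; a prime [p] from [primes_over] lies in its prime, and the two localizations agree
    because only the function field is larger than a prime divisor. *)
Lemma finite_support f : F f -> f != 0 ->
  finite_set [set E | prime_divisor X E /\ ord E f <> 0].
Proof.
move=> Ff f0; have [n [x [x0 eX]]] := surface_presents.
have chart_finite i c : affine iota x (x i) c -> c != 0 ->
    finite_set [set E | [/\ prime_divisor X E, affine iota x (x i) `<=` E & maxid E c]].
  set A := affine _ _ _ => Ac c0; have fx := forms_x iota x i.
  have hA : is_subring A := affine_subring fx.
  have nA : noetherian A by rewrite /A -(chartE iota x0); apply: noetherian_chart.
  have [|S [fS hS cS]] := primes_over hA nA (principal_submodule c hA).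
    exact: principal_sub.
  apply: (@sub_finite_set _ _ [set localization A p | p in S]); last exact: finite_image.
  move=> E [hE AE mc]; have [XE _ maxE] := hE.
  have hEl := surface_local XE; have hq := maxidI_prime hA hEl AE.
  have [|p Sp pq] := cS _ hq.
    by have [_ [_ _ mM]] := hEl; move=> _ [a Aa <-]; split;
      [rewrite mulrC; apply: mM => //; exact: AE|exact: subringM].
  have [hp cp] := hS p Sp; exists p => //.
  have pc : p c by apply: cp; apply: principal_self.
  have XEm : model iota x E by rewrite -eX.
  have eE := model_localization x0 XEm fx (x0 i) AE.
  have XL : X (localization A p) by rewrite eX; apply: affine_model.
  have EL : E `<=` localization A p.
    rewrite eE => _ [a [b [Aa Ab nb ->]]]; exists a, b; split=> // pb.
    by apply: nb; apply: pq.
  apply: contrapT => ne; have eL : localization A p = F.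
    by apply: maxE => //; split=> // LE; apply: ne; apply/seteqP; split.
  have : maxid (localization A p) c.
    by have : p c := pc; rewrite -{1}(maxid_localizationI hA hp) => -[].
  rewrite eL => -[Fc]; apply; split=> //; split=> //; exact: funfieldV.
have /choice[ab hab] : forall i, exists ab : K * K, [/\ affine iota x (x i) ab.1,
    affine iota x (x i) ab.2, ab.1 != 0, ab.2 != 0 & f = ab.1 / ab.2].
  move=> i; move: Ff; rewrite eX (funfieldE iota x0 i) => -[a [b [Aa Ab /eqP b0 ef]]].
  exists (a, b); split=> //=; by apply: contra_neq f0; rewrite ef => ->; rewrite mul0r.
apply: (@sub_finite_set _ _ (\bigcup_(i in [set: 'I_n.+1])
  [set E | [/\ prime_divisor X E, affine iota x (x i) `<=` E & maxid E ((ab i).1 * (ab i).2)]])).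
  move=> E [hE oE]; have [XE _ _] := hE.
  have XEm : model iota x E by rewrite -eX.
  have [i iE] := model_chart_sub x0 XEm; exists i => //; split=> //.
  have [Aa Ab a0 b0 ef] := hab i; have dE := prime_divisor_dvr hE.
  have hEl := surface_local XE; have [hE' _] := hEl.
  split; first by apply: subringM => //; apply: iE.
  move=> [_ [_ Ei]]; apply: oE; rewrite ef; apply: (ord_unit dE).
  have uab a b : E a -> E b -> a != 0 -> b != 0 -> E (a * b)^-1 -> loc_unit E a.
    move=> Ea Eb a_0 b_0 Eab; split=> //; split=> //.
    have -> : a^-1 = b * (a * b)^-1 by rewrite invfM mulrCA divff // mulr1.
    exact: subringM.
  apply: loc_unitM => //; first by apply: (uab _ _ (iE _ Aa) (iE _ Ab)).
  by apply: loc_unitV; apply: (uab _ _ (iE _ Ab) (iE _ Aa)) => //; rewrite mulrC.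
apply: bigcup_finite; first exact: finite_finset.
move=> i _; have [Aa Ab a0 b0 ef] := hab i; apply: chart_finite.
  by apply: subringM => //; apply/affine_subring/forms_x.
exact: mulf_neq0.
Qed.

End Surfaces.

(** * Symplectic involutions *)

Section Inertia.
Context {R : realType} {K : fieldType} (iota : {rmorphism R[i] -> K}).
Implicit Types (E P : set K) (X : set (set K)) (w : K * K * K).

Lemma eq_form_sym w w' : eq_form iota w w' -> eq_form iota w' w.
Proof. by move=> h d d' hd hd'; rewrite (h d d'). Qed.

Lemma eq_form_trans w w' w'' : eq_form iota w w' -> eq_form iota w' w'' ->
  eq_form iota w w''.
Proof. by move=> h h' d d' hd hd'; rewrite (h d d') // (h' d d'). Qed.

Definition map_form (f : K -> K) w : K * K * K := (f w.1.1, f w.1.2, f w.2).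

Lemma eq_form_map (f g : {rmorphism K -> K}) w w' : cancel f g -> cancel g f ->
  (forall c, f (iota c) = iota c) -> eq_form iota w w' ->
  eq_form iota (map_form f w) (map_form f w').
Proof.
move=> fK gK fc h d d' hd hd'.
have hg e : derivation iota e -> derivation iota (g \o e \o f).
  move=> [eD eM eC]; split=> /=.
  - by move=> a b; rewrite rmorphD eD rmorphD.
  - by move=> a b; rewrite rmorphM eM rmorphD !rmorphM /= !fK.
  - by move=> c; rewrite fc eC rmorph0.
have := h _ _ (hg d hd) (hg d' hd'); rewrite /= => /(congr1 f).
by rewrite /map_form /= !rmorphM !rmorphB !rmorphM /= !gK.
Qed.

Variable X : set (set K).
Hypothesis hX : smooth_projective_surface iota X.
Hypothesis XT : funfield X = setT.

(* If rho fixes the residue field of E, then a |-> (rho a - a) / t is a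
   derivation modulo t, so rho^* w = (1 + (rho t - t) / t) w modulo t.  Hence
   rho t = t modulo t^2, and rho^2 = 1 forces rho = 1. *)
Lemma symplectic_involution_inertia (rho : {rmorphism K -> K}) w E :
  (forall f, rho (rho f) = f) -> (exists f, rho f <> f) ->
  (forall c, rho (iota c) = iota c) ->
  symplectic_form iota X w -> eq_form iota (map_form rho w) w ->
  prime_divisor X E ->
  ~ ((forall a, E a -> E (rho a)) /\ forall a, E a -> maxid E (rho a - a)).
Proof.
move=> rho2 [f0 nf0] rhoc hw rw hE [rE resE].
have [XE _ _] := hE; have dE := prime_divisor_dvr hX hE; rewrite XT in dE.
have [hEs hm] := dvr_local dE; have [m0 mD mM] := hm.
have [t [t0 ht]] := dvr_uniformizer dE; have mt := uniformizer_maxid dE ht.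
have Et := maxid_sub mt.
have [P CP PE] := surface_Cpoint hX XE; have [XP _] := CP.
have [g [u [v [ug huv hwg]]]] := hw P CP.
have hP := surface_local hX XP; have [hPs _] := hP.
have Pu := maxid_sub (parameters_left hP huv).
have Pv := maxid_sub (parameters_left hP (parametersC huv)).
have CE := surface_const hX XE.
have [D1 [D2 [hD1 hD2 [D1u D1v D2u D2v] D1P D2P]]] := dual_derivations hX CP huv.
have DE D : derivation iota D -> (forall a, P a -> P (D a)) -> forall a, E a -> E (D a).
  move=> hD DP a; rewrite {1}(surface_sub_localization hX XP XE PE).
  move=> [b [c [Pb Pc nc ->]]].
  have Ec : E c^-1 by apply: maxid_inv => [|mc]; [exact: PE|apply: nc].
  have c0 : c != 0 by apply: contra_not_neq nc => ->; split=> //; apply: subring0.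
  rewrite (derivation_div _ hD) //; apply: (subringM hEs); last by rewrite -exprVn; apply: subringX.
  by apply: (subringB hEs); apply: (subringM hEs) => //; apply: PE => //; apply: DP.
have D1E := DE D1 hD1 D1P; have D2E := DE D2 hD2 D2P.
pose b a := (rho a - a) / t.
have bE a : E a -> E (b a).
  by move=> Ea; have := resE a Ea; rewrite ht /b => -[c Ec <-]; rewrite mulrC mulKf.
have rhoE a : rho a = a + t * b a by rewrite /b mulrC divfK // addrC subrK.
have [Eu Ev] : E u /\ E v by split; apply: PE.
(* [b] is a derivation up to the term [t * b x * b y]. Subtracting the derivation with the same
   values at [u] and [v] leaves a map that vanishes modulo the maximal ideal of [E]. *)
pose th a := b a - b u * D1 a - b v * D2 a.
have [D1D D1M D1C] := hD1; have [D2D D2M D2C] := hD2.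
have thM x y : E x -> E y -> maxid E (th (x * y) - x * th y - y * th x).
  move=> Ex Ey; have -> : th (x * y) - x * th y - y * th x = (b x * b y) * t.
    have -> : th (x * y) = (x * b y + y * b x + t * b x * b y)
        - b u * (x * D1 y + y * D1 x) - b v * (x * D2 y + y * D2 x).
      rewrite /th D1M D2M; congr (_ - _ - _).
      by rewrite /b rmorphM; field.
    by rewrite /th; ring.
  by apply: (mM) => //; apply: subringM => //; apply: bE.
have thE a : E a -> E (th a).
  move=> Ea; apply: (subringB hEs); first apply: (subringB hEs).
  - exact: bE.
  - by apply: subringM => //; [exact: bE|exact: D1E].
  - by apply: subringM => //; [exact: bE|exact: D2E].
have thP a : P a -> maxid E (th a).
  have [n [x [x0 eX]]] := surface_presents hX; rewrite eX in CP.
  have hN : submodule P (maxid E).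
    by split=> // y z Py mz; apply: mM => //; apply: PE.
  apply: (derivation_submodule x0 CP huv hN).
  - by move=> y z _ _; rewrite /th /b D1D D2D rmorphD; field.
  - by move=> y z Py Pz; apply: thM; apply: PE.
  - by move=> c; rewrite /th /b rhoc D1C D2C; field.
  - by rewrite /th D1u D2u mulr1 mulr0 !subr0 subrr.
  - by rewrite /th D1v D2v mulr1 mulr0 subr0 subrr.
have thm a : E a -> maxid E (th a).
  move=> Ea; move: (Ea); rewrite {1}(surface_sub_localization hX XP XE PE).
  move=> [y [z [Py Pz nz ea]]].
  have Ez : E z^-1 by apply: maxid_inv => [|mz]; [exact: PE|apply: nz].
  have z0 : z != 0 by apply: contra_not_neq nz => ->; split=> //; apply: subring0.
  have ey : y = a * z by rewrite ea divfK.
  have -> : th a = z^-1 * (th y - a * th z - (th (a * z) - a * th z - z * th a)).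
    by rewrite ey; field.
  have Ez' : E z by apply: PE.
  apply: (mM) => //; apply: (submoduleB hEs hm); last exact: thM.
  by apply: (submoduleB hEs hm); [exact: thP|apply: mM => //; exact: thP].
have mbt : maxid E (b t).
  have [[bu ebu] [bv ebv] [bg ebg]] : [/\ exists c, c = b u, exists c, c = b v & exists c, c = b g].
    by split; eexists.
  pose be := bu * D1 t + bv * D2 t.
  have -> : b t = th t + be by rewrite /th /be ebu ebv; ring.
  apply: (mD); first exact: thm.
  have rg : eq_form iota (map_form rho (g, u, v)) (g, u, v).
    apply: (eq_form_trans _ hwg); apply: eq_form_trans rw; apply: eq_form_sym.
    exact: (eq_form_map rho2 rho2 rhoc hwg).
  have := rg D1 D2 hD1 hD2; rewrite /= D1u D1v D2u D2v (rhoE u) (rhoE v) (rhoE g) -ebu -ebv -ebg.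
  rewrite !(D1D, D2D, D1M, D2M) D1u D1v D2u D2v => e.
  have Eg : E g by apply: PE; case: ug => _ [].
  have Eg' : E g^-1 by apply: PE; case: ug => _ [].
  have g0 : g != 0 by case: ug.
  (* The Jacobian of [rho u] and [rho v] with respect to [u] and [v] is [1 + be + t * S]; invariance
     of the form makes it [g / rho g], which is 1 modulo [t], so [t] divides [be]. *)
  pose S := D1 bu * (1 + t * D2 bv + bv * D2 t) + D2 bv * (1 + bu * D1 t)
     - D2 bu * (t * D1 bv + bv * D1 t) - bu * D2 t * D1 bv.
  have -> : be = - (g^-1 * (bg * (1 + be + t * S) + g * S)) * t.
    apply: (mulfI g0).
    have -> : g * (- (g^-1 * (bg * (1 + be + t * S) + g * S)) * t) =
       g * (1 + be) - (g + t * bg) * (1 + be + t * S) by field.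
    have -> : (g + t * bg) * (1 + be + t * S) = g.
      transitivity (g * (1 * 1 - 0 * 0)); last by ring.
      rewrite -e /S /be.
      by ring.
    by ring.
  have Ebu : E bu by rewrite ebu; apply: bE.
  have Ebv : E bv by rewrite ebv; apply: bE.
  have Ebg : E bg by rewrite ebg; apply: bE.
  have Ebe : E be by apply: (subringD hEs); apply: subringM => //; [exact: D1E|exact: D2E].
  have ES : E S.
    have E1 := subring1 hEs.
    have := D1E _ Ebu; have := D2E _ Ebu; have := D1E _ Ebv; have := D2E _ Ebv.
    have := D1E _ Et; have := D2E _ Et => ? ? ? ? ? ?.
    by rewrite /S; do ![apply: (subringB hEs)|apply: (subringD hEs)|apply: (subringM hEs)].
  apply: (mM) => //; apply: (subringN hEs); apply: (subringM hEs) => //.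
  apply: (subringD hEs); last exact: subringM.
  apply: (subringM hEs) => //.
  by apply: (subringD hEs); [apply: subringD => //; apply: subring1|apply: subringM].
have unit2 : loc_unit E 2.
  have -> : (2 : K) = iota 2%:R by rewrite rmorph_nat.
  split; first by rewrite fmorph_eq0 pnatr_eq0.
  by rewrite -fmorphV; split; apply: CE; [exists 2%:R|exists 2%:R^-1].
(* If [rho a - a = t ^+ n * c], applying [rho] changes the sign of the left side, while
   [rho t = t * (1 + b t)]. So [rho c] is [- c] modulo the maximal ideal; it is also [c], hence
   [2 * c] and then [c] lie in that ideal. *)
have deep n : forall a, E a -> principal (t ^+ n) E (rho a - a).
  elim: n => [|n IH] a Ea.
    by exists (rho a - a); rewrite ?mul1r //; apply: (subringB hEs) => //; apply: rE.
  have [c Ec ec] := IH a Ea.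
  have [Ebt Erc] : E (b t) /\ E (rho c) by split; [exact: bE|exact: rE].
  have e1 : (1 + b t) ^+ n * rho c = - c.
    apply: (mulfI (expf_neq0 n t0)); rewrite mulrA -exprMn.
    have -> : t * (1 + b t) = rho t by rewrite [RHS]rhoE; ring.
    by rewrite -rmorphXn -rmorphM ec rmorphB rho2 mulrN ec opprB.
  have [k Ek ek] : exists2 k, E k & (1 + b t) ^+ n = 1 + b t * k.
    exists (\sum_(i < n) (1 + b t) ^+ i).
      apply: subring_sum => // i _; apply: subringX => //.
      by apply: subringD => //; apply: subring1.
    by rewrite -[LHS](subrK 1) subrX1 [1 + b t - 1]addrAC subrr add0r addrC.
  have mc : maxid E c.
    have [u20 [_ E2]] := unit2.
    have -> : c = 2^-1 * (- (rho c - c) + - (k * rho c * b t)).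
      have e2 : c = - ((1 + b t * k) * rho c) by rewrite -ek e1 opprK.
      apply: (mulfI u20); rewrite mulVKf //.
      have -> : 2 * c = c + - ((1 + b t * k) * rho c) by rewrite -e2; ring.
      by ring.
    apply: (mM) => //; apply: (mD); apply: (submoduleN hEs hm); first exact: resE.
    by apply: (mM) => //; apply: subringM.
  have [d Ed ed] : principal t E c by rewrite -[principal t E]ht.
  by exists d => //; rewrite -ec exprSr -mulrA ed.
have rid a : E a -> rho a = a.
  move=> Ea; apply/eqP; rewrite -subr_eq0; apply/eqP; apply: contrapT => /eqP z0.
  have [e ue ez] := ord_uniformizer dE ht (I : [set: K] (rho a - a)) z0.
  have : 0 <= ord E (rho a - a).
    by apply/(ord_mem dE I z0); apply: (subringB hEs) => //; apply: rE.
  move: ez; case: (ord E (rho a - a)) => // k ez _.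
  have [c Ec ec] := deep k.+1 a Ea; have [e0 _] := ue.
  have ee : e = c * t.
    by apply: (mulfI (expf_neq0 k t0)); rewrite {1}exprnP -ez -ec exprSr; ring.
  by have [_ []] : maxid E e by rewrite ee; apply: mM.
apply: nf0; have [f_0|f_0] := eqVneq f0 0; first by rewrite f_0 rmorph0.
have [|Ef] := dvr_valuation dE (I : [set: K] f0) f_0; first exact: rid.
by apply: (invr_inj); rewrite -fmorphV rid.
Qed.

End Inertia.

(** * Approximation and invariant uniformizers *)

Section Approximation.
Context {R : realType} {K : fieldType} (iota : {rmorphism R[i] -> K}).
Implicit Types (E V W : set K).

Local Notation consts := (range iota).

Lemma dvr_setT_not E : dvr [set: K] E -> exists f, ~ E f.
Proof.
move=> hE; have [t [t0 ht]] := dvr_uniformizer hE; have [Et nu] := uniformizer_maxid hE ht.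
by exists t^-1 => Et'; apply: nu.
Qed.

Lemma dvr_separate E V : dvr [set: K] E -> dvr [set: K] V -> E <> V ->
  exists2 a, E a & ~ V a.
Proof.
move=> hE hV ne; apply: contrapT => h.
have EV : E `<=` V by move=> a Ea; apply: contrapT => nV; apply: h; exists a.
have [f Vf nf] : exists2 f, V f & ~ E f.
  apply: contrapT => h'; apply: ne; apply/seteqP; split=> // f Vf.
  by apply: contrapT => nf; apply: h'; exists f.
have [f' nf'] := dvr_setT_not hV; apply: nf'.
exact: (dvr_maximal hE (dvr_subring hV) EV Vf I nf).
Qed.

(** With [a] in [E] but not in [V] and [b] in [V] but not in [E], the element is [b / (a + b)]. *)
Lemma approx_pair E V : dvr [set: K] E -> dvr [set: K] V -> E <> V ->
  exists c, maxid E (c - 1) /\ maxid V c.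
Proof.
move=> hE hV ne; have [a Ea na] := dvr_separate hE hV ne.
have [b Vb nb] := dvr_separate hV hE (nesym ne).
have [hEs [m0 mD mM]] := dvr_local hE; have [hVs [n0 nD nM]] := dvr_local hV.
have a0 : a != 0 by apply: contra_not_neq na => ->; apply: subring0.
have b0 : b != 0 by apply: contra_not_neq nb => ->; apply: subring0.
have mb := dvr_inv_mem hE I b0 nb; have ma := dvr_inv_mem hV I a0 na.
have my : maxid E (a / b) by apply: mM.
have my' : maxid V (b / a) by apply: nM.
have [u0 [Eu Eu']] := loc_unit_addm (dvr_local hE) (loc_unit1 hEs) my.
have [w0 [Vw Vw']] := loc_unit_addm (dvr_local hV) (loc_unit1 hVs) my'.
exists (1 + a / b)^-1; split.
  have -> : (1 + a / b)^-1 - 1 = - (1 + a / b)^-1 * (a / b).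
    by apply: (mulfI u0); rewrite mulrBr mulfV // mulNr mulrN mulVKf //; ring.
  by apply: mM => //; apply: subringN.
have -> : (1 + a / b)^-1 = (1 + b / a)^-1 * (b / a).
  apply: (mulfI u0); rewrite mulfV //; apply: (mulfI w0).
  by rewrite mulr1 mulrCA mulVKf //; field; rewrite a0 b0.
exact: nM.
Qed.

(* phi(c) = (2 + l) c / (c^2 + l c + 1) fixes 1 and kills 0 and infinity; it is
   integral at V for all but at most one value of l. *)
Lemma approx_integral_one E V c : dvr [set: K] V -> consts `<=` V ->
  exists k : nat, forall l : nat, (k < l)%N ->
    let phi := (2 + l%:R) * c / (c ^+ 2 + l%:R * c + 1) in
    V phi /\ (maxid V c -> maxid V phi).
Proof.
move=> hV CV; have [hVs [n0 nD nM]] := dvr_local hV; have hVl := dvr_local hV.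
have nat_const (l : nat) : V l%:R by apply: CV; exists l%:R; rewrite ?rmorph_nat.
have nat_unit (l : nat) : (0 < l)%N -> loc_unit V l%:R.
  move=> l0; have e : (l%:R : K) = iota l%:R by rewrite rmorph_nat.
  split; first by rewrite e fmorph_eq0 pnatr_eq0 -lt0n.
  by split=> //; rewrite e -fmorphV; apply: CV; exists l%:R^-1.
pose den (l : nat) := c ^+ 2 + l%:R * c + 1.
have [Vc|nc] := pselect (V c); last first.
  have c0 : c != 0 by apply: contra_not_neq nc => ->; apply: subring0.
  have mc := dvr_inv_mem hV I c0 nc; have Vc' := maxid_sub mc.
  exists 0%N => l _; have u : loc_unit V (1 + (l%:R + c^-1) * c^-1).
    apply: loc_unit_addm => //; first exact: loc_unit1.
    by apply: nM => //; apply: subringD.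
  have [u0 [Vu Vu']] := u; split; last by case.
  have -> : (2 + l%:R) * c / (c ^+ 2 + l%:R * c + 1) =
      (2 + l%:R) * c^-1 / (1 + (l%:R + c^-1) * c^-1).
    have e : c ^+ 2 + l%:R * c + 1 = c ^+ 2 * (1 + (l%:R + c^-1) * c^-1) by field.
    by rewrite e; set w := 1 + _ in u0 *; field; rewrite u0 c0.
  by apply: subringM => //; apply: subringM => //; apply: subringD => //; apply: (nat_const 2).
have denV l : V (den l).
  apply: (subringD hVs); last exact: subring1.
  by apply: (subringD hVs); [exact: subringX|exact: subringM].
have [k hk] : exists k : nat, forall l : nat, (k < l)%N -> loc_unit V (den l).
  have [[k mk]|h] := pselect (exists k, maxid V (den k)); last first.
    by exists 0%N => l _; apply: loc_unitP => // ml; apply: h; exists l.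
  exists k => l kl; apply: loc_unitP => // ml.
  have : maxid V (den l - den k) by apply: (submoduleB hVs hVl.2).
  have -> : den l - den k = (l - k)%:R * c.
    by rewrite /den natrB ?(ltnW kl) //; ring.
  have [d0 [_ Vd]] := nat_unit (l - k)%N (ltac:(by rewrite subn_gt0)).
  move=> /(nM _ _ Vd); rewrite mulKf // => mc.
  apply: (maxidN1 hVs); have -> : 1 = den k - (c + k%:R) * c by rewrite /den; ring.
  by apply: (submoduleB hVs hVl.2) => //; apply: nM => //; apply: subringD.
exists k => l /hk [d0 [_ Vd]].
have V2 : V (2 + l%:R) by apply: subringD => //; apply: (nat_const 2).
split; first by apply: (subringM hVs) => //; apply: (subringM hVs).
by move=> mc; rewrite mulrC; apply: (nM) => //; apply: nM.
Qed.

(** Weak approximation: for a single [V j], the element of [approx_pair] is made integral everywhere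
    by [approx_integral_one], with one large [l] for all [V i]; the product over [j] then serves all
    of them. *)
Lemma approximation (I : finType) E (V : I -> set K) : dvr [set: K] E -> consts `<=` E ->
  (forall i, dvr [set: K] (V i)) -> (forall i, consts `<=` V i) ->
  exists c, maxid E (c - 1) /\ forall i, V i c /\ (V i <> E -> maxid (V i) c).
Proof.
move=> hE CE hV CV; have [hEs [m0 mD mM]] := dvr_local hE; have hEl := dvr_local hE.
have one j : V j <> E -> exists c, [/\ maxid E (c - 1), maxid (V j) c & forall i, V i c].
  move=> ne; have [c [mc mVc]] := approx_pair hE (hV j) (nesym ne).
  have /choice[k hk] := fun i => approx_integral_one E c (hV i) (CV i).
  pose l := (\max_i k i).+1.
  have kl i : (k i < l)%N by rewrite ltnS; apply: leq_bigmax.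
  have Ec : E c by rewrite -[c](subrK 1); apply: subringD => //; [exact: maxid_sub|exact: subring1].
  have El : E l%:R by apply: CE; exists l%:R; rewrite ?rmorph_nat.
  have u : loc_unit E (c ^+ 2 + l%:R * c + 1).
    (* The denominator is congruent at [E] to the nonzero constant [l + 2], because [c] is congruent
       to 1. *)
    have -> : c ^+ 2 + l%:R * c + 1 = l.+2%:R + (c + l%:R + 1) * (c - 1).
      by have -> : l.+2%:R = l%:R + 2 :> K; [rewrite -natrD addn2|ring].
    apply: loc_unit_addm => //.
      have e : (l.+2%:R : K) = iota l.+2%:R by rewrite rmorph_nat.
      split; first by rewrite e fmorph_eq0 pnatr_eq0.
      by rewrite e -fmorphV; split; apply: CE; [exists l.+2%:R|exists l.+2%:R^-1].
    by apply: mM => //; do 2?apply: subringD => //; apply: subring1.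
  exists ((2 + l%:R) * c / (c ^+ 2 + l%:R * c + 1)); split.
  - have [u0 [_ Eu]] := u.
    have -> : (2 + l%:R) * c / (c ^+ 2 + l%:R * c + 1) - 1 =
      - (c ^+ 2 + l%:R * c + 1)^-1 * (c - 1) * (c - 1) by field.
    apply: (mM) => //; apply: subringM => //; [exact: subringN|exact: maxid_sub].
  - by have [_] := hk j l (kl j); apply.
  - by move=> i; have [] := hk i l (kl i).
have /choice[c hc] : forall j, exists c, [/\ maxid E (c - 1), forall i, V i c
    & V j <> E -> maxid (V j) c].
  move=> j; have [e|/one[c [h1 h2 h3]]] := pselect (V j = E); last by exists c.
  exists 1; split=> //; first by rewrite subrr.
  by move=> i; apply: subring1; apply: dvr_subring (hV i).
exists (\prod_j c j); split.
  have Ec j : E (c j).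
    by have [h _ _] := hc j; rewrite -[c j](subrK 1); apply: subringD => //;
      [exact: maxid_sub|exact: subring1].
  elim/big_rec: _ => [|j y _ IH]; first by rewrite subrr.
  have -> : c j * y - 1 = c j * (y - 1) + (c j - 1) by ring.
  by apply: mD; [exact: mM|case: (hc j)].
move=> i; have hVs := dvr_subring (hV i); split.
  by apply: subring_prod => // j _; case: (hc j).
move=> ne; have [_ [_ _ nM]] := dvr_local (hV i).
rewrite (bigD1 i) //= mulrC; apply: nM; last by have [_ _] := hc i; apply.
by apply: subring_prod => // j _; case: (hc j).
Qed.

End Approximation.

Section Dedekind.
Context {K : fieldType}.
Implicit Types (E : set K).

(** Dedekind's independence of characters on a residue field: replacing [a] by [b * a] and
    subtracting [s j b] times the relation eliminates [s j], and multiplies [c0] by the unit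
    [b - s j b]. *)
Lemma character_independence E (s : nat -> K -> K) (r : seq nat) (c0 : K) (c : nat -> K) :
  local_ring E -> E c0 ->
  (forall i, i \in r -> [/\ E (c i), forall a, E a -> E (s i a),
     forall a b, E a -> E b -> s i (a * b) = s i a * s i b
     & exists2 b, E b & loc_unit E (b - s i b)]) ->
  (forall a, E a -> maxid E (c0 * a + \sum_(i <- r) c i * s i a)) -> maxid E c0.
Proof.
move=> hE; have [hEs hm] := hE; have [m0 mD mM] := hm.
elim: r c0 c => [|j r IH] c0 c Ec0 hr h.
  by have := h 1 (subring1 hEs); rewrite big_nil mulr1 addr0.
have [Ecj Esj sMj [b Eb ub]] := hr j (mem_head _ _).
have hr' i : i \in r -> [/\ E (c i), forall a, E a -> E (s i a),
     forall a b, E a -> E b -> s i (a * b) = s i a * s i b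
     & exists2 b, E b & loc_unit E (b - s i b)].
  by move=> ir; apply: hr; rewrite inE ir orbT.
have [u0 [Eu Eu']] := ub.
have : maxid E (c0 * (b - s j b)).
  apply: (IH _ (fun i => c i * (s i b - s j b))); first exact: subringM.
    move=> i ir; have [Eci Esi sMi exb] := hr' i ir; split=> //.
    by apply: subringM => //; apply: subringB => //; [exact: Esi|exact: Esj].
  move=> a Ea.
  have -> : c0 * (b - s j b) * a + \sum_(i <- r) c i * (s i b - s j b) * s i a =
     (c0 * (b * a) + \sum_(i <- j :: r) c i * s i (b * a)) -
     s j b * (c0 * a + \sum_(i <- j :: r) c i * s i a).
    rewrite !big_cons sMj //.
    have -> : \sum_(i <- r) c i * s i (b * a) = \sum_(i <- r) c i * (s i b - s j b) * s i a
       + s j b * \sum_(i <- r) c i * s i a.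
      rewrite mulr_sumr -big_split /= big_seq [RHS]big_seq; apply: eq_bigr => i ir.
      by have [_ _ sMi _] := hr' i ir; rewrite sMi //; ring.
    by ring.
  apply: (submoduleB hEs hm); first by apply: h; apply: subringM.
  by apply: (mM); [exact: Esj|exact: h].
by move=> mc; rewrite -[c0](mulfK u0) mulrC; apply: mM.
Qed.

End Dedekind.

Section Preimage.
Context {K : fieldType}.
Implicit Types (E O P : set K) (s : {rmorphism K -> K}).

Lemma loc_unit_preimage s E a : loc_unit (s @^-1` E) a <-> loc_unit E (s a).
Proof. by rewrite /loc_unit /= fmorph_eq0 fmorphV. Qed.

Lemma maxid_preimage s E : maxid (s @^-1` E) = s @^-1` maxid E.
Proof.
apply/seteqP; split=> a [Ea nu]; split=> //.
  by move=> u; apply: nu; apply: (loc_unit_preimage s E a).2.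
by move=> u; apply: nu; apply: (loc_unit_preimage s E a).1.
Qed.

Lemma subring_preimage s O : is_subring O -> is_subring (s @^-1` O).
Proof.
move=> hO; split=> [|a b Oa Ob] /=; first by rewrite rmorph1; apply: subring1.
by rewrite rmorphB rmorphM; split; [exact: subringB|exact: subringM].
Qed.

Lemma local_preimage s O : local_ring O -> local_ring (s @^-1` O).
Proof.
move=> [hO [m0 mD mM]]; split; first exact: subring_preimage.
rewrite maxid_preimage; split=> [|a b ma mb|a b Oa mb] /=.
- by rewrite rmorph0.
- by rewrite rmorphD; apply: mD.
- by rewrite rmorphM; apply: mM.
Qed.

Lemma dvr_preimage s E : bijective s -> dvr setT E -> dvr setT (s @^-1` E).
Proof.
move=> [s' sK s'K] hE; split=> //; first exact/local_preimage/(dvr_local hE).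
have [_ _ [t [t0 ht tot]]] := hE; exists (s' t); split.
- by rewrite -(fmorph_eq0 s) s'K.
- rewrite maxid_preimage; apply/seteqP; split=> a /=.
    rewrite ht => -[b Eb eb]; exists (s' b); rewrite /= ?s'K //.
    by apply: (fmorph_inj s); rewrite rmorphM !s'K.
  by move=> [b Eb <-]; rewrite rmorphM s'K ht; exists (s b).
- move=> f _ f0; have [|n [e [ue ef]]] := tot (s f) I; first by rewrite fmorph_eq0.
  exists n, (s' e); split; first by apply/loc_unit_preimage; rewrite s'K.
  by apply: (fmorph_inj s); rewrite rmorphM fmorphXz !s'K.
Qed.

Lemma ord_principal E t f (n : nat) : dvr setT E -> maxid E = principal t E ->
  (f != 0 -> n%:Z <= ord E f) -> principal (t ^+ n) E f.
Proof.
move=> hE ht; have hEs := dvr_subring hE; have [->|f0] := eqVneq f 0.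
  by exists 0; rewrite ?mulr0 //; apply: subring0.
move=> /(_ isT) h; have [e ue ef] := ord_uniformizer hE ht (I : setT f) f0.
have [k ek] : exists k : nat, ord E f = n%:Z + k%:Z.
  by exists `|ord E f - n%:Z|%N; move: h; lia.
exists (t ^+ k * e); last by rewrite mulrA -exprD exprnP PoszD -ek.
apply: subringM => //; last by case: ue => _ [].
by apply: subringX => //; apply: maxid_sub; apply: (uniformizer_maxid hE).
Qed.

End Preimage.

(** * Powers of tau, invariant uniformizers and Hilbert 90 *)

Section Automorphism.
Context {R : realType} {K : fieldType} (iota : {rmorphism R[i] -> K}).
Context (tau : {rmorphism K -> K}).
Implicit Types (E O P : set K).

Local Notation consts := (range iota).

(** The iterates are bundled as ring morphisms, so that local rings and valuations can be pulled
    back along each of them. *)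
Fixpoint pw n : {rmorphism K -> K} := if n is m.+1 then tau \o pw m else idfun.

Lemma pwE n f : pw n f = iter n tau f.
Proof. by elim: n => [//|n IH] /=; rewrite IH. Qed.

Lemma pwD m n f : pw (m + n) f = pw m (pw n f).
Proof. by rewrite !pwE iterD. Qed.

Lemma pwS n f : pw n.+1 f = pw n (tau f).
Proof. by rewrite !pwE iterSr. Qed.

Lemma pw_fix n f : tau f = f -> pw n f = f.
Proof. by move=> h; elim: n => [//|n IH] /=; rewrite IH. Qed.

Lemma pw_const n c : (forall c, tau (iota c) = iota c) -> pw n (iota c) = iota c.
Proof. by move=> h; apply: pw_fix. Qed.

Lemma pw_preimage_const n E : (forall c, tau (iota c) = iota c) -> consts `<=` E ->
  consts `<=` pw n @^-1` E.
Proof. by move=> tc CE _ [c _ <-] /=; rewrite pw_const //; apply: CE; exists c. Qed.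

Hypothesis tau4 : forall f, iter 4 tau f = f.

Lemma pw4 f : pw 4 f = f. Proof. by rewrite pwE tau4. Qed.

Lemma pw_mod n f : pw n f = pw (n %% 4) f.
Proof.
rewrite {1}(divn_eq n 4) addnC pwD; congr (pw _ _).
by elim: (n %/ 4)%N => [//|k IH]; rewrite mulSn pwD IH pw4.
Qed.

Lemma tau_bij : bijective tau.
Proof. by exists (pw 3) => f; [rewrite -pwS pw4|exact: pw4]. Qed.

Lemma pw_bij n : bijective (pw n).
Proof.
exists (pw (3 * n)) => f; rewrite -pwD pw_mod.
  by rewrite -[(_ + n)%N]addnC -mulSn modnMr.
by rewrite -mulSn modnMr.
Qed.

(* If every sigma^i preserving E moves some residue class, then by Artin-Dedekind
   the trace maps onto the residue field of an orbit, so E is unramified. *)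
Lemma invariant_uniformizer E : (forall c, tau (iota c) = iota c) ->
  dvr setT E -> consts `<=` E ->
  ~ ((forall a, E a -> E (tau (tau a))) /\ forall a, E a -> maxid E (tau (tau a) - a)) ->
  exists t, [/\ tau t = t, t != 0 & maxid E = principal t E].
Proof.
move=> tc hE CE inert; apply: contrapT => nt.
have hEl := dvr_local hE; have [hEs hm] := hEl; have [m0 mD mM] := hm.
have [p [p0 hp]] := dvr_uniformizer hE; have mp := uniformizer_maxid hE hp.
have Ep := maxid_sub mp.
pose V (i : 'I_4) := pw i @^-1` E.
have hV i : dvr setT (V i) by apply: dvr_preimage => //; apply: pw_bij.
have CV i : consts `<=` V i by apply: pw_preimage_const.
have [c [mc1 hc]] := approximation hE CE hV CV.
(* [G] is the decomposition group of [E]. The element [c] is congruent to 1 at [E], and its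
   conjugates by elements outside [G] lie in the maximal ideal. *)
pose G i := `[< pw i @^-1` E = E >].
have hc' i : (i < 4)%N -> ~~ G i -> maxid E (pw i c).
  move=> i4 /asboolPn nG; have [_ h] := hc (Ordinal i4).
  by have := h nG; rewrite /V maxid_preimage.
have Ec : E c by rewrite -[c](subrK 1); apply: subringD => //; [exact: maxid_sub|exact: subring1].
have GE i a : G i -> E a -> E (pw i a).
  by move=> /asboolP e; rewrite -{1}e.
have Gm i a : G i -> maxid E a -> maxid E (pw i a).
  by move=> /asboolP e; rewrite -{1}e maxid_preimage.
have h2 := principal_submodule (p ^+ 2) hEs; have [s0 sD sM] := h2.
have sub2 : principal (p ^+ 2) E `<=` maxid E.
  by move=> _ [a Ea <-]; rewrite expr2 mulrAC; apply: mM => //; apply: subringM.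
have mm a b : maxid E a -> maxid E b -> principal (p ^+ 2) E (a * b).
  by rewrite hp => -[x Ex <-] [y Ey <-]; exists (x * y); [exact: subringM|rewrite expr2; ring].
(* An invariant of order one would be an invariant uniformizer. *)
have sq f : tau f = f -> maxid E f -> principal (p ^+ 2) E f.
  move=> tf mf; apply: (ord_principal hE hp) => f0.
  have h : 0 < ord E f by apply/(ord_maxid hE I f0).
  have [e1|e1] := eqVneq (ord E f) 1; last by move: h e1; lia.
  case: nt; exists f; split=> //.
  have [e [e0 [Ee Ee']] ef] := ord_uniformizer hE hp (I : setT f) f0.
  rewrite e1 expr1z in ef; rewrite hp; apply/seteqP; split=> _ [a Ea <-].
    by exists (e^-1 * a); [exact: subringM|rewrite ef; field].
  by exists (e * a); [exact: subringM|rewrite ef mulrA].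
pose r := [:: 0; 1; 2; 3]%N.
have r4 i : i \in r -> (i < 4)%N by rewrite !inE => /or4P[] /eqP ->.
have key x : maxid E x -> principal (p ^+ 2) E (\sum_(i <- r | G i) pw i x).
  (* The power [c ^+ N] lifts the conjugates of [x] outside [G] to order at least 2 and does not
     change [x] modulo [p ^+ 2]. The full trace of [y] is invariant, so it has order at least 2, and
     so does its part over [G]. *)
  move=> mx; pose N := (\max_(i < 4) `|2 - ord E (pw i x)|)%N.
  pose y := c ^+ N * x.
  have my : maxid E y by apply: mM => //; apply: subringX.
  have offG i : i \in r -> ~~ G i -> principal (p ^+ 2) E (pw i y).
    move=> /r4 i4 nG; apply: (ord_principal hE hp) => y0.
    have x0 : pw i x != 0 by apply: contra_neq y0; rewrite rmorphM => ->; rewrite mulr0.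
    have [cN0|cN0] := eqVneq (pw i c ^+ N) 0.
      by rewrite rmorphM rmorphXn cN0 mul0r eqxx in y0.
    have leN : (`|2 - ord E (pw i x)| <= N)%N.
      exact: (@leq_bigmax _ (fun i : 'I_4 => `|2 - ord E (pw i x)|%N) (Ordinal i4)).
    rewrite rmorphM rmorphXn (ordM hE) //.
    have [c0|c0] := eqVneq (pw i c) 0.
      have N0 : N = 0%N by apply/eqP; apply: contraNT cN0 => N0; rewrite c0 expr0n (negPf N0).
      by rewrite N0 expr0 (ord1 hE) add0r; move: leN; rewrite N0; lia.
    rewrite (ordX hE) //; have : 0 < ord E (pw i c) by apply/(ord_maxid hE I c0)/hc'.
    move: leN; move: (ord E (pw i c)) (ord E (pw i x)) => oc ox le oc0.
    have : N%:Z <= oc *+ N by rewrite -mulr_natr natz ler_peMl //; lia.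
    by move: le; lia.
  have Ty : tau (\sum_(i <- r) pw i y) = \sum_(i <- r) pw i y.
    rewrite rmorph_sum !big_cons !big_nil.
    have -> : tau (pw 3 y) = y by exact: pw4.
    by rewrite /=; ring.
  have mTy : maxid E (\sum_(i <- r) pw i y).
    rewrite big_seq; apply: submodule_sum hm _ => i ir.
    have [Gi|nG] := boolP (G i); first exact: Gm.
    by apply: sub2; apply: offG.
  have GTy : principal (p ^+ 2) E (\sum_(i <- r | G i) pw i y).
    have := sq _ Ty mTy; rewrite (bigID G) /= => h.
    rewrite -[X in principal _ _ X](addrK (\sum_(i <- r | ~~ G i) pw i y)).
    apply: (submoduleB hEs h2) => //.
    rewrite big_seq_cond; apply: submodule_sum h2 _ => i /andP[ir nG]; exact: offG.
  have -> : \sum_(i <- r | G i) pw i x =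
     \sum_(i <- r | G i) pw i y - \sum_(i <- r | G i) pw i (y - x).
    by rewrite -sumrB; apply: eq_bigr => i _; rewrite rmorphB; ring.
  apply: (submoduleB hEs h2) => //; apply: submodule_sum h2 _ => i Gi.
  have -> : y - x = (c ^+ N - 1) * x by rewrite /y; ring.
  rewrite rmorphM; apply: mm; apply: Gm => //.
  rewrite -(expr1n _ N) subrXX mulrC; apply: mM => //.
  by apply: subring_sum => // j _; apply: subringM => //; apply: subringX => //; apply: subring1.
(* Dividing by [p] the trace of [p * a] over [G] gives a relation between characters of the residue
   field in which the identity has coefficient 1. *)
pose chi i := pw i p / p.
have chiE i : G i -> E (chi i).
  by move=> Gi; have := Gm i p Gi mp; rewrite hp /chi => -[a Ea <-]; rewrite mulrC mulKf.
pose r' := [seq i <- [:: 1; 2; 3]%N | G i].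
apply: (maxidN1 hEs).
apply: (@character_independence _ E (fun i => pw i) r' 1 chi hEl (subring1 hEs)).
- move=> i; rewrite mem_filter => /andP[Gi ir]; split.
  + exact: chiE.
  + by move=> a; apply: GE.
  + by move=> a b _ _; rewrite rmorphM.
  apply: contrapT => nb; have triv b : E b -> maxid E (pw i b - b).
    move=> Eb; have Ed : E (b - pw i b) by apply: (subringB hEs) => //; apply: GE.
    rewrite -opprB; apply: (submoduleN hEs hm); split=> // u; apply: nb; by exists b.
  (* [tau \o tau] is a power of each of the three candidates, so it would act trivially with any of
     them. *)
  apply: inert; move: ir; rewrite !inE => /or3P[] /eqP ei; rewrite ei in Gi triv.
  + split=> a Ea; first by apply: (GE 1%N) => //; apply: (GE 1%N).
    have -> : tau (tau a) - a = (pw 1 (pw 1 a) - pw 1 a) + (pw 1 a - a) by rewrite /=; ring.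
    by apply: mD; apply: triv => //; apply: GE.
  + by split=> a Ea; [apply: (GE 2%N)|apply: triv].
  + have e6 a : pw 3 (pw 3 a) = tau (tau a) by rewrite -pwD pw_mod.
    split=> a Ea; first by rewrite -e6; apply: (GE 3%N) => //; apply: (GE 3%N).
    have -> : tau (tau a) - a = (pw 3 (pw 3 a) - pw 3 a) + (pw 3 a - a) by rewrite e6; ring.
    by apply: mD; apply: triv => //; apply: GE.
move=> a Ea; have [b Eb eb] := key (p * a) (eq_ind_r (fun A => A (p * a)) (ex_intro2 _ _ a Ea erefl) hp).
have G0 : G 0%N by apply/asboolP.
rewrite hp; exists b => //; apply: (mulfI p0); rewrite mulrA -expr2 eb.
rewrite /r big_cons G0 /= mulrDr mul1r; congr (_ + _).
rewrite /r' big_filter mulr_sumr; apply: eq_bigr => i Gi.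
by rewrite rmorphM mulrA; congr (_ * _); rewrite /chi mulrCA mulfV // mulr1.
Qed.

(** The map [g * tau f] has order dividing 4, so the sum of its four iterates at any [a] is fixed.
    It is nonzero for some [a] by [character_independence], applied to [K] as a local ring with zero
    maximal ideal. *)
Lemma hilbert90 g : (exists f, iter 2 tau f <> f) -> g != 0 ->
  (forall f, iter 4 (fun f => g * tau f) f = f) ->
  exists2 h, h != 0 & g * tau h = h.
Proof.
move=> [f0 nf0] g0 g4; pose T f := g * tau f; apply: contrapT => nh.
have hT : is_subring [set: K] by split.
have maxT a : maxid [set: K] a -> a = 0.
  by move=> [_ nu]; apply/eqP/negPn/negP => a0; apply: nu.
have lT : local_ring [set: K].
  split=> //; split.
  - by split=> // -[]; rewrite eqxx.
  - by move=> a b /maxT -> /maxT ->; rewrite addr0; split=> // -[]; rewrite eqxx.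
  - by move=> a b _ /maxT ->; rewrite mulr0; split=> // -[]; rewrite eqxx.
apply: (maxidN1 hT).
pose c i := nth 0 [:: 1; g; g * tau g; g * tau g * tau (tau g)] i.
apply: (@character_independence _ [set: K] (fun i => pw i) [:: 1; 2; 3]%N 1 c lT I).
- move=> i ir; split=> //; first by move=> a b _ _; rewrite rmorphM.
  apply: contrapT => nb; have triv b : pw i b = b.
    apply/eqP; rewrite -subr_eq0 -opprB oppr_eq0; apply/negPn/negP => h.
    by apply: nb; exists b.
  apply: nf0; rewrite -pwE; move: ir; rewrite !inE => /or3P[] /eqP ei; rewrite ei in triv.
  + by rewrite (pwD 1 1) !triv.
  + exact: triv.
  + by rewrite -(pw_mod 6) (pwD 3 3) !triv.
move=> a _; rewrite !big_cons big_nil /= mul1r addr0.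
have -> : g * tau a + (g * tau g * tau (tau a) + g * tau g * tau (tau g) * tau (tau (tau a)))
   = T a + (T (T a) + T (T (T a))) by rewrite /T !rmorphM; ring.
have h : T (a + (T a + (T (T a) + T (T (T a))))) = a + (T a + (T (T a) + T (T (T a)))).
  have TD x y : T (x + y) = T x + T y by rewrite /T rmorphD mulrDr.
  by rewrite !TD [T (T (T (T a)))](g4 a); ring.
split=> // -[z0 _]; apply: nh; exists (a + (T a + (T (T a) + T (T (T a))))) => //.
Qed.

End Automorphism.

(** * Divisors of the quotient and of its resolution *)

Section LinearForms.
Context {R : realType} {K : fieldType} (iota : {rmorphism R[i] -> K}).
Variables (n : nat) (x : 'I_n.+1 -> K).
Hypothesis x_neq0 : forall i, x i != 0.
Implicit Types (P O : set K).

Local Notation X := (model iota x).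

(** The coefficients are powers of [k], so at a given point vanishing is a polynomial condition of
    degree at most [n] on [k]. *)
Definition lform (k : nat) : K := \sum_(j < n.+1) k%:R ^+ j * x j.

Definition nonvanishing O k : Prop := lform k != 0 /\ forall j, O (x j / lform k).

Lemma forms_lform k : forms iota x 1 (lform k).
Proof.
have h := forms_submodule iota x 1; have [_ _ hM] := h.
apply: submodule_sum h _ => j _; apply: hM; last exact: forms_x.
by exists (k%:R ^+ j); rewrite ?rmorphXn ?rmorph_nat.
Qed.

Lemma affine_sub O z : is_subring O -> range iota `<=` O -> z != 0 ->
  (forall j, O (x j / z)) -> affine iota x z `<=` O.
Proof.
move=> hO CO z0 xO f [d]; rewrite -{2}[f](mulfK (expf_neq0 d z0)).
move: (f * _) => y {f} fd; pose M := [set y | O (y / z ^+ d)].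
apply: (@span_sub _ _ M) fd; rewrite /M /=.
- by rewrite mul0r; apply: subring0.
- by move=> a b; rewrite mulrDl; apply: subringD.
- move=> a m Ca hm; rewrite -mulrA; apply: subringM => //; first exact: CO.
  elim: d m hm {M} => [|d IH] m /=.
    by rewrite inE => /eqP ->; rewrite mul1r invr1; apply: subring1.
  move=> /allpairsP[[j m'] /= [_ hm ->]].
  by rewrite exprS -mulf_div; apply: subringM => //; apply: IH.
Qed.

(** Each point excludes at most [n] values of [k]. The bound does not depend on the points, so a
    fixed finite list of hyperplanes serves every set of [m] points. *)
Lemma exists_nonvanishing m (P : 'I_m -> set K) : (forall i, Cpoint iota X (P i)) ->
  exists2 k, (k <= m * n)%N & forall i, nonvanishing (P i) k.
Proof.
move=> CP; have /choice[q hq] : forall i, exists q : {poly R[i]}, [/\ (size q <= n.+1)%N, q != 0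
    & forall k : nat, q.[k%:R] != 0 -> nonvanishing (P i) k].
  move=> i; have [XP valP] := CP i; have hP := model_local x_neq0 XP.
  have [hPs hm] := hP; have [j0 jP] := model_chart_sub x_neq0 XP.
  have Py j : P i (x j / x j0) by apply: jP; apply: affine_form => //; apply: forms_x.
  have /choice[c hc] := fun j => valP _ (Py j).
  exists (\poly_(j < n.+1) c (inord j)); split; first exact: size_poly.
    have c1 : c j0 = 1.
      have := hc j0; rewrite /has_value divff // => m1.
      apply/eqP; rewrite -subr_eq0 -oppr_eq0 opprB; apply/negPn/negP => c1.
      case: m1 => _; apply; rewrite -(rmorph1 iota) -rmorphB.
      have CO := model_const x_neq0 XP; split; first by rewrite fmorph_eq0.
      by rewrite -fmorphV; split; apply: CO; [exists (1 - c j0)|exists (1 - c j0)^-1].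
    apply/eqP => /(congr1 (fun p : {poly _} => p`_j0)).
    by rewrite coef_poly ltn_ord inord_val c1 coef0 => /eqP; rewrite oner_eq0.
  move=> k; rewrite (horner_coef_wide _ (size_poly _ _)) => qk.
  set s := \sum_(j < _) _ in qk.
  have val : maxid (P i) (lform k / x j0 - iota s).
    have -> : lform k / x j0 - iota s = \sum_(j < n.+1) iota (k%:R ^+ j) * (x j / x j0 - iota (c j)).
      rewrite /lform mulr_suml /s rmorph_sum -sumrB; apply: eq_bigr => j _.
      by rewrite coef_poly ltn_ord inord_val rmorphM rmorphXn rmorph_nat; ring.
    have [_ _ mM] := hm; apply: submodule_sum hm _ => j _; apply: mM => //; last exact: hc.
    by apply: (model_const x_neq0 XP); exists (k%:R ^+ j).
  have u : loc_unit (P i) (lform k / x j0).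
    rewrite -[_ / _](subrK (iota s)) addrC; apply: loc_unit_addm => //.
    have CO := model_const x_neq0 XP; split; first by rewrite fmorph_eq0.
    by rewrite -fmorphV; split; apply: CO; [exists s|exists s^-1].
  have [u0 [_ Pu]] := u; have l0 : lform k != 0 by apply: contra_neq u0 => ->; rewrite mul0r.
  split=> // j; have -> : x j / lform k = x j / x j0 * (lform k / x j0)^-1.
    by rewrite invf_div mulrA divfK.
  exact: subringM.
pose Q := \prod_i q i; pose rs : seq R[i] := [seq k%:R | k <- seq.iota 0 (m * n).+1].
have Q0 : Q != 0 by apply/prodf_neq0 => i _; case: (hq i).
have szQ : (size Q <= (m * n).+1)%N.
  have : (size Q <= (\sum_(i < m) (size (q i)).-1).+1)%N.
    rewrite /Q; elim/big_rec2: _ => [|i s y _ IH]; first by rewrite size_poly1.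
    apply: leq_trans (size_polyMleq _ _) _; have [_ qi0 _] := hq i.
    have : (0 < size (q i))%N by rewrite size_poly_gt0.
    by move: IH; move: (size (q i)) (size y); lia.
  move/leq_trans; apply; rewrite ltnS.
  have -> : (m * n = \sum_(i < m) n)%N by rewrite sum_nat_const card_ord.
  by apply: leq_sum => i _; have [sz _ _] := hq i; move: sz; case: (size _).
have urs : uniq rs.
  rewrite map_inj_uniq ?iota_uniq // => a b /eqP.
  by rewrite eqr_nat => /eqP.
have : ~~ all (root Q) rs.
  apply/negP => /(max_poly_roots Q0)/(_ urs); rewrite size_map size_iota.
  by rewrite ltnNge szQ.
case/allPn => z /mapP[k]; rewrite mem_iota add0n ltnS => /= km -> {z} nr.
exists k => // i; have [_ _ h] := hq i; apply: h; apply: contra nr.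
by rewrite rootE /Q horner_prod (bigD1 i) //= => /eqP ->; rewrite mul0r.
Qed.

End LinearForms.

(** * Traces of valuation rings on the field of invariants *)

Section FixedField.
Context {K : fieldType} (tau : {rmorphism K -> K}).
Implicit Types (E O P : set K).

Definition fixed_field : set K := [set f | tau f = f].
Local Notation Ks := fixed_field.

Lemma fixed_subring : is_subring Ks.
Proof.
split; first exact: rmorph1.
by move=> a b ha hb; rewrite /Ks /= rmorphB rmorphM ha hb.
Qed.

Lemma fixedV a : Ks a -> Ks a^-1.
Proof. by rewrite /Ks /= fmorphV => ->. Qed.

Lemma maxid_fixed O : maxid (O `&` Ks) = maxid O `&` Ks.
Proof.
apply/seteqP; split=> a.
  move=> [[Oa Ka] nu]; split=> //; split=> // -[a0 [_ Oa']]; apply: nu.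
  by split=> //; split=> //; split=> //; apply: fixedV.
by move=> [[Oa nu] Ka]; split=> // -[a0 [_ [Oa' _]]]; apply: nu.
Qed.

Lemma fixed_local O : local_ring O -> local_ring (O `&` Ks).
Proof.
move=> [hO [m0 mD mM]]; have hK := fixed_subring; split.
  split; first by split; [exact: subring1|exact: subring1].
  by move=> a b [Oa Ka] [Ob Kb]; split; split;
    [exact: subringB|exact: subringB|exact: subringM|exact: subringM].
rewrite maxid_fixed; split.
- by split=> //; apply: subring0.
- by move=> a b [ma Ka] [mb Kb]; split; [exact: mD|exact: subringD].
- by move=> a b [Oa Ka] [mb Kb]; split; [exact: mM|exact: subringM].
Qed.

Lemma dominates_fixed O : dominates O (O `&` Ks).
Proof. by split=> a; [case|rewrite maxid_fixed; case]. Qed.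

Lemma fixed_expz a (k : int) : Ks a -> Ks (a ^ k).
Proof. by rewrite /Ks /= fmorphXz => ->. Qed.

Section Unramified.
Variables (E : set K) (t : K).
Hypotheses (hE : dvr setT E) (Kt : Ks t) (t0 : t != 0) (ht : maxid E = principal t E).

Lemma fixed_uniformizer : maxid (E `&` Ks) = principal t (E `&` Ks).
Proof.
rewrite maxid_fixed ht; apply/seteqP; split=> a.
  move=> [[b Eb <-] Kb]; exists b => //; split=> //.
  have -> : b = t^-1 * (t * b) by rewrite mulKf.
  by apply: (subringM fixed_subring) => //; apply: fixedV.
move=> [b [Eb Kb] <-]; split; first by exists b.
exact: (subringM fixed_subring).
Qed.

Lemma fixed_dvr : dvr Ks (E `&` Ks).
Proof.
split; [exact/fixed_local/(dvr_local hE)|by move=> a []|].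
exists t; split=> //; first exact: fixed_uniformizer.
move=> f Kf f0; have [e [e0 [Ee Ee']] ef] := ord_uniformizer hE ht (I : setT f) f0.
exists (ord E f), e; split=> //.
have Ke : Ks e.
  have -> : e = t ^ (- ord E f) * f.
    by rewrite {2}ef mulrA -expfzDr // addNr expr0z mul1r.
  by apply: (subringM fixed_subring) => //; apply: fixed_expz.
by split=> //; split; split=> //; apply: fixedV.
Qed.

Lemma ord_fixed f : Ks f -> f != 0 -> ord (E `&` Ks) f = ord E f.
Proof.
move=> Kf f0; have [e ue ef] := ord_uniformizer fixed_dvr fixed_uniformizer Kf f0.
rewrite [in RHS]ef (ord_expz hE) //.
by case: ue => [e0 [[Ee _] [Ee' _]]].
Qed.

End Unramified.
End FixedField.

(** * Prime divisors of X, X / tau and Y *)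

Section Quotient.
Context {R : realType} {K : fieldType} (iota : {rmorphism R[i] -> K}).
Context (tau : {rmorphism K -> K}) (X : set (set K)).
Implicit Types (E O P Q : set K).

Local Notation Ks := (fixed_field tau).
Local Notation pw := (pw tau).

Hypothesis hX : smooth_projective_surface iota X.
Hypothesis XT : funfield X = setT.
Hypothesis tauX : automorphism iota X tau.
Hypothesis tau4 : forall f, iter 4 tau f = f.

Lemma tau_const c : tau (iota c) = iota c. Proof. by case: tauX => _ h _. Qed.

Lemma pw_model k O : X O <-> X (pw k @^-1` O).
Proof.
have [_ _ h] := tauX; elim: k O => [//|k IH] O; rewrite IH (h (pw k @^-1` O)).
have -> // : tau @^-1` (pw k @^-1` O) = pw k.+1 @^-1` O.
by apply/seteqP; split=> f /=; rewrite !pwE -iterSr.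
Qed.

Lemma prime_dvr E : prime_divisor X E -> dvr setT E.
Proof. by move=> /(prime_divisor_dvr hX); rewrite XT. Qed.

Lemma pw_prime_divisor k E : prime_divisor X E -> prime_divisor X (pw k @^-1` E).
Proof.
move=> hE; apply: (dvr_prime_divisor hX); first by apply: (pw_model k E).1; case: hE.
by rewrite XT; apply: dvr_preimage; [exact: pw_bij|exact: prime_dvr].
Qed.

Lemma pw_Cpoint k P : Cpoint iota X P -> Cpoint iota X (pw k @^-1` P).
Proof.
move=> [XP valP]; split; first exact: (pw_model k P).1.
move=> f Pf; have [c mc] := valP _ Pf; exists c.
rewrite /has_value maxid_preimage /= rmorphB pw_const //; exact: tau_const.
Qed.

Lemma setT_surface : X setT. Proof. by rewrite -XT; apply: surface_funfield hX. Qed.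

Lemma quotient_funfield : funfield (quotient_surface X tau) = Ks.
Proof.
apply/seteqP; split=> f; first by move=> [_ [P XP <-]] [].
by move=> Kf; exists (setT `&` Ks) => //; exists setT => //; exact: setT_surface.
Qed.

(* A prime divisor does not lie over a closed point of X / tau: otherwise a
   function vanishing on the orbit of the point but not on E would be integral
   over the maximal ideal of the point. *)
Lemma prime_divisor_not_over_Cpoint E P : prime_divisor X E -> Cpoint iota X P ->
  ~ dominates E (P `&` Ks).
Proof.
move=> hE CP dom; have [XE _ _] := hE; have [P' CP' P'E] := surface_Cpoint hX XE.
have [n [x [x0 eX]]] := surface_presents hX.
have hEl := surface_local hX XE; have [hEs hmE] := hEl; have CE := surface_const hX XE.
(* One chart is to contain the orbit of [P] and, through the point [P'] below [E], also the divisor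
   [E]. *)
pose S (i : 'I_5) := if (i < 4)%N then pw i @^-1` P else P'.
have CS i : Cpoint iota (model iota x) (S i).
  by rewrite -eX /S; case: ifP => // _; apply: pw_Cpoint.
have [k _ good] := exists_nonvanishing x0 CS.
set l := lform x k in good; have fl : forms iota x 1 l := forms_lform iota x k.
have l0 : l != 0 by case: (good ord0).
pose A := affine iota x l; have hA : is_subring A := affine_subring fl.
have AS i : A `<=` S i.
  have [XS _] := CS i; apply: affine_sub => //.
  - by case: (model_local x0 XS).
  - exact: model_const XS.
  - by case: (good i).
have AE : A `<=` E.
  by apply: subset_trans P'E; have := AS ord_max.
have SE i : S i = localization A (maxid (S i) `&` A).
  by have [XS _] := CS i; apply: (model_localization x0 XS fl l0 (AS i)).
have EE : E = localization A (maxid E `&` A).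
  have XEm : model iota x E by rewrite -eX.
  exact: (model_localization x0 XEm fl l0 AE).
(* A function vanishing at [S i] but not along [E] exists: otherwise, evaluation at the complex
   point would make both primes of the chart equal, and [S i] would be the prime divisor [E]. *)
have /choice[b hb] : forall i, exists b, [/\ A b, maxid (S i) b & ~ maxid E b].
  move=> i; apply: contrapT => h; have [XS valS] := CS i.
  have sub a : A a -> maxid (S i) a -> maxid E a.
    by move=> Aa ma; apply: contrapT => na; apply: h; exists a.
  have hS := model_local x0 XS; have [hSs hmS] := hS.
  have eq : maxid (S i) `&` A = maxid E `&` A.
    apply/seteqP; split=> a [ma Aa]; split=> //; first exact: sub.
    have [c mc] := valS _ (AS i _ Aa).
    have Ac : A (iota c) by apply: affine_const; exists c.
    have mEc : maxid E (a - iota c) by apply: sub => //; apply: subringB.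
    have mc' : maxid E (iota c).
      by rewrite -[iota c](subKr a); apply: (submoduleB hEs hmE).
    have c0 : c = 0.
      apply/eqP/negPn/negP => c0; case: mc' => _; apply.
      split; first by rewrite fmorph_eq0.
      by rewrite -fmorphV; split; apply: CE; [exists c|exists c^-1].
    by move: mc; rewrite c0 /has_value rmorph0 subr0.
  have eS : S i = E by rewrite EE SE eq.
  apply: (Cpoint_not_prime_divisor hX (P := S i)); first by rewrite eX.
  by rewrite eS.
pose B := \prod_i b i; have [_ _ mEM] := hmE.
have uB : loc_unit E B.
  rewrite /B; apply: big_ind => [|y z uy uz|i _]; first exact: loc_unit1.
    exact: loc_unitM.
  by have [Ab _ nm] := hb i; apply: loc_unitP => //; apply: AE.
have mB i : (i < 4)%N -> maxid P (pw i B).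
  move=> i4; pose j : 'I_5 := inord i; have ej : j = i :> nat by rewrite inordK // (ltn_trans i4).
  have Sj : S j = pw i @^-1` P by rewrite /S ej i4.
  have [XS _] := CS j; have [hSs [_ _ mM]] := model_local x0 XS.
  have : maxid (S j) B.
    rewrite /B (bigD1 j) //= mulrC; apply: mM; last by case: (hb j).
    by apply: subring_prod => // i' _; apply: AS; case: (hb i').
  by rewrite Sj maxid_preimage.
have [XP _] := CP; have [hPs [mP0 mPD mPM]] := surface_local hX XP.
pose b0 := B; pose b1 := pw 1 B; pose b2 := pw 2 B; pose b3 := pw 3 B.
have t0 : tau b0 = b1 by []. have t1 : tau b1 = b2 by []. have t2 : tau b2 = b3 by [].
have t3 : tau b3 = b0 by exact: (pw4 tau4 B).
have [m0 m1 m2 m3] : [/\ maxid P b0, maxid P b1, maxid P b2 & maxid P b3].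
  by split; [exact: (mB 0%N)|exact: (mB 1%N)|exact: (mB 2%N)|exact: (mB 3%N)].
have low y : tau y = y -> maxid P y -> maxid E y.
  by move=> ty my; have [_ h] := dom; apply: h; rewrite maxid_fixed.
have P0 := maxid_sub m0; have P1 := maxid_sub m1; have P2 := maxid_sub m2; have P3 := maxid_sub m3.
(* The elementary symmetric functions of the conjugates of [B] are invariant and vanish at [P],
   hence along [E]; the polynomial they define has the root [B], so [B ^+ 4] vanishes along [E]. *)
have e1 : maxid E (b0 + b1 + b2 + b3).
  apply: low; first by rewrite !rmorphD t0 t1 t2 t3; ring.
  by do 3?apply: (mPD).
have e2 : maxid E (b0 * b1 + b0 * b2 + b0 * b3 + b1 * b2 + b1 * b3 + b2 * b3).
  apply: low; first by rewrite !rmorphD !rmorphM t0 t1 t2 t3; ring.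
  by do 5?apply: (mPD); apply: (mPM).
have e3 : maxid E (b0 * b1 * b2 + b0 * b1 * b3 + b0 * b2 * b3 + b1 * b2 * b3).
  apply: low; first by rewrite !rmorphD !rmorphM t0 t1 t2 t3; ring.
  by do 3?apply: (mPD); apply: (mPM) => //; apply: subringM.
have e4 : maxid E (b0 * b1 * b2 * b3).
  apply: low; first by rewrite !rmorphM t0 t1 t2 t3; ring.
  by apply: (mPM) => //; do 2?apply: subringM => //.
have EB : E B by case: uB => _ [].
have : maxid E (B ^+ 4).
  have -> : B ^+ 4 = B ^+ 3 * (b0 + b1 + b2 + b3)
    - B ^+ 2 * (b0 * b1 + b0 * b2 + b0 * b3 + b1 * b2 + b1 * b3 + b2 * b3)
    + (B * (b0 * b1 * b2 + b0 * b1 * b3 + b0 * b2 * b3 + b1 * b2 * b3) - b0 * b1 * b2 * b3).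
    by rewrite /b0; ring.
  have [_ mED _] := hmE; apply: (mED); apply: (submoduleB hEs hmE) => //; apply: (mEM) => //;
    exact: subringX.
by case=> _; apply; rewrite !exprS expr0 mulr1; do 3?apply: (loc_unitM hEs) => //.
Qed.

(** Transitivity on the valuations above a given one: otherwise approximation gives [c] congruent to
    1 at [E] whose conjugates all vanish at [E'], and the invariant [y] is a unit at [E] that
    vanishes at [E']. *)
Lemma fixed_center_conjugate E E' : prime_divisor X E -> prime_divisor X E' ->
  E `&` Ks = E' `&` Ks -> exists2 k, (k < 4)%N & pw k @^-1` E' = E.
Proof.
move=> hE hE' eEE'; apply: contrapT => h.
have dE := prime_dvr hE; have dE' := prime_dvr hE'.
have [XE _ _] := hE; have [XE' _ _] := hE'.
have CE := surface_const hX XE; have CE' := surface_const hX XE'.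
(* The conjugates of [E] are included so that every conjugate of [c] is integral at [E]. *)
pose V (i : bool * 'I_4) := pw i.2 @^-1` (if i.1 then E' else E).
have hV i : dvr setT (V i) by apply: dvr_preimage; [exact: pw_bij|case: i => -[]].
have CV i : range iota `<=` V i.
  by apply: pw_preimage_const; [exact: tau_const|case: i => -[]].
have [c [mc hc]] := approximation dE CE hV CV.
have [hEs hmE] := dvr_local dE; have [hEs' hmE'] := dvr_local dE'.
have mc' i : (i < 4)%N -> maxid E' (pw i c).
  move=> i4; have [_] := hc (true, Ordinal i4); rewrite /V /= maxid_preimage; apply.
  by move=> e; apply: h; exists i.
have Ec i : (i < 4)%N -> E (pw i c).
  by move=> i4; have [] := hc (false, Ordinal i4).
have E1 := subring1 hEs; have E1' := subring1 hEs'.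
pose y := 1 - (1 - pw 0 c) * (1 - pw 1 c) * (1 - pw 2 c) * (1 - pw 3 c).
have ty : tau y = y.
  have t3 : tau (pw 3 c) = pw 0 c by exact: (pw4 tau4 c).
  rewrite /y rmorphB !rmorphM !rmorphB rmorph1 t3; have -> : tau (pw 0 c) = pw 1 c by [].
  have -> : tau (pw 1 c) = pw 2 c by []. have -> : tau (pw 2 c) = pw 3 c by [].
  by ring.
have my : maxid E (y - 1).
  have -> : y - 1 = (1 - pw 1 c) * (1 - pw 2 c) * (1 - pw 3 c) * (c - 1) by rewrite /y /=; ring.
  have [_ _ mM] := hmE; apply: mM => //.
  by do 2?apply: (subringM hEs); apply: (subringB hEs) => //; apply: Ec.
have uy : loc_unit E y.
  by rewrite -[y](subrK 1) addrC; apply: loc_unit_addm => //; exact: loc_unit1.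
have my' : maxid E' y.
  have m0 := mc' 0%N isT; have m1 := mc' 1%N isT; have m2 := mc' 2%N isT; have m3 := mc' 3%N isT.
  have [E0 E1c E2 E3] : [/\ E' (pw 0 c), E' (pw 1 c), E' (pw 2 c) & E' (pw 3 c)].
    by split; apply: maxid_sub.
  have -> : y = (1 - pw 1 c) * (1 - pw 2 c) * (1 - pw 3 c) * pw 0 c
     + ((1 - pw 2 c) * (1 - pw 3 c) * pw 1 c + ((1 - pw 3 c) * pw 2 c + pw 3 c)).
    by rewrite /y; ring.
  have [_ mD mM] := hmE'.
  by do 3?apply: (mD) => //; apply: (mM) => //; do 2?apply: (subringM hEs') => //; apply: (subringB hEs').
have [y0 [Ey Ey']] := uy; case: my' => Ey2; apply; split=> //; split=> //.
have : (E `&` Ks) y^-1 by split=> //; apply: fixedV.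
by rewrite eEE' => -[].
Qed.

Hypothesis unram : forall E, prime_divisor X E ->
  exists t, [/\ tau t = t, t != 0 & maxid E = principal t E].

Lemma quotient_dvr E : prime_divisor X E -> dvr Ks (E `&` Ks).
Proof.
by move=> hE; have [t [Kt t0 ht]] := unram hE; apply: fixed_dvr ht => //; exact: prime_dvr.
Qed.

Lemma quotient_ord E f : prime_divisor X E -> Ks f -> f != 0 ->
  ord (E `&` Ks) f = ord E f.
Proof.
by move=> hE; have [t [Kt t0 ht]] := unram hE; apply: (ord_fixed _ Kt) => //; exact: prime_dvr.
Qed.

Variables (Y X' : set (set K)).
Hypothesis Y_res : resolution iota (quotient_surface X tau) Y.
Hypothesis X'_res : resolution iota X X'.
Hypothesis X'Y : model_morphism X' Y.

Let hY : smooth_projective_surface iota Y. Proof. by case: Y_res. Qed.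
Let hX' : smooth_projective_surface iota X'. Proof. by case: X'_res. Qed.

Lemma Y_funfield : funfield Y = Ks.
Proof. by have [_ -> _] := Y_res; exact: quotient_funfield. Qed.

(** [E] has a center on [X'] by properness, and this maps to the center of [E] on [X], which is [E]
    itself; the center on [X'] lies in between and equals [E]. *)
Lemma blowup_prime_divisor E : prime_divisor X E -> prime_divisor X' E.
Proof.
move=> hE; have dE := prime_dvr hE; have [XE _ _] := hE.
have [_ X'T X'X] := X'_res; rewrite XT in X'T.
have [Q XQ dom] := surface_center hX' (dvr_local dE) (surface_const hX XE)
  (fun f _ => dvr_valuation dE I).
have [P XP dom'] := X'X _ XQ.
have eP : E = P.
  apply: (surface_center_unique hX XE XP (V := E)); first by split.
  exact: dominates_trans dom'.
have eQ : Q = E.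
  by apply/seteqP; split; [case: dom|rewrite {1}eP; case: dom'].
apply: (dvr_prime_divisor hX'); first by rewrite -eQ.
by rewrite X'T.
Qed.

(** [Q] lies over the trace of some [P], which is not a complex point by
    [prime_divisor_not_over_Cpoint]; in the main case the traces of [P] and [E] agree, as discrete
    valuation rings are maximal for domination. *)
Lemma center_on_Y E Q : prime_divisor X E -> Y Q -> dominates E Q -> Q = E `&` Ks.
Proof.
move=> hE YQ dom; have [_ _ YX] := Y_res; have [_ [P XP <-] domQ] := YX _ YQ.
have dom' : dominates E (P `&` Ks) by apply: dominates_trans domQ.
have QK : Q `<=` Ks by rewrite -Y_funfield; apply: surface_sub_funfield.
have QE : Q `<=` E `&` Ks by move=> f Qf; split; [case: dom => h _; apply: h|apply: QK].
have [eP|CP|hP] := surface_cases hX XP.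
- have dE := quotient_dvr hE; apply/seteqP; split=> // f [Ef Kf].
  by case: domQ => h _; apply: h; rewrite eP XT.
- by case: (prime_divisor_not_over_Cpoint hE CP).
have dP := quotient_dvr hP.
have e : E `&` Ks = P `&` Ks.
  apply: (dominates_dvr dP); first by move=> f [].
  split=> f; first by move=> [Pf Kf]; split=> //; case: dom' => h _; apply: h.
  move=> mf; rewrite maxid_fixed; split; first by case: dom' => _ h; apply: h.
  by case: mf => -[].
apply/seteqP; split=> //; rewrite e; by case: domQ.
Qed.

Lemma quotient_prime_divisor E : prime_divisor X E -> prime_divisor Y (E `&` Ks).
Proof.
move=> hE; have [X'E _ _] := blowup_prime_divisor hE.
have [Q YQ dom] := X'Y X'E; have eQ := center_on_Y hE YQ dom.
apply: (dvr_prime_divisor hY); first by rewrite -eQ.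
by rewrite Y_funfield; apply: quotient_dvr.
Qed.

Lemma Y_prime_divisor_cases Q : prime_divisor Y Q ->
  (exists2 E, prime_divisor X E & Q = E `&` Ks) \/
  (exists2 P, Cpoint iota X P & dominates Q (P `&` Ks)).
Proof.
move=> hQ; have [YQ [_ nQ] _] := hQ; have [_ _ YX] := Y_res.
have [_ [P XP <-] dom] := YX _ YQ.
have QK : Q `<=` Ks by rewrite -Y_funfield; apply: surface_sub_funfield.
have [eP|CP|hP] := surface_cases hX XP.
- case: nQ; rewrite Y_funfield => f Kf; case: dom => h _; apply: h.
  by rewrite eP XT.
- by right; exists P.
- by left; exists P => //; apply: (dominates_dvr (quotient_dvr hP)).
Qed.

End Quotient.

(** * The class of L is invariant *)

Section CechTransport.
Context {R : realType} {K : fieldType} (iota : {rmorphism R[i] -> K}).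
Context (X : set (set K)) (sigma : {rmorphism K -> K}).
Hypothesis hX : smooth_projective_surface iota X.
Hypothesis XT : funfield X = setT.
Hypothesis sigmaX : automorphism iota X sigma.
Implicit Types (E P S : set K) (D : set K -> int) (x y z : cech_pair (K := K) 2).

Let sigma_const c : sigma (iota c) = iota c. Proof. by case: sigmaX. Qed.

Lemma has_value_preimage P f c : has_value iota (sigma @^-1` P) f c <-> has_value iota P (sigma f) c.
Proof. by rewrite /has_value maxid_preimage /= rmorphB sigma_const. Qed.

Lemma Cpoint_preimage P : Cpoint iota X P <-> Cpoint iota X (sigma @^-1` P).
Proof.
have [[s' sK s'K] _ Xs] := sigmaX; rewrite /Cpoint -Xs; split=> -[XP h]; split=> // f Pf.
  by have [c hc] := h _ Pf; exists c; apply/has_value_preimage.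
have [|c /has_value_preimage] := h (s' f); first by rewrite /= s'K.
by rewrite s'K => hc; exists c.
Qed.

Lemma euclid_nbhs_preimage P (N : set (set K)) :
  euclid_nbhs iota X (sigma @^-1` P) N -> euclid_nbhs iota X P [set S | N (sigma @^-1` S)].
Proof.
move=> [s [e [e0 sP h]]]; exists (map sigma s), e; split=> //.
  by move=> _ /mapP[f fs ->]; apply: (sP f fs).
move=> Q CQ hQ /=; apply: h; first exact: (Cpoint_preimage Q).1.
move=> f fs; have [|c [d [hc hd hcd]]] := hQ (sigma f); first exact: map_f.
by exists c, d; split=> //; apply/has_value_preimage.
Qed.

Lemma euclid_nbhs_sub P (M N : set (set K)) : M `<=` N ->
  euclid_nbhs iota X P M -> euclid_nbhs iota X P N.
Proof. by move=> MN [s [e [e0 sP h]]]; exists s, e; split=> // Q CQ hQ; apply/MN/h. Qed.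

Lemma open_cover_aut (U : set K -> set (set K)) : open_cover iota X U ->
  open_cover iota X (fun P => [set S | U (sigma @^-1` P) (sigma @^-1` S)]).
Proof.
move=> hU P /Cpoint_preimage/hU[[UC Uo] UP]; split=> //; split.
  by move=> S /UC; apply: (Cpoint_preimage S).2.
by move=> S US; apply: (@euclid_nbhs_preimage S (U (sigma @^-1` P))); apply: Uo.
Qed.

Lemma nerve_aut (U : set K -> set (set K)) q (s : 'I_q.+1 -> set K) :
  nerve iota X (fun P => [set S | U (sigma @^-1` P) (sigma @^-1` S)]) s ->
  nerve iota X U (fun i => sigma @^-1` s i).
Proof.
move=> [Cs [S US]]; split; first by move=> i; apply: (Cpoint_preimage (s i)).1.
by exists (sigma @^-1` S).
Qed.

Lemma cech_cocycle_aut q (x : cech_pair q) :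
  cech_cocycle iota X x -> cech_cocycle iota X (cech_aut sigma x).
Proof.
by move=> [hU hd]; split; [exact: open_cover_aut|move=> s /nerve_aut/hd].
Qed.

Lemma cech_null_aut q (x : cech_pair q.+1) :
  cech_null iota X x -> cech_null iota X (cech_aut sigma x).
Proof.
move=> [W [b [hW sub hb]]].
exists (fun P => [set S | W (sigma @^-1` P) (sigma @^-1` S)]),
  (fun s => b (fun i => sigma @^-1` s i)); split.
- exact: open_cover_aut.
- by move=> P S WS; apply: (sub _ _ WS).
- by move=> s /nerve_aut/hb.
Qed.

Lemma orthogonal_aut x y :
  Defs.orthogonal iota X x y -> Defs.orthogonal iota X (cech_aut sigma x) (cech_aut sigma y).
Proof. exact: (@cech_null_aut 3 (cech_cup x y : cech_pair 4)). Qed.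

Lemma cech_invariant_aut x :
  cech_invariant iota X sigma x -> cech_invariant iota X sigma (cech_aut sigma x).
Proof. exact: (@cech_null_aut 1 (cech_sub (cech_aut sigma x) x)). Qed.

Lemma chern_class_aut D x :
  chern_class iota X D x -> chern_class iota X (aut_pullback_div sigma D) (cech_aut sigma x).
Proof.
have [sb _ Xs] := sigmaX; move=> [f [l [hU hf hl hc]]].
exists (fun P => sigma (f (sigma @^-1` P))),
  (fun P Q S => l (sigma @^-1` P) (sigma @^-1` Q) (sigma @^-1` S)); split.
- exact: open_cover_aut.
- move=> P S /Cpoint_preimage CP US; have [f0 _ hfD] := hf _ _ CP US.
  split; [by rewrite fmorph_eq0|by rewrite XT|move=> E hE SE].
  rewrite -ord_preimage //; apply: hfD => //; last by move=> a; apply: SE.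
  apply: (dvr_prime_divisor hX); first by apply: (Xs E).1; case: hE.
  by rewrite XT; apply: dvr_preimage => //; rewrite -XT; apply: (prime_divisor_dvr hX).
- move=> P Q /Cpoint_preimage CP /Cpoint_preimage CQ; have [cont val] := hl _ _ CP CQ; split.
    move=> S [SP SQ] e e0.
    have := cont (sigma @^-1` S) (conj SP SQ) e e0.
    by move/euclid_nbhs_preimage; apply: euclid_nbhs_sub => T /= h [TP TQ]; apply: h.
  by move=> S SP SQ; rewrite -fmorph_div; apply/has_value_preimage/val.
- move=> P Q T S /Cpoint_preimage CP /Cpoint_preimage CQ /Cpoint_preimage CT SP SQ ST.
  rewrite (hc _ _ _ _ CP CQ CT SP SQ ST) /=; congr (_ * (x.2 _)%:~R).
  by apply/funext => -[[|[|[|i]]] hi].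
Qed.

End CechTransport.

(** * Sections of a very ample class are not proportional *)

Section VeryAmple.
Context {R : realType} {K : fieldType} (iota : {rmorphism R[i] -> K}).
Context (X : set (set K)).
Hypothesis hX : smooth_projective_surface iota X.
Hypothesis XT : funfield X = setT.

Lemma ord_exprz (E : set K) (f : K) (n : int) : dvr setT E -> f != 0 -> ord E (f ^ n) = n * ord E f.
Proof.
move=> dE f0; have hp (k : nat) : ord E (f ^+ k) = k%:Z * ord E f.
  by rewrite (ordX dE) // -mulr_natl natz.
case: n => k; first exact: hp.
by rewrite NegzE -exprnN (ordV dE) ?expf_neq0 // hp mulNr.
Qed.

(** Otherwise every local ring of [X] would be the field of constants, and there would be no chain
    of two. *)
Lemma generic_point_nonconstant r (s : 'I_r.+1 -> K) : presents iota s X ->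
  ~ forall i, range iota (s i / s ord0).
Proof.
move=> [s0 eX] hs; have [_ [[A [B [C [XA XB _ [_ nAB] _]]]] _] _] := hX.
have sub O : X O -> O = range iota.
  move=> XO; apply/seteqP; split; last exact: surface_const XO.
  move: XO; rewrite eX => -[i [p [_ ->]]] f [a [b [ca cb _ ->]]].
  have h : chart iota s i `<=` range iota.
    apply: smallest_sub => [|_ [j _ <-]].
      split=> //; split; first by exists 1; rewrite ?rmorph1.
      move=> _ _ [u _ <-] [v _ <-]; split; first by exists (u - v); rewrite ?rmorphB.
      by exists (u * v); rewrite ?rmorphM.
    have [u _ eu] := hs j; have [v _ ev] := hs i; exists (u / v) => //.
    by rewrite fmorph_div eu ev -mulf_div divff ?mulr1 // invr_neq0.
  have [u _ <-] := h _ ca; have [v _ <-] := h _ cb.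
  by exists (u / v) => //; rewrite fmorph_div.
by apply: nAB; rewrite (sub A XA) (sub B XB).
Qed.

(** The functions [s i ^+ n.+1 * b] are regular, hence constant. So powers of the ratios of sections
    are constant, and then the ratios too, the complex numbers being algebraically closed. *)
Lemma sections_not_proportional r (s : 'I_r.+1 -> K) (n : nat) (b : K) : presents iota s X -> b != 0 ->
  (forall i E, prime_divisor X E -> 0 <= ord E (s i ^+ n.+1 * b)) -> False.
Proof.
move=> hs b0 h; have [s0 _] := hs.
have /choice[c hc] : forall i, exists c, s i ^+ n.+1 * b = iota c.
  move=> i; apply: (regular_divisor_const hX); first by rewrite XT.
  move=> E hE; have := h i E hE.
  by move/(ord_mem (prime_dvr hX XT hE) I); apply; rewrite mulf_neq0 ?expf_neq0.
apply: (generic_point_nonconstant hs) => i.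
pose q : {poly R[i]} := 'X^(n.+1) - (c i / c ord0)%:P.
have [||u ->] := @poly_root_const R K iota (s i / s ord0) q; last by exists u.
  by rewrite -size_poly_gt0 size_XnsubC.
rewrite /q rmorphB /= map_polyXn map_polyC hornerD hornerN hornerXn hornerC /= fmorph_div -!hc.
by rewrite expr_div_n -mulf_div divff // mulr1 subrr.
Qed.

End VeryAmple.

(** * Action of tau on the orthogonal of Omega_4 and on L *)

Section InvariantClass.
Context {R : realType} {K : fieldType} (iota : {rmorphism R[i] -> K}).
Context (X : set (set K)) (tau : {rmorphism K -> K}) (L : set K -> int).
Hypothesis hX : smooth_projective_surface iota X.
Hypothesis XT : funfield X = setT.
Hypothesis tauX : automorphism iota X tau.
Hypothesis tau4 : forall f, iter 4 tau f = f.
Implicit Types (E P S : set K) (D : set K -> int).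

Local Notation tr := (aut_pullback_div tau).

Lemma preimage4 E : tau @^-1` (tau @^-1` (tau @^-1` (tau @^-1` E))) = E.
Proof. by apply/seteqP; split=> f /=; have := tau4 f => /= ->. Qed.

Lemma cech_aut4 q (x : cech_pair q) :
  cech_aut tau (cech_aut tau (cech_aut tau (cech_aut tau x))) = x.
Proof.
case: x => U c; congr pair; apply/funext => P /=.
  by rewrite preimage4; apply/funext => S /=; rewrite preimage4.
by congr c; apply/funext => i; rewrite preimage4.
Qed.

(** Any test class is the transform by [tau] of its transform by the inverse, which is the third
    power of [tau], and orthogonality can be transported. *)
Lemma Omega4_aut (y : cech_pair 2) : Omega4 iota X tau y -> Omega4 iota X tau (cech_aut tau y).
Proof.
move=> [cy hy]; split; first exact: cech_cocycle_aut.
move=> z cz iz; rewrite -(cech_aut4 z); apply: orthogonal_aut => //; apply: hy.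
  by do 3?apply: cech_cocycle_aut.
by do 3?apply: cech_invariant_aut.
Qed.

Lemma tau_prime_divisor E : prime_divisor X E -> prime_divisor X (tau @^-1` E).
Proof. by move=> hE; apply: (pw_prime_divisor hX XT tauX tau4 1). Qed.

Lemma is_divisor_aut D : is_divisor X D -> is_divisor X (tr D).
Proof.
have h E : prime_divisor X (tau @^-1` E) -> prime_divisor X E.
  by move=> hE; rewrite -(preimage4 E); do 3?apply: tau_prime_divisor.
move=> [Ds Df]; split; first by move=> E /Ds/h.
have := finite_image (fun E : set K => tau @^-1` (tau @^-1` (tau @^-1` E))) Df.
apply: sub_finite_set => E hE /=; exists (tau @^-1` E) => //; exact: preimage4.
Qed.

Lemma Omega4_perp_aut D : Omega4_perp iota X tau D -> Omega4_perp iota X tau (tr D).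
Proof.
move=> [hD h]; split; first exact: is_divisor_aut.
move=> x y cx oy; rewrite -(cech_aut4 x) -(cech_aut4 y); apply: orthogonal_aut => //.
apply: h; last by do 3?apply: Omega4_aut.
have -> : D = tr (tr (tr (tr D))) by apply/funext => E; rewrite /aut_pullback_div preimage4.
by do 3?apply: chern_class_aut.
Qed.

Hypothesis L_ample : ample iota X L.

(* Since tau^4 = 1, (n^4 - 1) L is linearly equivalent to 0, and if n = -1 then so is
   L + tau^* L; either way all sections of a very ample multiple of L would be
   proportional. *)
Lemma lin_equiv_multiple (n : int) : lin_equiv X (tr L) (scale_div n L) -> n = 1.
Proof.
move=> [h [h0 _] hh]; have [m m0 [r [s [hs _ ps]]]] := L_ample.
have [s0 _] := ps.
have sec i E : prime_divisor X E -> 0 <= ord E (s i) + m%:Z * L E.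
  by move=> hE; have [_ /(_ (s0 i))] := hs i; apply.
have [n1|n1] := eqVneq n 1 => //; exfalso.
have [en|nn1] := eqVneq n (-1).
  (* Here [h] has divisor tau^* L + L, which compensates the poles of [s i] and [tau (s ord0)]. *)
  have b0 : tau (s ord0) * h ^+ m != 0 by rewrite mulf_neq0 ?expf_neq0 // fmorph_eq0.
  refine (sections_not_proportional hX XT (n := 0) ps b0 _) => i E hE; have dE := prime_dvr hX XT hE.
  have := sec i E hE; have := sec ord0 _ (tau_prime_divisor hE); have := hh E hE.
  rewrite expr1 !(ordM dE) ?mulf_neq0 ?expf_neq0 ?fmorph_eq0 // (ordX dE) //.
  rewrite ord_preimage; last exact: tau_bij.
  rewrite /aut_pullback_div /scale_div en -mulr_natr natz => -> h1 h2.
  by have := addr_ge0 h2 h1; congr (0 <= _); ring.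
(* The divisors of the factors telescope from the fourth transform of [L], which is [L], to [n ^+ 4]
   times [L]. *)
have h4 E : prime_divisor X E -> ord E (tau (tau (tau h)) * tau (tau h) ^ n * tau h ^ (n ^+ 2)
    * h ^ (n ^+ 3)) = (1 - n ^+ 4) * L E.
  move=> hE; have dE := prime_dvr hX XT hE.
  have h1 := hh _ (tau_prime_divisor hE); have h2 := hh _ (tau_prime_divisor (tau_prime_divisor hE)).
  have h3 := hh _ (tau_prime_divisor (tau_prime_divisor (tau_prime_divisor hE))).
  have h0' := hh _ hE; have bt := tau_bij tau4.
  rewrite !(ordM dE) ?mulf_neq0 ?expfz_neq0 ?fmorph_eq0 // !(ord_exprz _ dE) ?fmorph_eq0 //.
  rewrite !ord_preimage // in h1 h2 h3.
  rewrite h0' h1 h2 h3 /aut_pullback_div /scale_div preimage4; ring.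
have [b [N [b0 N0 hb]]] : exists b (N : nat), [/\ b != 0, (0 < N)%N
   & forall E, prime_divisor X E -> ord E b = N%:Z * L E].
  set H := _ * _ in h4; have H0 : H != 0.
    by rewrite /H !mulf_neq0 ?expfz_neq0 ?fmorph_eq0.
  have n4 : n ^+ 4 != 1.
    have -> : (n ^+ 4 == 1) = ((n - 1) * (n + 1) * (n ^+ 2 + 1) == 0).
      by rewrite -subr_eq0; congr (_ == 0); ring.
    rewrite !mulf_eq0 subr_eq0 addr_eq0 (negPf n1) (negPf nn1) /=.
    by rewrite gt_eqF // ltr_wpDl ?sqr_ge0.
  have [le|le] := leP 0 (1 - n ^+ 4).
    exists H, `|1 - n ^+ 4|%N; split=> //; first by rewrite absz_gt0 subr_eq0 eq_sym.
    by move=> E hE; rewrite h4 // gez0_abs.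
  exists H^-1, `|1 - n ^+ 4|%N; split=> //; first by rewrite invr_neq0.
    by rewrite absz_gt0 subr_eq0 eq_sym.
  move=> E hE; rewrite (ordV (prime_dvr hX XT hE)) // h4 // ltz0_abs // mulNr; ring.
case: N N0 hb => // N _ hb.
refine (sections_not_proportional hX XT (n := N) ps (expf_neq0 m b0) _) => i E hE.
have dE := prime_dvr hX XT hE; have := sec i E hE.
rewrite (ordM dE) ?expf_neq0 // !exprnP !(ord_exprz _ dE) // hb // => h'.
by have := mulr_ge0 (isT : 0 <= N.+1%:Z) h'; congr (0 <= _); ring.
Qed.

(** The norm of [g] has trivial divisor because the fourth power of [tau] is the identity, so it is
    a constant [c]; a fourth root of [c^-1] normalizes [g]. *)
Lemma exists_linearization : lin_equiv X (tr L) L -> exists g, linearization X tau L g.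
Proof.
move=> [g [g0 _] hg]; pose N := g * tau g * tau (tau g) * tau (tau (tau g)).
have N0 : N != 0 by rewrite !mulf_neq0 ?fmorph_eq0.
have FN : funfield X N by rewrite XT.
have ordN E : prime_divisor X E -> ord E N = 0.
  move=> hE; have dE := prime_dvr hX XT hE.
  have h1 := hg _ (tau_prime_divisor hE); have h2 := hg _ (tau_prime_divisor (tau_prime_divisor hE)).
  have h3 := hg _ (tau_prime_divisor (tau_prime_divisor (tau_prime_divisor hE))).
  have h0 := hg _ hE; have bt := tau_bij tau4; rewrite !ord_preimage // in h1 h2 h3.
  rewrite !(ordM dE) ?mulf_neq0 ?fmorph_eq0 // h0 h1 h2 h3 /aut_pullback_div preimage4; ring.
have [c c0 ec] := ord0_const hX FN N0 ordN.
pose d := 4.-root c^-1.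
have d4 : d ^+ 4 = c^-1 by exact: rootCK.
have d0 : d != 0.
  by apply: contra_neq c0 => d0; apply: invr_inj; rewrite -d4 d0 expr0n invr0.
have tc c' : tau (iota c') = iota c' by case: tauX.
exists (iota d * g); split; first by rewrite mulf_neq0 ?fmorph_eq0.
  move=> E hE; have dE := prime_dvr hX XT hE; have [XE _ _] := hE.
  rewrite (ordM dE) ?fmorph_eq0 // hg // [ord E (iota d)](ord_unit dE) ?add0r //.
  split; first by rewrite fmorph_eq0.
  by rewrite -fmorphV; split; apply: (surface_const hX XE); [exists d|exists d^-1].
move=> f; rewrite /section_action /= !rmorphM !tc.
have := tau4 f => /= ->; transitivity (iota (d ^+ 4) * N * f); first by rewrite rmorphXn /N; ring.
by rewrite ec -rmorphM d4 mulVf // rmorph1 mul1r.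
Qed.

End InvariantClass.

(** * Descent of the eigensections *)

Section Ramification.
Context {R : realType} {K : fieldType} (iota : {rmorphism R[i] -> K}).
Context (X : set (set K)) (tau : {rmorphism K -> K}).
Hypothesis hX : smooth_projective_surface iota X.
Hypothesis XT : funfield X = setT.
Hypothesis tauX : automorphism iota X tau.
Hypothesis tau4 : has_order4 tau.

Lemma symplectic_unramified w E : symplectic_form iota X w ->
  eq_form iota (map_form tau w) w -> prime_divisor X E ->
  exists t, [/\ tau t = t, t != 0 & maxid E = principal t E].
Proof.
move=> sw tw hE; have [t4 [f0 nf0]] := tau4; have [XE _ _] := hE.
have [_ tc _] := tauX.
apply: (invariant_uniformizer t4 tc (prime_dvr hX XT hE) (surface_const hX XE)).
apply: (symplectic_involution_inertia hX XT (rho := pw tau 2) _ _ _ sw) => //.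
- by exists f0.
- by move=> c; apply: pw_const.
apply: (eq_form_trans _ tw).
by apply: (eq_form_map (g := pw tau 3)) tw => // f; exact: (t4 f).
Qed.

End Ramification.

(** * From invariant divisors on X to divisors on Y *)

Section Descent.
Context {R : realType} {K : fieldType} (iota : {rmorphism R[i] -> K}).
Context (X Y X' : set (set K)) (tau : {rmorphism K -> K}) (L : set K -> int).
Hypothesis hX : smooth_projective_surface iota X.
Hypothesis XT : funfield X = setT.
Hypothesis tauX : automorphism iota X tau.
Hypothesis tau4 : forall f, iter 4 tau f = f.
Hypothesis unram : forall E, prime_divisor X E ->
  exists t, [/\ tau t = t, t != 0 & maxid E = principal t E].
Hypothesis Y_res : resolution iota (quotient_surface X tau) Y.
Hypothesis X'_res : resolution iota X X'.
Hypothesis X'Y : model_morphism X' Y.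
Implicit Types (E P Q : set K) (D M : set K -> int).

Local Notation Ks := (fixed_field tau).

Let hY : smooth_projective_surface iota Y. Proof. by case: Y_res. Qed.
Let YK : funfield Y = Ks. Proof. exact: (Y_funfield hX XT Y_res). Qed.
Let dvrX E (hE : prime_divisor X E) : dvr setT E. Proof. exact: (prime_dvr hX XT hE). Qed.
Let dvrY Q (hQ : prime_divisor Y Q) : dvr Ks Q.
Proof. by rewrite -YK; apply: (prime_divisor_dvr hY). Qed.
Let KM a b : Ks a -> Ks b -> Ks (a * b).
Proof. exact: (subringM (fixed_subring tau)). Qed.

Definition tau_norm (f : K) : K := f * tau f * tau (tau f) * tau (tau (tau f)).

Lemma tau_normM f g : tau_norm (f * g) = tau_norm f * tau_norm g.
Proof. by rewrite /tau_norm !rmorphM; ring. Qed.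

Lemma tau_norm_neq0 f : f != 0 -> tau_norm f != 0.
Proof. by move=> f0; rewrite !mulf_neq0 ?fmorph_eq0. Qed.

Lemma tau_norm_fixed f : Ks (tau_norm f).
Proof. by rewrite /fixed_field /= !rmorphM; have := tau4 f => /= ->; rewrite /tau_norm; ring. Qed.

Lemma tau_norm_id f : Ks f -> tau_norm f = f ^+ 4.
Proof. by move=> tf; rewrite /tau_norm !tf; ring. Qed.

(* An invariant section regular along the prime divisors of X has bounded poles along
   the curves of Y contracted to X / tau: near the orbit of P, it becomes a regular
   function after taking a power and dividing by a section of a multiple of L. *)
Lemma exceptional_bound h : ample iota X L -> h != 0 -> exists B : set K -> int,
  [/\ forall Q, 0 <= B Q, finite_set [set Q | prime_divisor Y Q /\ B Q <> 0]
    & forall P Q f, Cpoint iota X P -> prime_divisor Y Q -> dominates Q (P `&` Ks) ->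
        Ks f -> f != 0 -> (forall E, prime_divisor X E -> 0 <= ord E f + (L E + ord E h)) ->
        0 <= ord Q f + B Q].
Proof.
move=> [m m0 [r [s [sH sloc [s0 eX]]]]] h0.
pose c t := tau_norm ((lform s t)^-1 * h ^+ m).
have c0 t : lform s t != 0 -> c t != 0.
  by move=> l0; apply: tau_norm_neq0; rewrite mulf_neq0 ?invr_neq0 ?expf_neq0.
(* The four points of an orbit are avoided by one of [4 * r + 1] linear forms; summing over all of
   them bounds the contribution of whichever form is used. *)
exists (fun Q => \sum_(t < (4 * r).+1 | lform s t != 0) `|ord Q (c t)|); split.
- by move=> Q; apply: sumr_ge0.
- pose S (t : 'I_(4 * r).+1) := [set Q | lform s t != 0 /\ prime_divisor Y Q /\ ord Q (c t) <> 0].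
  apply: (@sub_finite_set _ _ (\bigcup_(t in [set: 'I_(4 * r).+1]) S t)); last first.
    apply: bigcup_finite => // t _; have [l0|l0] := eqVneq (lform s t) 0.
      by rewrite /S l0 eqxx; apply: (@sub_finite_set _ _ set0) => // Q [].
    apply: sub_finite_set (finite_support hY _ (c0 t l0)) => [Q []//|].
    by rewrite YK; apply: tau_norm_fixed.
  move=> Q [hQ]; apply: contra_notP => nS; apply: big1 => t l0.
  by have [->//|/eqP nz] := eqVneq (ord Q (c t)) 0; case: nS; exists t.
move=> P Q f CP hQ dom Kf f0 hf.
have CPk (k : 'I_4) : Cpoint iota (model iota s) (pw tau k @^-1` P).
  by rewrite -eX; apply: pw_Cpoint.
have [t le_t good] := exists_nonvanishing s0 CPk.
set l := lform s t in good; have l0 : l != 0 by case: (good ord0).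
(* As [l] does not vanish at the orbit, [l^-1] has order at least that of [m L] along the divisors
   through it, which cancels the poles of [(f * h) ^+ m]. *)
pose F := f ^+ m * (l^-1 * h ^+ m).
have FP (k : 'I_4) : P (pw tau k F).
  have CPX : Cpoint iota X (pw tau k @^-1` P) by rewrite eX.
  apply: (Cpoint_normal hX CPX); first by rewrite XT.
  move=> E hE PE; have dE := dvrX hE.
  have [i [_ _ /(_ E hE PE) si]] := sloc _ CPX.
  have : E (s i / l) by apply: PE; case: (good k) => _; apply.
  move/(ord_mem dE I (mulf_neq0 (s0 i) (invr_neq0 l0))).
  rewrite (ordM dE) ?invr_neq0 // (ordV dE) // => hl.
  rewrite (ordV dE) // /scale_div in si; have hfE := mulr_ge0 (isT : 0 <= m%:Z) (hf E hE).
  apply/(ord_mem dE I); first by rewrite !mulf_neq0 ?expf_neq0 ?invr_neq0.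
  rewrite !(ordM dE) ?mulf_neq0 ?expf_neq0 ?invr_neq0 // (ordV dE) // !exprnP !(ord_exprz _ dE) //.
  by move: hl hfE si; rewrite !mulrDr; lia.
have [XP _] := CP; have [hPs _] := surface_local hX XP.
have NP : P (tau_norm F).
  rewrite /tau_norm; do 3?apply: (subringM hPs).
  - exact: (FP (@Ordinal 4 0 isT)).
  - exact: (FP (@Ordinal 4 1 isT)).
  - exact: (FP (@Ordinal 4 2 isT)).
  - exact: (FP (@Ordinal 4 3 isT)).
have dQ := dvrY hQ.
have : Q (tau_norm F) by case: dom => h' _; apply: h'; split=> //; apply: tau_norm_fixed.
have fm0 : f ^+ m != 0 by rewrite expf_neq0.
have Kfm : Ks (f ^+ m) by rewrite /fixed_field /= rmorphXn Kf.
rewrite /F tau_normM -/(c t) (tau_norm_id Kfm) -exprM => hN.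
have : 0 <= ord Q (f ^+ (m * 4) * c t).
  apply/(ord_mem dQ) => //; last by rewrite mulf_neq0 ?expf_neq0 ?c0.
  by apply: KM; [rewrite /fixed_field /= rmorphXn Kf|exact: tau_norm_fixed].
rewrite (ordM dQ) ?expf_neq0 ?c0 //; last first.
- exact: tau_norm_fixed.
- by rewrite /fixed_field /= rmorphXn Kf.
rewrite (ordX dQ) // -mulr_natr natz => hc.
have : `|ord Q (c t)| <= \sum_(t < (4 * r).+1 | lform s t != 0) `|ord Q (c t)|.
  have tl : (t < (4 * r).+1)%N by [].
  by rewrite (bigD1 (Ordinal tl)) //= lerDl; apply: sumr_ge0.
move: (\sum_(_ < _ | _) _) => b hb; have b0 : 0 <= b by apply: le_trans hb.
have [//|lt] := leP 0 (ord Q f + b); have : ord Q f * (m * 4)%N%:Z <= ord Q f * 1.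
  by rewrite ler_wnM2l; move: m0 lt b0; lia.
by move: (_ * (m * 4)%N%:Z) hc hb lt => o; lia.
Qed.

Definition tau_invariant M : Prop := forall E, prime_divisor X E -> M (tau @^-1` E) = M E.

Lemma tau_invariant_fixed M E E' : tau_invariant M -> prime_divisor X E -> prime_divisor X E' ->
  E `&` Ks = E' `&` Ks -> M E = M E'.
Proof.
move=> hM hE hE' /(fixed_center_conjugate hX XT tauX tau4 hE hE')[k _ <-].
elim: k => [//|k IH]; rewrite -IH.
have -> : pw tau k.+1 @^-1` E' = tau @^-1` (pw tau k @^-1` E').
  by apply/seteqP; split=> f /=; rewrite -pwS.
exact/hM/(pw_prime_divisor hX XT tauX tau4 k hE').
Qed.

Lemma descend_divisor M B : tau_invariant M -> is_divisor X M ->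
  finite_set [set Q | prime_divisor Y Q /\ B Q <> 0] ->
  exists D, [/\ is_divisor Y D, forall E, prime_divisor X E -> D (E `&` Ks) = M E
    & forall Q, prime_divisor Y Q -> (exists2 E, prime_divisor X E & Q = E `&` Ks) \/ D Q = B Q].
Proof.
move=> tM [_ Mf] Bf.
have /choice[D hD] : forall Q, exists d : int,
    [/\ d <> 0 -> prime_divisor Y Q,
        forall E, prime_divisor X E -> Q = E `&` Ks -> d = M E
      & prime_divisor Y Q -> (exists2 E, prime_divisor X E & Q = E `&` Ks) \/ d = B Q].
  move=> Q; have [[E hE eQ]|nE] := pselect (exists2 E, prime_divisor X E & Q = E `&` Ks).
    exists (M E); split.
    - by move=> _; rewrite eQ; apply: (quotient_prime_divisor hX XT tauX tau4 unram Y_res X'_res X'Y).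
    - by move=> E' hE' eQ'; apply: tau_invariant_fixed => //; rewrite -eQ.
    - by left; exists E.
  have [hQ|nQ] := pselect (prime_divisor Y Q).
    exists (B Q); split=> // [E hE eQ|]; last by right.
    by case: nE; exists E.
  by exists 0; split=> // E hE eQ; case: nE; exists E.
exists D; split.
- split; first by move=> Q; case: (hD Q).
  pose S1 := (fun E : set K => E `&` Ks) @` [set E | M E <> 0].
  apply: (@sub_finite_set _ _ (S1 `|` [set Q | prime_divisor Y Q /\ B Q <> 0])).
    move=> Q DQ; have [h1 h2 h3] := hD Q; have hQ := h1 DQ.
    case: (h3 hQ) => [[E hE eQ]|eB]; last by right; split=> //; rewrite -eB.
    by left; exists E => //=; rewrite -(h2 E hE eQ).
  by rewrite finite_setU; split=> //; apply: finite_image.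
- by move=> E hE; have [_ h _] := hD (E `&` Ks); apply: h.
- by move=> Q hQ; have [_ _ h] := hD Q; apply: h.
Qed.

(** A power of an invariant uniformizer is a local equation of [D] at the trace of [E]. Since [E] is
    unramified over its trace, any local equation has the same order at both. *)
Lemma rational_pullback_descended D E : prime_divisor X E ->
  rational_pullback X X' Y D E = D (E `&` Ks).
Proof.
move=> hE; have hE' := blowup_prime_divisor hX XT X'_res hE.
have hQ := quotient_prime_divisor hX XT tauX tau4 unram Y_res X'_res X'Y hE.
have [YQ [_ nQ] maxQ] := hQ; have dQ := dvrY hQ.
rewrite /rational_pullback /pushforward_div /pullback_div; do 2 rewrite asboolT //.
have [t [Kt t0 ht]] := unram hE.
set A := [set f | _]; have : A (xget 1 A).
  apply: (@xgetPex _ 1 A); exists (t ^ D (E `&` Ks)), (E `&` Ks) => //; split.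
    exact: dominates_fixed.
  split; [by rewrite expfz_neq0|by rewrite YK; apply: fixed_expz|move=> Q' hQ' sub].
  have -> : Q' = E `&` Ks.
    apply: contrapT => ne; have [YQ' [_ n'] _] := hQ'.
    apply: n'; rewrite -(maxQ _ YQ') //; split=> // sub'.
    by apply: ne; apply/seteqP.
  rewrite -[t ^ _]mulr1.
  exact: (ord_expz dQ _ t0 (fixed_uniformizer Kt t0 ht) (loc_unit1 (dvr_subring dQ))).
move=> [Q YQ' [dom [f0 Kf hf]]].
have eQ := center_on_Y hX XT tauX tau4 unram Y_res hE YQ' dom.
rewrite YK in Kf; rewrite -(quotient_ord hX XT unram hE Kf f0); apply: hf => //.
by rewrite eQ.
Qed.

End Descent.

(** * Eigenspaces as spaces of sections on Y *)

Section Eigenspaces.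
Context {R : realType} {K : fieldType} (iota : {rmorphism R[i] -> K}).
Context (X Y X' : set (set K)) (tau : {rmorphism K -> K}) (L : set K -> int).
Hypothesis hX : smooth_projective_surface iota X.
Hypothesis XT : funfield X = setT.
Hypothesis tauX : automorphism iota X tau.
Hypothesis tau_order4 : has_order4 tau.
Hypothesis unram : forall E, prime_divisor X E ->
  exists t, [/\ tau t = t, t != 0 & maxid E = principal t E].
Hypothesis Y_res : resolution iota (quotient_surface X tau) Y.
Hypothesis X'_res : resolution iota X X'.
Hypothesis X'Y : model_morphism X' Y.
Hypothesis L_div : is_divisor X L.
Hypothesis L_ample : ample iota X L.
Variable g : K.
Hypothesis hg : linearization X tau L g.
Implicit Types (E P Q : set K) (D : set K -> int).

Local Notation Ks := (fixed_field tau).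
Local Notation T := (section_action tau g).

Let tau4 : forall f, iter 4 tau f = f. Proof. by case: tau_order4. Qed.
Let tc c : tau (iota c) = iota c. Proof. by case: tauX. Qed.
Let g0 : g != 0. Proof. by case: hg. Qed.

Lemma ord_iota c E : c != 0 -> prime_divisor X E -> ord E (iota c) = 0.
Proof.
move=> c0 hE; have [XE _ _] := hE; apply: (ord_unit (prime_dvr hX XT hE)).
split; first by rewrite fmorph_eq0.
by rewrite -fmorphV; split; apply: (surface_const hX XE); [exists c|exists c^-1].
Qed.

(** Hilbert 90 for [iota lambda^-1 * g], which inherits the order condition from [g] because
    [lambda ^+ 4 = 1]. *)
Lemma eigensection (lambda : R[i]) : lambda ^+ 4 = 1 ->
  exists2 h, h != 0 & T h = iota lambda * h.
Proof.
move=> l4; have l0 : lambda != 0.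
  by apply: contra_eq_neq l4 => ->; rewrite expr0n eq_sym oner_eq0.
have [_ [f0 nf0]] := tau_order4; have [_ _ T4] := hg.
have [|||h h0 hh] := @hilbert90 _ tau tau4 (iota lambda^-1 * g).
- by exists f0.
- by rewrite mulf_neq0 ?fmorph_eq0 ?invr_eq0.
- move=> f; have := T4 f; rewrite /section_action /= !rmorphM !tc => {2}<-.
  transitivity (iota (lambda^-1 ^+ 4) *
    (g * (tau g * (tau (tau g) * (tau (tau (tau g)) * tau (tau (tau (tau f)))))))).
    by rewrite rmorphXn; ring.
  by rewrite exprVn l4 invr1 rmorph1 mul1r.
by exists h => //; rewrite /section_action -{2}hh !mulrA -rmorphM divff // rmorph1 mul1r.
Qed.

Lemma eigensection_invariant h lambda : lambda != 0 -> h != 0 -> T h = iota lambda * h ->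
  tau_invariant X tau (fun E => L E + ord E h).
Proof.
move=> l0 h0 hh E hE; have dE := prime_dvr hX XT hE.
have [_ /(_ E hE) og _] := hg; rewrite ord_preimage; last exact: tau_bij.
have := congr1 (ord E) hh; rewrite /section_action !(ordM dE) ?fmorph_eq0 //.
rewrite og (ord_iota l0 hE) /aut_pullback_div.
by move: (ord E _) (ord E h) (L E) (L _) => a b c d; lia.
Qed.

Lemma eigensection_quotient h lambda s : lambda != 0 -> h != 0 -> T h = iota lambda * h ->
  T s = iota lambda * s <-> Ks (s / h).
Proof.
move=> l0 h0 hh; have il0 : iota lambda != 0 by rewrite fmorph_eq0.
have eh : tau h = iota lambda * h / g by rewrite -hh /section_action mulrC mulKf.
rewrite /fixed_field /= fmorph_div eh /section_action; split=> [es|].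
  by rewrite -[tau s](mulKf g0) es; field; rewrite g0 h0 il0.
have e0 : iota lambda * h / g != 0 by rewrite !mulf_neq0 ?invr_eq0.
by move/(congr1 (fun z => z * (iota lambda * h / g))); rewrite divfK // => ->; field; rewrite h0 g0.
Qed.

Lemma exists_descended_divisor lambda : lambda ^+ 4 = 1 ->
  exists D, [/\ is_divisor Y D, lin_equiv X (rational_pullback X X' Y D) L
    & pullback_H0 X X' Y D L = section_eigenspace iota X tau L g lambda].
Proof.
move=> l4; have l0 : lambda != 0.
  by apply: contra_eq_neq l4 => ->; rewrite expr0n eq_sym oner_eq0.
have [h h0 hh] := eigensection l4.
have tM := eigensection_invariant l0 h0 hh.
have [B [B0 Bf hB]] := exceptional_bound hX XT tauX tau4 Y_res L_ample h0.
(* [ord E h] is meaningful only at prime divisors, so the divisor is cut off to 0 elsewhere. *)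
have dM : is_divisor X (fun E => if `[< prime_divisor X E >] then L E + ord E h else 0).
  split; first by move=> E; case: asboolP.
  have [Ls Lf] := L_div; have Fh : funfield X h by rewrite XT.
  apply: (@sub_finite_set _ _ ([set E | L E <> 0] `|` [set E | prime_divisor X E /\ ord E h <> 0])).
    move=> E /=; case: asboolP => // hE nz; have [e|/eqP ne] := eqVneq (L E) 0; last by left.
    by right; split=> // e'; apply: nz; rewrite e e'.
  by rewrite finite_setU; split=> //; exact: (finite_support hX Fh h0).
have tM' : tau_invariant X tau (fun E => if `[< prime_divisor X E >] then L E + ord E h else 0).
  move=> E hE; rewrite !asboolT //; first exact: tM.
  exact: (tau_prime_divisor hX XT tauX tau4 hE).
have [D [dD DE DB]] := descend_divisor hX XT tauX tau4 unram Y_res X'_res X'Y tM' dM Bf.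
have {}DE E : prime_divisor X E -> D (E `&` Ks) = L E + ord E h.
  by move=> hE; rewrite DE // asboolT.
have pD E : prime_divisor X E -> rational_pullback X X' Y D E = L E + ord E h.
  move=> hE; rewrite (rational_pullback_descended hX XT tauX tau4 unram Y_res X'_res X'Y) //.
  exact: DE.
have YK := Y_funfield hX XT Y_res.
have H0YD f : H0 Y D f <->
    Ks f /\ (f != 0 -> forall E, prime_divisor X E -> 0 <= ord E f + (L E + ord E h)).
  rewrite /H0 YK; split=> -[Kf hf]; split=> // f0.
    move=> E hE; rewrite -DE // -(quotient_ord hX XT unram hE Kf f0); apply: hf => //.
    exact: (quotient_prime_divisor hX XT tauX tau4 unram Y_res X'_res X'Y).
  move=> Q hQ.
  have lift E : prime_divisor X E -> Q = E `&` Ks -> 0 <= ord Q f + D Q.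
    by move=> hE ->; rewrite DE // (quotient_ord hX XT unram hE Kf f0); apply: hf.
  have [[E hE eQ]|DQ] := DB Q hQ; first exact: lift eQ.
  have [[E hE eQ]|[P CP dom]] := Y_prime_divisor_cases hX XT unram Y_res hQ; first exact: lift eQ.
  by rewrite DQ; apply: (hB P) => //; apply: hf.
exists D; split=> //.
  exists h; first by rewrite XT.
  by move=> E hE; rewrite pD // addrAC subrr add0r.
apply/seteqP; split=> s.
  move=> [f [h' [/H0YD[Kf hf] h'0 hh' ->]]].
  have Fq : funfield X (h' / h) by rewrite XT.
  (* [h'] and [h] have the same divisor on [X], so they differ by a constant. *)
  have [||c c0 ec] := ord0_const hX Fq.
  - by rewrite mulf_neq0 ?invr_eq0.
  - move=> E hE; have dE := prime_dvr hX XT hE.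
    by rewrite (ordM dE) ?invr_eq0 // (ordV dE) // hh' // pD //; ring.
  have eh' : h' = iota c * h by rewrite -ec divfK.
  split; last first.
    apply/(eigensection_quotient _ l0 h0 hh); rewrite eh' mulrA mulfK //.
    by apply: (subringM (fixed_subring tau)) => //; exact: tc.
  split; first by rewrite XT.
  rewrite mulf_eq0 (negPf h'0) orbF => f0 E hE; have dE := prime_dvr hX XT hE.
  by rewrite (ordM dE) // hh' // pD //; have := hf f0 E hE; lia.
move=> [[_ hs] /(eigensection_quotient _ l0 h0 hh) Kq].
exists (s / h), h; split=> //; last by rewrite divfK.
  apply/H0YD; split=> //; rewrite mulf_eq0 invr_eq0 (negPf h0) orbF => s0 E hE.
  have dE := prime_dvr hX XT hE; rewrite (ordM dE) ?invr_eq0 // (ordV dE) //.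
  by have := hs s0 E hE; lia.
by move=> E hE; rewrite pD // addrAC subrr add0r.
Qed.

Lemma linearization_scalar g' : linearization X tau L g' ->
  exists2 c, c ^+ 4 = 1 & g' = iota c * g.
Proof.
move=> [g'0 og' T4']; have [_ og T4] := hg.
have Fq : funfield X (g' / g) by rewrite XT.
have [||c c0 ec] := ord0_const hX Fq.
- by rewrite mulf_neq0 ?invr_eq0.
- move=> E hE; have dE := prime_dvr hX XT hE.
  by rewrite (ordM dE) ?invr_eq0 // (ordV dE) // og // og' // subrr.
have eg : g' = iota c * g by rewrite -ec divfK.
exists c => //; apply: (fmorph_inj iota); rewrite rmorph1.
have := T4' 1; have := T4 1; rewrite eg /section_action /= !rmorphM !rmorph1 !tc !mulr1 => e1 e2.
have : iota c * (iota c * (iota c * iota c)) * (g * (tau g * (tau (tau g) * tau (tau (tau g))))) = 1.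
  by rewrite -[RHS]e2; ring.
by rewrite e1 mulr1.
Qed.

Lemma section_eigenspace_scalar (c lambda : R[i]) : c != 0 ->
  section_eigenspace iota X tau L (iota c * g) (c * lambda) = section_eigenspace iota X tau L g lambda.
Proof.
move=> c0; apply/seteqP; split=> s [hs es]; split=> //; move: es; rewrite /section_action rmorphM -!mulrA.
  by move/(mulfI _); apply; rewrite fmorph_eq0.
by move=> ->.
Qed.

Lemma H0D f f' : H0 X L f -> H0 X L f' -> H0 X L (f + f').
Proof.
move=> [_ hf] [_ hf']; split; first by rewrite XT.
move=> n0 E hE; have dE := prime_dvr hX XT hE; rewrite -lerBlDr sub0r.
by apply: (ordD dE) => // n; rewrite -subr_ge0 opprK; [apply: hf|apply: hf'].
Qed.

Lemma H0Z c f : H0 X L f -> H0 X L (iota c * f).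
Proof.
move=> [_ hf]; split; first by rewrite XT.
rewrite mulf_eq0 fmorph_eq0 negb_or => /andP[c0 f0] E hE.
by rewrite (ordM (prime_dvr hX XT hE)) ?fmorph_eq0 // ord_iota // add0r; apply: hf.
Qed.

Lemma H0_section_action f : H0 X L f -> H0 X L (T f).
Proof.
move=> [_ hf]; split; first by rewrite XT.
rewrite mulf_eq0 fmorph_eq0 negb_or => /andP[_ f0] E hE; have dE := prime_dvr hX XT hE.
have [_ /(_ E hE) og _] := hg.
have := hf f0 _ (tau_prime_divisor hX XT tauX tau4 hE).
rewrite ord_preimage; last exact: tau_bij.
rewrite /section_action (ordM dE) ?fmorph_eq0 // og /aut_pullback_div.
by move: (ord E _) (L E) (L _) => a b c; lia.
Qed.

Lemma section_actionD f f' : T (f + f') = T f + T f'.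
Proof. by rewrite /section_action rmorphD mulrDr. Qed.

Lemma section_actionZ c f : T (iota c * f) = iota c * T f.
Proof. by rewrite /section_action rmorphM tc; ring. Qed.

Let v : K := iota 'i.

Let v2 : v ^+ 2 = -1. Proof. by rewrite -rmorphXn sqrCi rmorphN1. Qed.
Let v0 : v != 0.
Proof. by rewrite fmorph_eq0 -sqrf_eq0 sqrCi oppr_eq0 oner_eq0. Qed.
Let v3 : v ^+ 3 = - v. Proof. by rewrite exprS v2 mulrN1. Qed.
Let four : (4%:R : K) != 0. Proof. by rewrite -(rmorph_nat iota) fmorph_eq0 pnatr_eq0. Qed.

Let sum4 (F : 'I_4 -> K) : \sum_j F j = F (@Ordinal 4 0 isT) + F (@Ordinal 4 1 isT)
  + F (@Ordinal 4 2 isT) + F (@Ordinal 4 3 isT).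
Proof.
rewrite !big_ord_recl big_ord0 addr0 !addrA; do !congr (_ + _);
  by congr F; apply: val_inj.
Qed.

Lemma eigenspace_decomposition s : H0 X L s <-> exists2 w : 'I_4 -> K,
  (forall j : 'I_4, section_eigenspace iota X tau L g ('i ^+ j) (w j)) & s = \sum_j w j.
Proof.
split; last first.
  move=> [w hw ->]; apply: big_ind => [|a b|j _]; [|exact: H0D|by case: (hw j)].
  by split; [rewrite XT|rewrite eqxx].
move=> Hs; have [_ _ T4] := hg.
(* The projector onto the eigenspace of ['i ^+ j]: the average of the powers of [T] weighted by
   inverse powers of the eigenvalue, its inverse being written as its cube. *)
pose w (j : 'I_4) := iota (4%:R^-1) * (s + (iota ('i ^+ j ^+ 3) * T s
  + (iota ('i ^+ j ^+ 2) * T (T s) + iota ('i ^+ j) * T (T (T s))))).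
exists w.
  move=> j; split.
    by apply: H0Z; apply: (H0D) => //; apply: H0D; [|apply: H0D]; apply: H0Z;
      do 3?apply: H0_section_action => //.
  rewrite /w section_actionZ [RHS]mulrCA; congr (_ * _).
  rewrite !section_actionD !section_actionZ; have -> : T (T (T (T s))) = s by exact: T4.
  have x4 : (iota ('i ^+ j)) ^+ 4 = 1.
    by rewrite rmorphXn -exprM mulnC exprM (exprM _ 2 2) v2 expr2 mulrNN mulr1 expr1n.
  rewrite !(rmorphXn _ _ ('i ^+ j)) -[X in X + _ = _]mul1r -x4; ring.
pose F x := 4%:R^-1 * (s + (x ^+ 3 * T s + (x ^+ 2 * T (T s) + x * T (T (T s))))).
have wF j : w j = F (v ^+ j) by rewrite /w fmorphV !rmorphXn rmorph_nat.
rewrite sum4 !wF /= v2 v3 expr0 expr1.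
have -> : F 1 + F v + F (-1) + F (- v) = s + 4%:R^-1 * 2%:R * (1 + v ^+ 2) * T (T s).
  by rewrite /F; field.
by rewrite v2 subrr mulr0 mul0r addr0.
Qed.

Lemma eigenspace_independent (w : 'I_4 -> K) :
  (forall j : 'I_4, section_eigenspace iota X tau L g ('i ^+ j) (w j)) ->
  \sum_j w j = 0 -> forall j, w j = 0.
Proof.
move=> hw; rewrite sum4.
have [_ h0] := hw (@Ordinal 4 0 isT); have [_ h1] := hw (@Ordinal 4 1 isT).
have [_ h2] := hw (@Ordinal 4 2 isT); have [_ h3] := hw (@Ordinal 4 3 isT).
move: h0 h1 h2 h3; rewrite /= !rmorphXn -/v v2 v3 expr0 expr1 mul1r mulN1r mulNr.
set w0 := w (Ordinal _); set w1 := w (Ordinal _); set w2 := w (Ordinal _); set w3 := w (Ordinal _).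
move=> h0 h1 h2 h3 e0.
have T0 : T 0 = 0 by rewrite /section_action rmorph0 mulr0.
have TN a : T (- a) = - T a by rewrite /section_action rmorphN mulrN.
have vv a : v * (v * a) = - a by rewrite mulrA -expr2 v2 mulN1r.
have e1 := congr1 T e0; rewrite T0 !section_actionD h0 h1 h2 h3 in e1.
have e2 := congr1 T e1.
rewrite T0 !section_actionD !TN !section_actionZ h0 h1 h2 h3 -/v mulrN !vv !opprK in e2.
have e3 := congr1 T e2; rewrite T0 !section_actionD !TN h0 h1 h2 h3 in e3.
rewrite opprK in e3.
have zero (a : K) : 4%:R * a = 0 -> a = 0.
  by move/eqP; rewrite mulf_eq0 (negPf four) => /eqP.
(* The sum of the four relations is [4 * w0]; below, their alternating sum is [4 * w2]. *)
have z0 : w0 = 0.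
  apply: zero; rewrite -[RHS](addr0 0) -{1}e0 -[X in _ = _ + X](addr0 0) -{1}e1.
  by rewrite -[X in _ = _ + (_ + X)](addr0 0) -{1}e2 -e3; ring.
have z2 : w2 = 0.
  apply: zero; rewrite -[RHS](subr0 0) -{1}e0 -[X in _ = _ - X](subr0 0) -{1}e1.
  by rewrite -[X in _ = _ - (_ - X)](subr0 0) -{1}e2 -e3; ring.
rewrite z0 z2 add0r subr0 !addr0 ?add0r in e0 e1.
have z1 : w1 = w3 by apply: (mulfI v0); apply/eqP; rewrite -subr_eq0 e1.
have z3 : w3 = 0.
  by apply: zero; rewrite -[RHS]addr0 -{1}e0 -e0 z1; ring.
move=> -[[|[|[|[|j]]]] hj] //; [rewrite -z0|rewrite -z3 -z1|rewrite -z2|rewrite -z3];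
  congr (w _); exact: val_inj.
Qed.

End Eigenspaces.

Lemma primitive_i (C : numClosedFieldType) : 4.-primitive_root ('i : C).
Proof.
have e2 : ('i : C) ^+ 2 = -1 := sqrCi _.
have n11 : (-1 : C) != 1.
  by rewrite eq_sym -subr_eq0 opprK -[1 + 1]/(2%:R) pnatr_eq0.
have e4 : ('i : C) ^+ 4 = 1 by rewrite (exprM _ 2 2) e2 expr2 mulrNN mulr1.
have ni1 : ('i : C) != 1 by apply: contra_neq n11 => i1; rewrite -e2 i1 expr1n.
have ni3 : ('i : C) ^+ 3 != 1.
  by apply: contra_neq ni1 => e3; rewrite -e4 (exprSr _ 3) e3 mul1r.
apply/andP; split=> //; apply/forallP => -[[|[|[|[|k]]]] hk] //=; rewrite unity_rootE.
- by rewrite expr1 (negPf ni1).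
- by rewrite e2 (negPf n11).
- by rewrite (negPf ni3).
- by rewrite e4 !eqxx.
Qed.

Theorem proposition6p1p1 (R : realType) (K : fieldType)
    (iota : {rmorphism R[i] -> K})
    (X : set (set K)) (tau : {rmorphism K -> K}) (L : set K -> int)
    (Y X' : set (set K))
    (X_K3 : projective_K3 iota X)
    (tau_aut : automorphism iota X tau)
    (tau_order4 : has_order4 tau)
    (tau_symplectic : symplectic iota X tau)
    (NS_rank : rank_NS X 15)
    (L_div : is_divisor X L)
    (L_ample : ample iota X L)
    (L_gen : generates_Omega4_perp iota X tau L)
    (Y_minres : minimal_resolution iota (quotient_surface X tau) Y)
    (X'_res : resolution iota X X')
    (X'_to_Y : model_morphism X' Y) :
  (exists g : K, linearization X tau L g) /\
  exists D : 'I_4 -> (set K -> int),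
  [/\ forall j, is_divisor Y (D j),
      forall j, lin_equiv X (rational_pullback X X' Y (D j)) L,
      (forall s : K, H0 X L s <->
         exists2 w : 'I_4 -> K,
           (forall j, pullback_H0 X X' Y (D j) L (w j)) & s = \sum_j w j) /\
      (forall w : 'I_4 -> K,
         (forall j, pullback_H0 X X' Y (D j) L (w j)) ->
         \sum_j w j = 0 -> forall j, w j = 0)
    & forall g : K, linearization X tau L g ->
      exists lambda : 'I_4 -> R[i],
      [/\ injective lambda, forall j, lambda j ^+ 4 = 1
        & forall j, pullback_H0 X X' Y (D j) L =
                    section_eigenspace iota X tau L g (lambda j)]].
Proof.
have [hX XT [w sw] _] := X_K3; have [tau4 _] := tau_order4.
have unram E : prime_divisor X E -> exists t, [/\ tau t = t, t != 0 & maxid E = principal t E].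
  exact: (symplectic_unramified hX XT tau_aut tau_order4 sw (tau_symplectic _ sw)).
have [Y_res _] := Y_minres.
have [g0 hg0] : exists g, linearization X tau L g.
  apply: (exists_linearization hX XT tau_aut tau4).
  (* [L] is 1 times itself, so the generation hypothesis puts it in the orthogonal of Omega_4; its
     transform is then there too, and is a multiple of [L]. *)
  have perpL : Omega4_perp iota X tau L.
    apply/L_gen => //; exists 1; exists 1; first by rewrite oner_eq0 XT.
    by move=> E hE; rewrite (ord1 (prime_dvr hX XT hE)) /scale_div mul1r subrr.
  have [n tauL] := (L_gen _ (is_divisor_aut hX XT tau_aut tau4 L_div)).1
    (Omega4_perp_aut hX XT tau_aut tau4 perpL).
  have n1 := lin_equiv_multiple hX XT tau_aut tau4 L_ample tauL.
  by move: tauL; rewrite n1 /scale_div; under eq_fun do rewrite mul1r.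
split; first by exists g0.
have prim := primitive_i (R[i] : numClosedFieldType).
have i4 (j : 'I_4) : ('i ^+ j : R[i]) ^+ 4 = 1.
  by rewrite -exprM mulnC exprM (prim_expr_order prim) expr1n.
have /choice[D hD] : forall j : 'I_4, exists D, [/\ is_divisor Y D,
    lin_equiv X (rational_pullback X X' Y D) L
    & pullback_H0 X X' Y D L = section_eigenspace iota X tau L g0 ('i ^+ j)].
  move=> j; exact: (exists_descended_divisor hX XT tau_aut tau_order4 unram Y_res X'_res X'_to_Y
    L_div L_ample hg0 (i4 j)).
exists D; split.
- by move=> j; case: (hD j).
- by move=> j; case: (hD j).
- split=> [s|v hv].
    rewrite (eigenspace_decomposition hX XT tau_aut tau_order4 hg0); split=> -[v hv ->];
      exists v => // j; have [_ _ e] := hD j; by [rewrite e|rewrite -e].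
  apply: (eigenspace_independent (g := g0) (L := L) tau_aut) => j; have [_ _ <-] := hD j; exact: hv.
(* Another linearization differs by a fourth root of unity [c], which permutes the eigenvalues and
   leaves the set of eigenspaces unchanged. *)
move=> g hg; have [c c4 ->] := linearization_scalar hX XT tau_aut hg0 hg.
have c0 : c != 0 by apply: contra_eq_neq c4 => ->; rewrite expr0n eq_sym oner_eq0.
exists (fun j => c * 'i ^+ j); split.
- move=> a b /(mulfI c0)/eqP; rewrite (eq_prim_root_expr prim) !modn_small // => /eqP.
  exact: val_inj.
- by move=> j; rewrite exprMn c4 i4 mul1r.
- by move=> j; rewrite section_eigenspace_scalar //; case: (hD j).
Qed.
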